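(* Let $n\in\mathbb N_0$, $x=\cos\theta\in(-1,1)$, $\alpha,\gamma\in(-\frac12,\infty)$, and let $t,\beta,q\in\mathbb C$ with $|t|<1$, $0<|q|<1$. Then $$\int_{-1}^1\frac{(t\beta e^{i\theta},t\beta e^{-i\theta};q)_\infty}{(te^{i\theta},te^{-i\theta};q)_\infty}\,P_n^{(\alpha,\gamma)}(x|q)\,\frac{w(x;\alpha,\gamma;q)}{\sqrt{1-x^2}}\,dx=2\pi\,g_n(\alpha,\gamma;q)\,d_n(\beta,t,\alpha,\gamma;q),$$ where $$d_n(\beta,t,\alpha,\gamma;q)=\frac{(t\alpha^{-\frac12})^n(\beta,-(\alpha\gamma)^{\frac12},-(q\alpha\gamma)^{\frac12};q)_n}{(q^n\alpha\gamma;q)_n}\cdot\frac{(q^n\alpha^{\frac12}\beta t,\,-q^n\gamma^{\frac12}\beta t,\,-q^{n+\frac12}\gamma^{\frac12}\beta t,\,q^{n+\frac12}\alpha^{\frac12}\gamma t;q)_\infty}{(\alpha^{\frac12}t,\,-\gamma^{\frac12}t,\,-(q\gamma)^{\frac12}t,\,q^{2n+\frac12}\alpha^{\frac12}\gamma\beta t;q)_\infty}\,\Phi_n,$$ $$\Phi_n={}_8\phi_7\left(\begin{array}{c}q^{2n-\frac12}\alpha^{\frac12}\gamma\beta t,\ \pm q^{n+\frac34}\alpha^{\frac14}(\gamma\beta t)^{\frac12},\ -q^n(\alpha\gamma)^{\frac12},\ -q^{n+\frac12}(\alpha\gamma)^{\frac12},\ q^{n+\frac12}\gamma,\ (q\alpha)^{-\frac12}\beta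 t,\ q^n\beta\\ \pm q^{n-\frac14}\alpha^{\frac14}(\gamma\beta t)^{\frac12},\ q^n\alpha^{\frac12}\beta t,\ -q^n\gamma^{\frac12}\beta t,\ -q^{n+\frac12}\gamma^{\frac12}\beta t,\ q^{2n+1}\alpha\gamma,\ q^{n+\frac12}\alpha^{\frac12}\gamma t\end{array};q,(q\alpha)^{\frac12}t\right).$$
   Context: In a list of parameters, $\pm c$ stands for the two entries $c,-c$. $q$-Pochhammer symbols: $(a;q)_0=1$, $(a;q)_n=(1-a)(1-aq)\cdots(1-aq^{n-1})$, $(a;q)_\infty=\prod_{n\ge0}(1-aq^n)$, and $(a_1,\ldots,a_r;q)_n=(a_1;q)_n\cdots(a_r;q)_n$ (also for $n=\infty$). Basic hypergeometric series: ${}_r\phi_s\left(\begin{array}{c}a_1,\ldots,a_r\\ b_1,\ldots,b_s\end{array};q,z\right)=\sum_{k=0}^\infty\frac{(a_1,\ldots,a_r;q)_k}{(q,b_1,\ldots,b_s;q)_k}\left((-1)^kq^{\binom k2}\right)^{1+s-r}z^k$. The continuous $q$-Jacobi polynomials, in the rescaled notation where $\alpha,\gamma$ replace what is usually written $q^{\alpha+\frac12},q^{\gamma+\frac12}$, are $P_n^{(\alpha,\gamma)}(x|q)=\frac{(q^{\frac12}\alpha;q)_n}{(q;q)_n}\,{}_4\phi_3\left(\begin{array}{c}q^{-n},\ q^n\alpha\gamma,\ \alpha^{\frac12}e^{i\theta},\ \alpha^{\frac12}e^{-i\theta}\\ q^{\frac12}\alpha,\ -(\alpha\gamma)^{\frac12},\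 -(q\alpha\gamma)^{\frac12}\end{array};q,q\right)$, $x=\cos\theta$. Weight: $w(x;\alpha,\gamma;q)=\left|\frac{(e^{2i\theta};q)_\infty}{(\alpha^{\frac12}e^{i\theta},-\gamma^{\frac12}e^{i\theta};q^{\frac12})_\infty}\right|^2$. The quantity $g_n$, for which $2\pi g_n$ is the squared norm of $P_n^{(\alpha,\gamma)}(x|q)$ with respect to $w(x;\alpha,\gamma;q)/\sqrt{1-x^2}$ on $(-1,1)$, is $$g_n(\alpha,\gamma;q)=\frac{\alpha^n(1-\alpha\gamma)(q^{\frac12}\alpha,q^{\frac12}\gamma,-q(\alpha\gamma)^{\frac12};q)_n\,((\alpha\gamma q)^{\frac12},q(\alpha\gamma)^{\frac12};q)_\infty}{(1-q^{2n}\alpha\gamma)(q,\alpha\gamma,-(\alpha\gamma)^{\frac12};q)_n\,(q,q^{\frac12}\alpha,q^{\frac12}\gamma,-(\alpha\gamma)^{\frac12},-(\alpha\gamma q)^{\frac12};q)_\infty}.$$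
   Formalization: The range α,γ>-1/2 is for the classical parameters (rescaled letters are q^{α+1/2}, q^{γ+1/2}, principal powers); for q not in (0,1) the weight's |F(e^{iθ})|² is read as F(e^{iθ})F(e^{-iθ}); no denominator on the right-hand side vanishes. *)

(* Defs.v *)
(* Stdlib reals with Coquelicot. *)
From Stdlib Require Import Reals List Lra.
From Coquelicot Require Import Coquelicot.
Import ListNotations.
Local Open Scope C_scope.

(** * Elementary complex functions *)

Definition cis (u : R) : C := (cos u, sin u).

(** Principal argument, in (-PI, PI], of a nonzero [z]. *)
Definition carg (z : C) : R :=
  if Rle_dec 0 (Im z) then acos (Re z / Cmod z) else (- acos (Re z / Cmod z))%R.

(** Principal value of [z ^ s] for a real exponent [s] and [z <> 0]. *)
Definition cpow (z : C) (s : R) : C :=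
  RtoC (Rpower (Cmod z) s) * cis (s * carg z).

(** Principal square root; unlike [cpow z (1/2)] it is also correct at 0. *)
Definition csqrt (z : C) : C := RtoC (sqrt (Cmod z)) * cis (carg z / 2).

(** * q-series *)

Fixpoint qpoch (a q : C) (n : nat) : C :=
  match n with
  | O => 1
  | S m => qpoch a q m * (1 - a * q ^ m)
  end.

(** Limit of [qpoch a q n], taken componentwise; it exists when [Cmod q < 1]. *)
Definition qpoch_inf (a q : C) : C :=
  (real (Lim_seq (fun n => Re (qpoch a q n))),
   real (Lim_seq (fun n => Im (qpoch a q n)))).

Definition qpochs (l : list C) (q : C) (n : nat) : C :=
  fold_right (fun a p => qpoch a q n * p) 1 l.

Definition qpochs_inf (l : list C) (q : C) : C :=
  fold_right (fun a p => qpoch_inf a q * p) 1 l.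

(** General term of r-phi-s, for [r <= s + 1] (the subtraction is truncated). *)
Definition qhyp_term (l m : list C) (q z : C) (k : nat) : C :=
  qpochs l q k / qpochs (q :: m) q k
  * ((-1) ^ k * q ^ (k * (k - 1) / 2)) ^ (1 + length m - length l) * z ^ k.

Definition qhyp (l m : list C) (q z : C) : C :=
  (Series (fun k => Re (qhyp_term l m q z k)),
   Series (fun k => Im (qhyp_term l m q z k))).

(** [qpoch b q k <> 0] for every [k] and every [b] in the list; equivalently,
    no factor of [qpoch_inf b q] vanishes. *)
Definition nonvanishing (l : list C) (q : C) : Prop :=
  forall b, In b l -> forall k : nat, b * q ^ k <> 1.

(** * Continuous q-Jacobi polynomials

    Below, [a] and [c] are the classical real parameters.  The rescaled
    parameters are [q ^ (a + 1/2)] and [q ^ (c + 1/2)], and a fractional power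
    of a rescaled parameter is the corresponding principal power of [q]:
    [rpow q a s] is the [s]-th power of [q ^ (a + 1/2)].  In this way the
    square root of a product of rescaled parameters and [q] is the product of
    their square roots, also when [q] is not a positive real. *)
Definition rpow (q : C) (a s : R) : C := cpow q (s * (a + 1 / 2)).

Definition cqJacobi (n : nat) (a c : R) (q : C) (x : R) : C :=
  let th := acos x in
  let A := rpow q a in
  let G := rpow q c in
  qpoch (cpow q (1/2) * A 1) q n / qpoch q q n
  * qhyp [ / q ^ n;
           q ^ n * A 1 * G 1;
           A (1/2)%R * cis th;
           A (1/2)%R * cis (- th) ]
         [ cpow q (1/2) * A 1;
           - (A (1/2)%R * G (1/2)%R);
           - (cpow q (1/2) * A (1/2)%R * G (1/2)%R) ]
         q q.

(** The function whose squared modulus, for [0 < q < 1], is the weight. *)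
Definition weight_amp (a c : R) (q : C) (th : R) : C :=
  qpoch_inf (cis (2 * th)) q
  / qpochs_inf [ rpow q a (1/2) * cis th; - (rpow q c (1/2) * cis th) ]
               (cpow q (1/2)).

(** For complex [q], the squared modulus of a function of [exp(i theta)] is
    read, as usual for Askey-Wilson type weights with complex parameters, as
    the product of its values at [theta] and [- theta]; see [weight_Cmod]. *)
Definition weight (a c : R) (q : C) (x : R) : C :=
  weight_amp a c q (acos x) * weight_amp a c q (- acos x).

Definition gnorm (n : nat) (a c : R) (q : C) : C :=
  let A := rpow q a in
  let G := rpow q c in
  let h := cpow q (1/2) in
  let r := A (1/2)%R * G (1/2)%R in
  (A 1 ^ n * (1 - A 1 * G 1) * qpochs [ h * A 1; h * G 1; - (q * r) ] q n
     * qpochs_inf [ h * r; q * r ] q)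
  / ((1 - q ^ (2 * n) * A 1 * G 1) * qpochs [ q; A 1 * G 1; - r ] q n
     * qpochs_inf [ q; h * A 1; h * G 1; - r; - (h * r) ] q).

(** * The very-well-poised 8-phi-7 and the coefficient *)

Definition Phi_upper (n : nat) (beta t : C) (a c : R) (q : C) : list C :=
  let A := rpow q a in
  let G := rpow q c in
  let N := INR n in
  let s := cpow q (N + 3/4) * A (1/4)%R * csqrt (G 1 * beta * t) in
  [ cpow q (2 * N - 1/2) * A (1/2)%R * G 1 * beta * t;
    s;
    - s;
    - (cpow q N * A (1/2)%R * G (1/2)%R);
    - (cpow q (N + 1/2) * A (1/2)%R * G (1/2)%R);
    cpow q (N + 1/2) * G 1;
    cpow q (- (1/2)) * A (- (1/2))%R * beta * t;
    cpow q N * beta ].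

Definition Phi_lower (n : nat) (beta t : C) (a c : R) (q : C) : list C :=
  let A := rpow q a in
  let G := rpow q c in
  let N := INR n in
  let s := cpow q (N - 1/4) * A (1/4)%R * csqrt (G 1 * beta * t) in
  [ s;
    - s;
    cpow q N * A (1/2)%R * beta * t;
    - (cpow q N * G (1/2)%R * beta * t);
    - (cpow q (N + 1/2) * G (1/2)%R * beta * t);
    cpow q (2 * N + 1) * A 1 * G 1;
    cpow q (N + 1/2) * A (1/2)%R * G 1 * t ].

Definition Phi (n : nat) (beta t : C) (a c : R) (q : C) : C :=
  qhyp (Phi_upper n beta t a c q) (Phi_lower n beta t a c q)
       q (cpow q (1/2) * rpow q a (1/2) * t).

Definition d_lower (n : nat) (beta t : C) (a c : R) (q : C) : list C :=
  let A := rpow q a in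
  let G := rpow q c in
  [ A (1/2)%R * t;
    - (G (1/2)%R * t);
    - (cpow q (1/2) * G (1/2)%R * t);
    cpow q (2 * INR n + 1/2) * A (1/2)%R * G 1 * beta * t ].

Definition dcoef (n : nat) (beta t : C) (a c : R) (q : C) : C :=
  let A := rpow q a in
  let G := rpow q c in
  let N := INR n in
  (t * A (- (1/2))%R) ^ n
  * qpochs [ beta;
             - (A (1/2)%R * G (1/2)%R);
             - (cpow q (1/2) * A (1/2)%R * G (1/2)%R) ] q n
  / qpoch (q ^ n * A 1 * G 1) q n
  * (qpochs_inf [ cpow q N * A (1/2)%R * beta * t;
                  - (cpow q N * G (1/2)%R * beta * t);
                  - (cpow q (N + 1/2) * G (1/2)%R * beta * t);
                  cpow q (N + 1/2) * A (1/2)%R * G 1 * t ] q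
     / qpochs_inf (d_lower n beta t a c q) q)
  * Phi n beta t a c q.

Definition gen_kernel (beta t q : C) (x : R) : C :=
  let th := acos x in
  qpochs_inf [ t * beta * cis th; t * beta * cis (- th) ] q
  / qpochs_inf [ t * cis th; t * cis (- th) ] q.

(** * Sanity check: for [0 < q < 1] the weight is a squared modulus *)

Lemma cis_opp u : cis (- u) = Cconj (cis u).
Proof. unfold cis, Cconj; simpl; now rewrite cos_neg, sin_neg. Qed.

Lemma cpow_pos (q s : R) : (0 < q)%R -> cpow (RtoC q) s = RtoC (Rpower q s).
Proof.
intros Hq; unfold cpow, carg.
rewrite Cmod_R, Rabs_pos_eq by lra; simpl.
destruct (Rle_dec 0 0) as [_|H]; [|lra].
replace (q / q)%R with 1%R by (field; lra).
rewrite acos_1, Rmult_0_r; unfold cis; rewrite cos_0, sin_0.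
apply Cmult_1_r.
Qed.

Lemma qpoch_conj a (q : R) n :
  qpoch (Cconj a) (RtoC q) n = Cconj (qpoch a (RtoC q) n).
Proof.
induction n as [|n IH]; simpl.
- unfold Cconj; simpl; apply injective_projections; simpl; lra.
- rewrite IH, <- RtoC_pow.
  apply injective_projections; simpl; ring.
Qed.

Lemma qpoch_inf_conj a (q : R) :
  qpoch_inf (Cconj a) (RtoC q) = Cconj (qpoch_inf a (RtoC q)).
Proof.
apply injective_projections; unfold qpoch_inf; simpl.
- f_equal; apply Lim_seq_ext; intros n; now rewrite qpoch_conj.
- rewrite <- Rbar_opp_real, <- Lim_seq_opp.
  f_equal; apply Lim_seq_ext; intros n; now rewrite qpoch_conj.
Qed.

Lemma weight_amp_conj a c (q th : R) : (0 < q)%R ->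
  weight_amp a c (RtoC q) (- th) = Cconj (weight_amp a c (RtoC q) th).
Proof.
intros Hq; unfold weight_amp, rpow; simpl.
rewrite !cpow_pos by easy.
replace (2 * - th)%R with (- (2 * th))%R by ring.
rewrite !cis_opp.
assert (E : forall (r : R) z, RtoC r * Cconj z = Cconj (RtoC r * z)).
{ intros r z; apply injective_projections; simpl; ring. }
assert (D : forall z, - Cconj z = Cconj (- z)).
{ intros z; apply injective_projections; simpl; ring. }
rewrite !E, !D, !qpoch_inf_conj.
assert (M : forall z w, Cconj z * Cconj w = Cconj (z * w)).
{ intros z w; apply injective_projections; simpl; ring. }
assert (I : forall z, / Cconj z = Cconj (/ z)).
{ intros z; apply injective_projections; simpl; unfold Rdiv;
    replace (- snd z * (- snd z * 1))%R with (snd z * (snd z * 1))%R by ring;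
    ring. }
rewrite !Cmult_1_r; unfold Cdiv; now rewrite M, I, M.
Qed.

Lemma weight_Cmod a c (q x : R) : (0 < q < 1)%R ->
  weight a c (RtoC q) x = RtoC (Cmod (weight_amp a c (RtoC q) (acos x)) ^ 2).
Proof.
intros Hq; unfold weight; rewrite weight_amp_conj by lra.
set (z := weight_amp _ _ _ _).
unfold Cmod; rewrite pow2_sqrt.
- apply injective_projections; simpl; ring.
- simpl; nra.
Qed.

(* Main.v *)
(** Write h(u) = (u e^(i theta), u e^(-i theta); q)_inf, z = e^(i theta), and let
    a = alpha^(1/2), b = q^(1/2) a, c = - gamma^(1/2), d = q^(1/2) c, r = t beta.  The weight is
    (z^2, z^(-2); q)_inf / (h(a) h(b) h(c) h(d)) and the kernel is h(r) / h(t).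

    The Askey-Wilson integral is evaluated by shifting the contour from |z| = 1 to |z| = |q|:
    for a suitable function the shift yields a first-order q-difference equation in a, which is
    iterated to a = 0; the constant is read off from parameters making the weight a
    trigonometric polynomial.

    For b = r q^m the five-parameter integral of h(r) / (h(a) h(b) h(c) h(d) h(t)) is computed by
    induction on m: the integral and the terminating very-well-poised 8-phi-7 satisfy the same
    contiguous relation, the latter by telescoping.  Both sides are analytic in b and the points
    r q^m accumulate at 0, so the evaluation holds for |b| < 1.

    By Sears' transformation the polynomial may be expanded in (b z, b / z; q)_k.  Integrating
    term by term replaces b by b q^k in the 8-phi-7, and the sum over k is a q-Saalschuetz sum
    which annihilates the first n terms of the series.  This requires r small and nonzero; both
    sides are analytic in r, which removes the restriction.

    Analytic functions are handled as uniform limits of polynomials, and functions on an annulus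
    as uniform limits of Laurent polynomials, so that complex q needs no special treatment. *)

Require Import Defs.
From Stdlib Require Import Reals List Lra Lia Classical.
From Stdlib Require Import IndefiniteDescription FunctionalExtensionality.
From Coquelicot Require Import Coquelicot.
Import ListNotations.
Local Open Scope C_scope.

(** The target 8-phi-7 singles out b and t: its parameters r/b and q^n beta = q^n r/t come from the
    products [bpoch], while a, c, d enter symmetrically. This dictates the base of the expansion. In
    base b the denominators (ba, bc, bd; q)_k of the polynomial cancel against the change of 1/(ab,
    bc, bd; q)_inf under b -> b q^k, and a balanced sum remains. The polynomial is defined in base
    a, hence the need for Sears' transformation.

    The obstacle is poles. Reciprocals enter only as geometric series, so only 1/(x; q)_inf with |x|
    bounded below 1 is directly available. But r = t beta is unrestricted, and the series has poles
    in r at the zeros of (mu r; q)_inf. Multiplying by this factor makes both sides entire in r; the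
    nonvanishing hypotheses of the theorem allow dividing by it at the end.

    Likewise 1/sqrt(1-x^2) is not integrated as it stands: the factor (1-z^2)(1-z^-2) = 4 sin^2
    theta of the weight leaves a continuous function on [-1,1], so that a Riemann integral
    exists. *)

Lemma Cmod_minus_comm (x y : C) : Cmod (x - y) = Cmod (y - x).
Proof. rewrite <- Cmod_opp; f_equal; ring. Qed.

Lemma Cmod_minus_le (x y z : C) : (Cmod (x - z) <= Cmod (x - y) + Cmod (y - z))%R.
Proof.
replace (x - z) with ((x - y) + (y - z)) by ring; apply Cmod_triangle.
Qed.

Lemma Cmod_minus_triangle (x y : C) : (Cmod (x - y) <= Cmod x + Cmod y)%R.
Proof. unfold Cminus; rewrite <- (Cmod_opp y); apply Cmod_triangle. Qed.

Lemma Cmod_minus_ge (x y : C) : (Cmod x - Cmod y <= Cmod (x - y))%R.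
Proof.
enough (Cmod x <= Cmod (x - y) + Cmod y)%R by lra.
replace x with ((x - y) + y) at 1 by ring; apply Cmod_triangle.
Qed.

Lemma Cmod_lt_neq (x y : C) : (Cmod x < Cmod y)%R -> x <> y.
Proof. intros H ->; lra. Qed.

Lemma Cminus_neq0 (x y : C) : x <> y -> x - y <> 0.
Proof. intros H E; apply H; replace x with (x - y + y) by ring; rewrite E; ring. Qed.

Lemma Cmod_small_eq0 (x : C) : (forall eps : R, (0 < eps)%R -> (Cmod x <= eps)%R) -> x = 0.
Proof.
intros H; apply Cmod_eq_0.
destruct (Rle_lt_or_eq_dec 0 (Cmod x) (Cmod_ge_0 x)) as [L|L]; auto.
specialize (H (Cmod x / 2)%R); lra.
Qed.

(** * Limits of complex sequences *)

(** Componentwise like [qpoch_inf], so that [qpoch_inf a q] is convertible to [Clim (qpoch a q)] and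
    convergence results apply to it directly. *)
Definition Clim (u : nat -> C) : C :=
  (real (Lim_seq (fun n => Re (u n))), real (Lim_seq (fun n => Im (u n)))).

Definition Ccv (u : nat -> C) (l : C) : Prop :=
  forall eps : R, (0 < eps)%R -> exists N, forall n, (N <= n)%nat -> (Cmod (u n - l) < eps)%R.

Lemma im_le_Cmod (c : C) : (Rabs (Im c) <= Cmod c)%R.
Proof. apply Rle_trans with (2 := Rmax_Cmod c); apply Rmax_r. Qed.

Lemma Ccv_Re u l : Ccv u l -> is_lim_seq (fun n => Re (u n)) (Re l).
Proof.
intros H; apply is_lim_seq_spec; intros eps.
destruct (H eps (cond_pos eps)) as [N HN]; exists N; intros n Hn.
apply Rle_lt_trans with (2 := HN n Hn).
exact (re_le_Cmod (u n - l)).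
Qed.

Lemma Ccv_Im u l : Ccv u l -> is_lim_seq (fun n => Im (u n)) (Im l).
Proof.
intros H; apply is_lim_seq_spec; intros eps.
destruct (H eps (cond_pos eps)) as [N HN]; exists N; intros n Hn.
apply Rle_lt_trans with (2 := HN n Hn).
exact (im_le_Cmod (u n - l)).
Qed.

Lemma Ccv_Clim u l : Ccv u l -> Clim u = l.
Proof.
intros H; unfold Clim.
rewrite (is_lim_seq_unique _ _ (Ccv_Re _ _ H)), (is_lim_seq_unique _ _ (Ccv_Im _ _ H)).
destruct l; reflexivity.
Qed.

Lemma Ccv_unique u l l' : Ccv u l -> Ccv u l' -> l = l'.
Proof. intros H H'; rewrite <- (Ccv_Clim _ _ H); now apply Ccv_Clim. Qed.

Lemma Ccv_ext u v l : (forall n, u n = v n) -> Ccv u l -> Ccv v l.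
Proof.
intros E H eps He; destruct (H eps He) as [N HN]; exists N; intros n Hn.
rewrite <- E; auto.
Qed.

Lemma Ccv_const c : Ccv (fun _ => c) c.
Proof. intros eps He; exists O; intros n _; replace (c - c) with (RtoC 0) by ring; now rewrite Cmod_0. Qed.

Lemma Ccv_subseq u l (s : nat -> nat) : (forall n, (n <= s n)%nat) -> Ccv u l -> Ccv (fun n => u (s n)) l.
Proof.
intros Hs H eps He; destruct (H eps He) as [N HN]; exists N; intros n Hn.
apply HN; specialize (Hs n); lia.
Qed.

Lemma Ccv_plus u v l m : Ccv u l -> Ccv v m -> Ccv (fun n => u n + v n) (l + m).
Proof.
intros H1 H2 eps He.
destruct (H1 (eps / 2)%R) as [N1 HN1]; [lra|].
destruct (H2 (eps / 2)%R) as [N2 HN2]; [lra|].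
exists (N1 + N2)%nat; intros n Hn.
replace (u n + v n - (l + m)) with ((u n - l) + (v n - m)) by ring.
apply Rle_lt_trans with (1 := Cmod_triangle _ _).
specialize (HN1 n ltac:(lia)); specialize (HN2 n ltac:(lia)); lra.
Qed.

Lemma Ccv_mult u v l m : Ccv u l -> Ccv v m -> Ccv (fun n => u n * v n) (l * m).
Proof.
intros H1 H2 eps He.
set (B := (Cmod l + Cmod m + 1)%R).
assert (HB : (1 <= B)%R) by (unfold B; generalize (Cmod_ge_0 l) (Cmod_ge_0 m); lra).
destruct (H1 (Rmin 1 (eps / (2 * B)))%R) as [N1 HN1].
{ apply Rmin_case; [lra|]. apply Rdiv_lt_0_compat; lra. }
destruct (H2 (Rmin 1 (eps / (2 * B)))%R) as [N2 HN2].
{ apply Rmin_case; [lra|]. apply Rdiv_lt_0_compat; lra. }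
exists (N1 + N2)%nat; intros n Hn.
specialize (HN1 n ltac:(lia)); specialize (HN2 n ltac:(lia)).
assert (E1 := Rlt_le_trans _ _ _ HN1 (Rmin_r _ _)).
assert (E2 := Rlt_le_trans _ _ _ HN2 (Rmin_r _ _)).
assert (E3 := Rlt_le_trans _ _ _ HN2 (Rmin_l _ _)).
replace (u n * v n - l * m) with ((u n - l) * v n + l * (v n - m)) by ring.
apply Rle_lt_trans with (1 := Cmod_triangle _ _); rewrite !Cmod_mult.
assert (Hv : (Cmod (v n) <= Cmod m + 1)%R) by (generalize (Cmod_minus_ge (v n) m); lra).
assert (D : (eps / (2 * B) * B = eps / 2)%R) by (field; lra).
generalize (Cmod_ge_0 (u n - l)) (Cmod_ge_0 (v n)) (Cmod_ge_0 l) (Cmod_ge_0 m) (Cmod_ge_0 (v n - m)); intros.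
assert (Cmod (u n - l) * Cmod (v n) <= eps / (2 * B) * (Cmod m + 1))%R by (apply Rmult_le_compat; lra).
assert (Cmod l * Cmod (v n - m) <= Cmod l * (eps / (2 * B)))%R by (apply Rmult_le_compat_l; lra).
assert (X : (0 < eps / (2 * B))%R) by (apply Rdiv_lt_0_compat; lra).
assert (eps / (2*B) * (Cmod m + 1) + Cmod l * (eps / (2 * B)) = eps / (2 * B) * B)%R by (unfold B; ring).
lra.
Qed.

Lemma Ccv_scal c u l : Ccv u l -> Ccv (fun n => c * u n) (c * l).
Proof. intros H; apply (Ccv_mult (fun _ => c)); auto using Ccv_const. Qed.

Lemma geom_small B kappa eps : (0 <= kappa < 1)%R -> (0 < eps)%R ->
  exists N, forall n, (N <= n)%nat -> (B * kappa ^ n < eps)%R.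
Proof.
intros Hk He.
assert (L : is_lim_seq (fun n => (B * kappa ^ n)%R) 0%R).
{ replace (Finite 0) with (Rbar_mult B 0%R) by (simpl; f_equal; ring).
  apply is_lim_seq_scal_l, is_lim_seq_geom; rewrite Rabs_pos_eq; lra. }
apply is_lim_seq_spec in L; destruct (L (mkposreal eps He)) as [N HN]; exists N; intros n Hn.
specialize (HN n Hn); simpl in HN; rewrite Rminus_0_r in HN.
apply Rle_lt_trans with (2 := HN), Rle_abs.
Qed.

Lemma Ccv_le u l K kappa : (0 <= kappa < 1)%R ->
  (forall n, (Cmod (u n - l) <= K * kappa ^ n)%R) -> Ccv u l.
Proof.
intros Hk H eps He; destruct (geom_small K kappa eps Hk He) as [N HN]; exists N; intros n Hn.
apply Rle_lt_trans with (1 := H n); auto.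
Qed.

(** The partial geometric sum is kept exact in the bound, so that the induction step closes with an
    equality; bounding it by a multiple of [kappa ^ n] at once would not carry the induction. *)
Lemma geom_tail u K kappa : (0 <= kappa < 1)%R ->
  (forall n, (Cmod (u (S n) - u n) <= K * kappa ^ n)%R) ->
  forall n m, (Cmod (u (n + m)%nat - u n) <= K / (1 - kappa) * (kappa ^ n - kappa ^ (n + m)))%R.
Proof.
intros Hk H n m; induction m as [|m IH].
- rewrite Nat.add_0_r; replace (u n - u n) with (RtoC 0) by ring; rewrite Cmod_0; lra.
- apply Rle_trans with (1 := Cmod_minus_le _ (u (n + m)%nat) _).
  rewrite Nat.add_succ_r.
  specialize (H (n + m)%nat).
  apply Rle_trans with (1 := Rplus_le_compat _ _ _ _ H IH); right.
  simpl; field; lra.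
Qed.

(** Cauchy's criterion with a rate. The error depends only on [K] and [kappa], so convergence is
    uniform in every parameter for which these can be fixed; infinite products and series both get
    their limits from here. *)
Lemma Clim_geom u K kappa : (0 <= kappa < 1)%R ->
  (forall n, (Cmod (u (S n) - u n) <= K * kappa ^ n)%R) ->
  forall n, (Cmod (u n - Clim u) <= K / (1 - kappa) * kappa ^ n)%R.
Proof.
intros Hk H.
assert (HK : (0 <= K)%R).
{ specialize (H O); simpl in H; generalize (Cmod_ge_0 (u 1%nat - u O)); lra. }
assert (HKk : (0 <= K / (1 - kappa))%R).
{ apply Rmult_le_pos; [lra|]; left; apply Rinv_0_lt_compat; lra. }
assert (T : forall n m, (n <= m)%nat -> (Cmod (u m - u n) <= K / (1 - kappa) * kappa ^ n)%R).
{ intros n m L; replace m with (n + (m - n))%nat by lia.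
  apply Rle_trans with (1 := geom_tail u K kappa Hk H n (m - n)).
  apply Rmult_le_compat_l; auto.
  generalize (pow_le kappa (n + (m - n)) (proj1 Hk)); lra. }
assert (Z : forall eps : R, (0 < eps)%R -> exists N, forall n m, (N <= n)%nat -> (N <= m)%nat ->
   (Cmod (u m - u n) < eps)%R).
{ intros eps He.
  destruct (geom_small (K / (1 - kappa)) kappa eps Hk He) as [N HN]; exists N; intros n m Hn Hm.
  assert (G : forall n m, (N <= n)%nat -> (n <= m)%nat -> (Cmod (u m - u n) < eps)%R).
  { intros n' m' Hn' L'; apply Rle_lt_trans with (1 := T n' m' L'); auto. }
  destruct (Nat.le_ge_cases n m); [now apply G|].
  rewrite Cmod_minus_comm; now apply G. }
assert (CR : ex_finite_lim_seq (fun n => Re (u n))).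
{ apply ex_lim_seq_cauchy_corr; intros eps.
  destruct (Z eps (cond_pos eps)) as [N HN]; exists N; intros n m Hn Hm.
  apply Rle_lt_trans with (2 := HN m n Hm Hn); exact (re_le_Cmod (u n - u m)). }
assert (CI : ex_finite_lim_seq (fun n => Im (u n))).
{ apply ex_lim_seq_cauchy_corr; intros eps.
  destruct (Z eps (cond_pos eps)) as [N HN]; exists N; intros n m Hn Hm.
  apply Rle_lt_trans with (2 := HN m n Hm Hn); exact (im_le_Cmod (u n - u m)). }
destruct CR as [x Hx], CI as [y Hy].
assert (E : Clim u = (x, y)).
{ unfold Clim; now rewrite (is_lim_seq_unique _ _ Hx), (is_lim_seq_unique _ _ Hy). }
assert (CV : Ccv u (x, y)).
{ intros eps He.
  apply is_lim_seq_spec in Hx; apply is_lim_seq_spec in Hy.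
  assert (He2 : (0 < eps / 2)%R) by lra.
  destruct (Hx (mkposreal _ He2)) as [N1 H1], (Hy (mkposreal _ He2)) as [N2 H2].
  exists (N1 + N2)%nat; intros n Hn.
  specialize (H1 n ltac:(lia)); specialize (H2 n ltac:(lia)); simpl in H1, H2.
  apply Rle_lt_trans with (1 := Cmod_2Rmax _).
  assert (M : (Rmax (Rabs (fst (u n - (x, y))%C)) (Rabs (snd (u n - (x, y))%C)) < eps / 2)%R).
  { apply Rmax_case; [exact H1 | exact H2]. }
  assert (S2 : (sqrt 2 <= 2)%R).
  { apply Rsqr_incr_0_var; [|lra]. rewrite Rsqr_sqrt; unfold Rsqr; lra. }
  assert (0 <= Rmax (Rabs (fst (u n - (x, y))%C)) (Rabs (snd (u n - (x, y))%C)))%R.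
  { apply Rle_trans with (2 := Rmax_l _ _), Rabs_pos. }
  nra. }
intros n; rewrite E.
apply le_epsilon; intros eps He.
destruct (CV eps He) as [N HN].
apply Rle_trans with (1 := Cmod_minus_le _ (u (n + N)%nat) _).
rewrite Cmod_minus_comm.
specialize (T n (n + N)%nat ltac:(lia)); specialize (HN (n + N)%nat ltac:(lia)); lra.
Qed.

(** * q-shifted factorials *)

Lemma exp_le x y : (x <= y)%R -> (exp x <= exp y)%R.
Proof.
intros [H| ->]; [left; now apply exp_increasing|apply Rle_refl].
Qed.

Lemma qpoch_add a q m n : qpoch a q (m + n) = qpoch a q m * qpoch (a * q ^ m) q n.
Proof.
induction n as [|n IH]; simpl; [rewrite Nat.add_0_r; ring|].
rewrite Nat.add_succ_r; simpl; rewrite IH, Cpow_add_r; ring.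
Qed.

Lemma qpoch_Sl a q n : qpoch a q (S n) = (1 - a) * qpoch (a * q) q n.
Proof.
replace (S n) with (1 + n)%nat by lia; rewrite qpoch_add; simpl.
replace (a * (q * 1)) with (a * q) by ring; ring.
Qed.

Lemma qpoch_0l q n : qpoch 0 q n = 1.
Proof. induction n as [|n IH]; simpl; [easy|rewrite IH; ring]. Qed.

Lemma qpoch_neq0 a q n : (forall k, (k < n)%nat -> a * q ^ k <> 1) -> qpoch a q n <> 0.
Proof.
induction n as [|n IH]; intros H; simpl.
- intros E; injection E; lra.
- apply Cmult_neq_0; [apply IH; intros; apply H; lia|].
  apply Cminus_neq0; intros E; apply (H n); auto.
Qed.

Lemma Cmod_mult_lt1 x y : (Cmod x < 1)%R -> (Cmod y < 1)%R -> (Cmod (x * y) < 1)%R.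
Proof.
intros; rewrite Cmod_mult; generalize (Cmod_ge_0 x) (Cmod_ge_0 y); nra.
Qed.

Section QSeries.
Variable q : C.
Hypothesis Hq : (Cmod q < 1)%R.

Lemma Cmod_q_range : (0 <= Cmod q < 1)%R.
Proof. split; [apply Cmod_ge_0 | exact Hq]. Qed.

Lemma Cmod_mult_qpow_le a k : (Cmod (a * q ^ k) <= Cmod a)%R.
Proof.
rewrite Cmod_mult, Cmod_pow.
assert (H := Cmod_q_range).
assert (P : (Cmod q ^ k <= 1)%R).
{ rewrite <- (pow1 k); apply pow_incr; lra. }
rewrite <- (Rmult_1_r (Cmod a)) at 2; apply Rmult_le_compat_l; [apply Cmod_ge_0|exact P].
Qed.

Lemma Cmod_mult_qpow_lt1 x k : (Cmod x < 1)%R -> (Cmod (x * q ^ k) < 1)%R.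
Proof. intros H; apply Rle_lt_trans with (2 := H); apply Cmod_mult_qpow_le. Qed.

Lemma mult_qpow_neq1 a k : (Cmod a < 1)%R -> a * q ^ k <> 1.
Proof.
intros H; apply Cmod_lt_neq; rewrite Cmod_1.
apply Rle_lt_trans with (2 := H), Cmod_mult_qpow_le.
Qed.

Lemma qpoch_neq0_small a n : (Cmod a < 1)%R -> qpoch a q n <> 0.
Proof. intros H; apply qpoch_neq0; intros; now apply mult_qpow_neq1. Qed.

(** Each factor is at most 1 + R |q|^k <= exp(R |q|^k). The partial geometric sum stays in the
    exponent during the induction and is bounded by 1/(1-|q|) only at the end. *)
Lemma qpoch_bound R a n : (Cmod a <= R)%R ->
  (Cmod (qpoch a q n) <= exp (R / (1 - Cmod q)))%R.
Proof.
intros H; assert (K := Cmod_q_range).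
assert (HR : (0 <= R)%R) by (generalize (Cmod_ge_0 a); lra).
apply Rle_trans with (exp (R * ((1 - Cmod q ^ n) / (1 - Cmod q)))).
- induction n as [|n IH]; simpl.
  + rewrite Cmod_1; replace (R * ((1 - 1) / (1 - Cmod q)))%R with 0%R by (field; lra).
    rewrite exp_0; lra.
  + rewrite Cmod_mult.
    replace (R * ((1 - Cmod q * Cmod q ^ n) / (1 - Cmod q)))%R
      with (R * ((1 - Cmod q ^ n) / (1 - Cmod q)) + R * Cmod q ^ n)%R by (field; lra).
    rewrite exp_plus; apply Rmult_le_compat; auto using Cmod_ge_0.
    apply Rle_trans with (1 + R * Cmod q ^ n)%R; [|apply exp_ineq1_le].
    apply Rle_trans with (1 := Cmod_minus_triangle _ _).
    rewrite Cmod_1, Cmod_mult, Cmod_pow.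
    apply Rplus_le_compat_l, Rmult_le_compat_r; [apply pow_le; lra | exact H].
- apply exp_le, Rmult_le_compat_l; auto.
  unfold Rdiv; rewrite <- (Rmult_1_l (/ (1 - Cmod q))) at 2.
  apply Rmult_le_compat_r; [left; apply Rinv_0_lt_compat; lra|].
  generalize (pow_le (Cmod q) n (proj1 K)); lra.
Qed.

(** Rests on 1 - x >= exp(-x/(1-s)) for 0 <= x <= s < 1, which follows from (1 + x/(1-s))(1-x) >= 1.
    A lower bound independent of [n] is what makes reciprocals of infinite products uniform
    limits. *)
Lemma qpoch_lower s a n : (s < 1)%R -> (Cmod a <= s)%R ->
  (exp (- (s / (1 - s) / (1 - Cmod q))) <= Cmod (qpoch a q n))%R.
Proof.
intros Hs H; assert (K := Cmod_q_range).
assert (HR : (0 <= s)%R) by (generalize (Cmod_ge_0 a); lra).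
set (R := (s / (1 - s))%R).
assert (HR' : (0 <= R)%R).
{ apply Rmult_le_pos; auto; left; apply Rinv_0_lt_compat; lra. }
apply Rle_trans with (exp (- (R * ((1 - Cmod q ^ n) / (1 - Cmod q))))).
- apply exp_le, Ropp_le_contravar; unfold Rdiv at 2; apply Rmult_le_compat_l; auto.
  unfold Rdiv; rewrite <- (Rmult_1_l (/ (1 - Cmod q))) at 2.
  apply Rmult_le_compat_r; [left; apply Rinv_0_lt_compat; lra|].
  generalize (pow_le (Cmod q) n (proj1 K)); lra.
- induction n as [|n IH]; simpl.
  + rewrite Cmod_1; replace (R * ((1 - 1) / (1 - Cmod q)))%R with 0%R by (field; lra).
    rewrite Ropp_0, exp_0; lra.
  + rewrite Cmod_mult.
    replace (- (R * ((1 - Cmod q * Cmod q ^ n) / (1 - Cmod q))))%R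
      with (- (R * ((1 - Cmod q ^ n) / (1 - Cmod q))) + - (R * Cmod q ^ n))%R by (field; lra).
    rewrite exp_plus; apply Rmult_le_compat; auto; try (left; apply exp_pos).
    set (x := (s * Cmod q ^ n)%R).
    assert (Hp : (0 <= Cmod q ^ n <= 1)%R).
    { split; [apply pow_le; lra|rewrite <- (pow1 n); apply pow_incr; lra]. }
    assert (Hx : (0 <= x <= s)%R) by (unfold x; nra).
    apply Rle_trans with (1 - x)%R.
    2:{ generalize (Cmod_minus_ge 1 (a * q ^ n)).
        rewrite Cmod_1, Cmod_mult, Cmod_pow; unfold x.
        assert (Cmod a * Cmod q ^ n <= s * Cmod q ^ n)%R by (apply Rmult_le_compat_r; lra); lra. }
    rewrite exp_Ropp.
    apply Rmult_le_reg_l with (exp (R * Cmod q ^ n)); [apply exp_pos|].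
    rewrite Rinv_r by (apply Rgt_not_eq, exp_pos).
    apply Rle_trans with ((1 + R * Cmod q ^ n) * (1 - x))%R.
    2:{ apply Rmult_le_compat_r; [lra|apply exp_ineq1_le]. }
    replace (R * Cmod q ^ n)%R with (x / (1 - s))%R by (unfold x, R; field; lra).
    apply Rmult_le_reg_r with (1 - s)%R; [lra|].
    replace ((1 + x / (1 - s)) * (1 - x) * (1 - s))%R with ((1 - s + x) * (1 - x))%R by (field; lra).
    nra.
Qed.

Definition qpoch_err (B : R) : R := (exp (B / (1 - Cmod q)) * B / (1 - Cmod q))%R.

Lemma qpoch_inf_err R a n : (Cmod a <= R)%R ->
  (Cmod (qpoch a q n - qpoch_inf a q) <= qpoch_err R * Cmod q ^ n)%R.
Proof.
intros H; unfold qpoch_err.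
apply (Clim_geom (qpoch a q) (exp (R / (1 - Cmod q)) * R) (Cmod q) Cmod_q_range).
intros m; simpl.
replace (qpoch a q m * (1 - a * q ^ m) - qpoch a q m) with (- (qpoch a q m * (a * q ^ m))) by ring.
rewrite Cmod_opp, !Cmod_mult, Cmod_pow, <- Rmult_assoc.
apply Rmult_le_compat_r; [apply pow_le, Cmod_ge_0|].
apply Rmult_le_compat; auto using Cmod_ge_0, qpoch_bound.
Qed.

Lemma qpoch_cv a : Ccv (qpoch a q) (qpoch_inf a q).
Proof.
apply (Ccv_le _ _ (qpoch_err (Cmod a)) (Cmod q) Cmod_q_range).
intros n; apply qpoch_inf_err; lra.
Qed.

Lemma qpoch_inf_split a n : qpoch_inf a q = qpoch a q n * qpoch_inf (a * q ^ n) q.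
Proof.
apply (Ccv_unique (fun m => qpoch a q (n + m))).
- apply (Ccv_subseq (qpoch a q)); [intros; lia|apply qpoch_cv].
- apply Ccv_ext with (fun m => qpoch a q n * qpoch (a * q ^ n) q m).
  { intros m; now rewrite qpoch_add. }
  apply Ccv_scal, qpoch_cv.
Qed.

Lemma qpoch_inf_S a : qpoch_inf a q = (1 - a) * qpoch_inf (a * q) q.
Proof. rewrite (qpoch_inf_split a 1); simpl; f_equal; [ring|f_equal; ring]. Qed.

Lemma qpoch_inf_0 : qpoch_inf 0 q = 1.
Proof.
apply (Ccv_unique (qpoch 0 q)); [apply qpoch_cv|].
apply Ccv_ext with (fun _ => RtoC 1); [intros; now rewrite qpoch_0l|apply Ccv_const].
Qed.

Lemma qpoch_inf_bound R a : (Cmod a <= R)%R ->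
  (Cmod (qpoch_inf a q) <= exp (R / (1 - Cmod q)))%R.
Proof.
intros H; apply le_epsilon; intros eps He.
destruct (qpoch_cv a eps He) as [N HN]; specialize (HN N (Nat.le_refl _)).
generalize (qpoch_bound R a N H) (Cmod_minus_ge (qpoch_inf a q) (qpoch a q N)).
rewrite Cmod_minus_comm; lra.
Qed.

Lemma qpoch_inf_lower s a : (s < 1)%R -> (Cmod a <= s)%R ->
  (exp (- (s / (1 - s) / (1 - Cmod q))) <= Cmod (qpoch_inf a q))%R.
Proof.
intros Hs H; apply le_epsilon; intros eps He.
destruct (qpoch_cv a eps He) as [N HN]; specialize (HN N (Nat.le_refl _)).
generalize (qpoch_lower s a N Hs H) (Cmod_minus_ge (qpoch a q N) (qpoch_inf a q)); lra.
Qed.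

Lemma qpoch_inf_neq0_small a : (Cmod a < 1)%R -> qpoch_inf a q <> 0.
Proof.
intros H E; generalize (qpoch_inf_lower (Cmod a) a H (Rle_refl _)).
rewrite E, Cmod_0; generalize (exp_pos (- (Cmod a / (1 - Cmod a) / (1 - Cmod q)))); lra.
Qed.

(** After finitely many factors the argument a q^n has modulus below 1, where the lower bound
    applies; the factors split off are nonzero by hypothesis. *)
Lemma qpoch_inf_neq0 a : (forall k, a * q ^ k <> 1) -> qpoch_inf a q <> 0.
Proof.
intros H.
assert (L : exists n, (Cmod (a * q ^ n) < 1)%R).
{ destruct (Ccv_le (fun n => a * q ^ n) 0 (Cmod a) (Cmod q) Cmod_q_range) with (eps := 1%R) as [N HN].
  - intros n; replace (a * q ^ n - 0) with (a * q ^ n) by ring.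
    rewrite Cmod_mult, Cmod_pow; lra.
  - lra.
  - exists N; specialize (HN N (Nat.le_refl _)).
    now replace (a * q ^ N - 0) with (a * q ^ N) in HN by ring. }
destruct L as [n Hn]; rewrite (qpoch_inf_split a n).
apply Cmult_neq_0; [apply qpoch_neq0; auto|now apply qpoch_inf_neq0_small].
Qed.

Lemma qpoch_mult_neq0 u v n : (Cmod u < 1)%R -> (Cmod v < 1)%R -> qpoch (u * v) q n <> 0.
Proof. intros; now apply qpoch_neq0_small, Cmod_mult_lt1. Qed.

Lemma qpoch_inf_mult_neq0 u v : (Cmod u < 1)%R -> (Cmod v < 1)%R -> qpoch_inf (u * v) q <> 0.
Proof. intros; now apply qpoch_inf_neq0_small, Cmod_mult_lt1. Qed.

End QSeries.

Lemma qpoch_dup a h n :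
  qpoch a (h * h) n * qpoch (a * h) (h * h) n = qpoch a h (2 * n).
Proof.
induction n as [|n IH]; [simpl; ring|].
replace (2 * S n)%nat with (S (S (2 * n))) by lia.
cbn [qpoch]; rewrite <- IH.
replace ((h * h) ^ n) with (h ^ (2 * n)) by (rewrite Cpow_mult_r; f_equal; simpl; ring).
rewrite Cpow_S; ring.
Qed.

Lemma qpoch_sq a q n : qpoch a q n * qpoch (- a) q n = qpoch (a * a) (q * q) n.
Proof.
induction n as [|n IH]; [simpl; ring|].
cbn [qpoch]; rewrite <- IH, Cpow_mult_l; ring.
Qed.

Lemma Cmod_sq_lt1 (h : C) : (Cmod h < 1)%R -> (Cmod (h * h) < 1)%R.
Proof. intros H; rewrite Cmod_mult; generalize (Cmod_ge_0 h); nra. Qed.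

(** Relates base h to base h^2. It passes between q^(1/2) and q in the weight and, with q in the
    role of h, between q and q^2 in the evaluation of constants. *)
Lemma qpoch_inf_dup a h : (Cmod h < 1)%R ->
  qpoch_inf a (h * h) * qpoch_inf (a * h) (h * h) = qpoch_inf a h.
Proof.
intros H; assert (H2 := Cmod_sq_lt1 h H).
apply (Ccv_unique (fun n => qpoch a h (2 * n))).
- eapply Ccv_ext; [intros n; apply qpoch_dup|].
  apply Ccv_mult; now apply qpoch_cv.
- apply (Ccv_subseq (qpoch a h)); [intros; lia|now apply qpoch_cv].
Qed.

Lemma qpoch_inf_sq a q : (Cmod q < 1)%R ->
  qpoch_inf a q * qpoch_inf (- a) q = qpoch_inf (a * a) (q * q).
Proof.
intros H; assert (H2 := Cmod_sq_lt1 q H).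
apply (Ccv_unique (fun n => qpoch (a * a) (q * q) n)).
- eapply Ccv_ext; [intros n; apply qpoch_sq|].
  apply Ccv_mult; now apply qpoch_cv.
- now apply qpoch_cv.
Qed.

(** * Uniform closure of an algebra of functions *)

Section UniformClosure.
Variables (X : Type) (K : X -> Prop) (M : (X -> C) -> Prop).
Hypothesis M_const : forall c, M (fun _ => c).
Hypothesis M_mult : forall f g, M f -> M g -> M (fun x => f x * g x).
Hypothesis M_bounded : forall f, M f -> exists B, forall x, K x -> (Cmod (f x) <= B)%R.

(** Instantiated with Laurent monomials on an annulus, with monomials on a disc, and with monomials
    whose coefficients depend on an angle. [span_ext] compares functions on [K] only, so values
    outside, such as reciprocals at 0, do not matter. *)
Inductive span : (X -> C) -> Prop :=
| span_base f : M f -> span f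
| span_plus f g : span f -> span g -> span (fun x => f x + g x)
| span_ext f g : span f -> (forall x, K x -> f x = g x) -> span g.

Definition uclos (f : X -> C) : Prop :=
  forall eps : R, (0 < eps)%R ->
  exists p, span p /\ forall x, K x -> (Cmod (f x - p x) <= eps)%R.

Lemma span_mult f g : span f -> span g -> span (fun x => f x * g x).
Proof.
intros Hf; revert g; induction Hf as [f Hf|f1 f2 _ IH1 _ IH2|f f' _ IH E]; intros g Hg.
- induction Hg as [g Hg|g1 g2 _ IH1 _ IH2|g g' _ IH E].
  + now apply span_base, M_mult.
  + apply span_ext with (fun x => f x * g1 x + f x * g2 x); [now apply span_plus|].
    intros x _; ring.
  + apply span_ext with (1 := IH); intros x Hx; now rewrite E.
- apply span_ext with (fun x => f1 x * g x + f2 x * g x); [apply span_plus; auto|].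
  intros x _; ring.
- apply span_ext with (1 := IH g Hg); intros x Hx; now rewrite E.
Qed.

Lemma span_bounded f : span f -> exists B, forall x, K x -> (Cmod (f x) <= B)%R.
Proof.
induction 1 as [f Hf|f g _ [B1 IH1] _ [B2 IH2]|f g _ [B IH] E].
- now apply M_bounded.
- exists (B1 + B2)%R; intros x Hx; apply Rle_trans with (1 := Cmod_triangle _ _).
  specialize (IH1 x Hx); specialize (IH2 x Hx); lra.
- exists B; intros x Hx; rewrite <- E; auto.
Qed.

Lemma uclos_span f : span f -> uclos f.
Proof.
intros H eps He; exists f; split; auto; intros x _.
replace (f x - f x) with (RtoC 0) by ring; rewrite Cmod_0; lra.
Qed.

Lemma uclos_base f : M f -> uclos f.
Proof. intros H; now apply uclos_span, span_base. Qed.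

Lemma uclos_const c : uclos (fun _ => c).
Proof. now apply uclos_base. Qed.

Lemma uclos_ext f g : uclos f -> (forall x, K x -> f x = g x) -> uclos g.
Proof.
intros H E eps He; destruct (H eps He) as [p [Hp Hf]]; exists p; split; auto.
intros x Hx; rewrite <- E; auto.
Qed.

Lemma uclos_bounded f : uclos f -> exists B, (0 < B)%R /\ forall x, K x -> (Cmod (f x) <= B)%R.
Proof.
intros H; destruct (H 1%R Rlt_0_1) as [p [Hp Hf]].
destruct (span_bounded p Hp) as [B HB]; exists (Rabs B + 1)%R; split.
{ generalize (Rabs_pos B); lra. }
intros x Hx; specialize (Hf x Hx); specialize (HB x Hx).
generalize (Cmod_minus_ge (f x) (p x)) (Rle_abs B); lra.
Qed.

Lemma uclos_plus f g : uclos f -> uclos g -> uclos (fun x => f x + g x).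
Proof.
intros Hf Hg eps He.
destruct (Hf (eps / 2)%R) as [p [Hp Ef]]; [lra|].
destruct (Hg (eps / 2)%R) as [r [Hr Eg]]; [lra|].
exists (fun x => p x + r x); split; [now apply span_plus|].
intros x Hx; replace (f x + g x - (p x + r x)) with ((f x - p x) + (g x - r x)) by ring.
apply Rle_trans with (1 := Cmod_triangle _ _).
specialize (Ef x Hx); specialize (Eg x Hx); lra.
Qed.

Lemma uclos_mult f g : uclos f -> uclos g -> uclos (fun x => f x * g x).
Proof.
intros Hf Hg eps He.
destruct (uclos_bounded g Hg) as [B [HB Bg]].
destruct (Hf (eps / (2 * B))%R) as [p [Hp Ef]]; [apply Rdiv_lt_0_compat; lra|].
destruct (uclos_bounded p (uclos_span p Hp)) as [A [HA Bp]].
destruct (Hg (eps / (2 * A))%R) as [r [Hr Eg]]; [apply Rdiv_lt_0_compat; lra|].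
exists (fun x => p x * r x); split; [now apply span_mult|].
intros x Hx.
replace (f x * g x - p x * r x) with ((f x - p x) * g x + p x * (g x - r x)) by ring.
apply Rle_trans with (1 := Cmod_triangle _ _); rewrite !Cmod_mult.
specialize (Ef x Hx); specialize (Eg x Hx); specialize (Bg x Hx); specialize (Bp x Hx).
assert (Cmod (f x - p x) * Cmod (g x) <= eps / (2 * B) * B)%R
  by (apply Rmult_le_compat; auto using Cmod_ge_0).
assert (Cmod (p x) * Cmod (g x - r x) <= A * (eps / (2 * A)))%R
  by (apply Rmult_le_compat; auto using Cmod_ge_0).
replace (eps / (2 * B) * B)%R with (eps / 2)%R in * by (field; lra).
replace (A * (eps / (2 * A)))%R with (eps / 2)%R in * by (field; lra).
lra.
Qed.

Lemma uclos_opp f : uclos f -> uclos (fun x => - f x).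
Proof.
intros H; apply uclos_ext with (fun x => - (1) * f x).
- apply uclos_mult; auto using uclos_const.
- intros; ring.
Qed.

Lemma uclos_minus f g : uclos f -> uclos g -> uclos (fun x => f x - g x).
Proof. intros Hf Hg; apply uclos_plus; auto using uclos_opp. Qed.

Lemma uclos_pow f n : uclos f -> uclos (fun x => f x ^ n).
Proof.
intros H; induction n as [|n IH]; simpl; [apply uclos_const|now apply uclos_mult].
Qed.

Lemma uclos_lim f (g : nat -> X -> C) B kappa : (0 <= kappa < 1)%R ->
  (forall n, uclos (g n)) ->
  (forall n x, K x -> (Cmod (f x - g n x) <= B * kappa ^ n)%R) -> uclos f.
Proof.
intros Hk Hg H eps He.
assert (He2 : (0 < eps / 2)%R) by lra.
destruct (geom_small B kappa _ Hk He2) as [N HN]; specialize (HN N (Nat.le_refl _)).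
destruct (Hg N (eps / 2)%R He2) as [p [Hp E]]; exists p; split; auto.
intros x Hx; apply Rle_trans with (1 := Cmod_minus_le _ (g N x) _).
specialize (E x Hx); specialize (H N x Hx); lra.
Qed.

(** The partial geometric sums [g n] satisfy (1 - u) g n = 1 - u^n. All reciprocals in the closure
    come from this one, hence the recurring condition that arguments of inverted q-products be
    bounded by some s < 1. *)
Lemma uclos_inv_1m u s : (0 <= s < 1)%R -> uclos u -> (forall x, K x -> (Cmod (u x) <= s)%R) ->
  uclos (fun x => / (1 - u x)).
Proof.
intros Hs Hu Hb.
set (g := fix g n x := match n with O => RtoC 0 | S m => g m x + u x ^ m end).
assert (Hg : forall n x, (1 - u x) * g n x = 1 - u x ^ n).
{ intros n x; induction n as [|n IH]; simpl; [ring|].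
  rewrite Cmult_plus_distr_l, IH; ring. }
apply uclos_lim with g (/ (1 - s))%R s; auto.
- induction n as [|n IH]; simpl; [apply uclos_const|].
  apply uclos_plus; [exact IH|now apply uclos_pow].
- intros n x Hx; specialize (Hb x Hx).
  assert (L : (1 - s <= Cmod (1 - u x))%R).
  { generalize (Cmod_minus_ge 1 (u x)); rewrite Cmod_1; lra. }
  assert (N : 1 - u x <> 0) by (apply Cmod_gt_0; lra).
  replace (/ (1 - u x) - g n x) with (/ (1 - u x) * u x ^ n).
  2:{ replace (g n x) with (/ (1 - u x) * ((1 - u x) * g n x)) by (field; auto).
      rewrite Hg; field; auto. }
  rewrite Cmod_mult, Cmod_pow, Cmod_inv by auto.
  apply Rmult_le_compat.
  + left; apply Rinv_0_lt_compat; lra.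
  + apply pow_le, Cmod_ge_0.
  + apply Rinv_le_contravar; lra.
  + apply pow_incr; split; auto using Cmod_ge_0.
Qed.

Variable q : C.
Hypothesis Hq : (Cmod q < 1)%R.

Lemma uclos_qpoch u n : uclos u -> uclos (fun x => qpoch (u x) q n).
Proof.
intros H; induction n as [|n IH]; simpl; [apply uclos_const|].
apply uclos_mult; auto.
apply uclos_minus; [apply uclos_const|].
apply uclos_mult; auto using uclos_const.
Qed.

Lemma uclos_qpoch_inf u : uclos u -> uclos (fun x => qpoch_inf (u x) q).
Proof.
intros H; destruct (uclos_bounded u H) as [B [HB Bu]].
apply uclos_lim with (fun n x => qpoch (u x) q n) (qpoch_err q B) (Cmod q).
- now apply Cmod_q_range.
- intros n; now apply uclos_qpoch.
- intros n x Hx; rewrite Cmod_minus_comm; apply qpoch_inf_err; auto.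
Qed.

Lemma uclos_inv_qpoch u s n : (s < 1)%R -> uclos u -> (forall x, K x -> (Cmod (u x) <= s)%R) ->
  uclos (fun x => / qpoch (u x) q n).
Proof.
intros Hs Hu Hb.
(* If s < 0, the bound on |u x| says that no point satisfies [K]. *)
destruct (Rle_lt_dec 0 s) as [Hs0|Hs0].
2:{ apply uclos_ext with (fun _ => 0); [apply uclos_const|].
    intros x Hx; specialize (Hb x Hx); generalize (Cmod_ge_0 (u x)); lra. }
induction n as [|n IH]; simpl.
- apply uclos_const.
- apply uclos_ext with (fun x => / qpoch (u x) q n * / (1 - u x * q ^ n)).
  + apply uclos_mult; auto.
    apply (uclos_inv_1m (fun x => u x * q ^ n) s); auto.
    * apply uclos_mult; auto using uclos_const.
    * intros x Hx; apply Rle_trans with (2 := Hb x Hx); now apply Cmod_mult_qpow_le.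
  + intros x Hx; specialize (Hb x Hx); field; split.
    * apply Cminus_neq0, not_eq_sym, mult_qpow_neq1; auto; lra.
    * apply qpoch_neq0_small; auto; lra.
Qed.

(** The reciprocals of the finite products converge uniformly because finite and infinite products
    are bounded below by the same constant [L]. *)
Lemma uclos_inv_qpoch_inf u s : (s < 1)%R -> uclos u -> (forall x, K x -> (Cmod (u x) <= s)%R) ->
  uclos (fun x => / qpoch_inf (u x) q).
Proof.
intros Hs Hu Hb.
set (L := exp (- (s / (1 - s) / (1 - Cmod q)))).
assert (HL : (0 < L)%R) by apply exp_pos.
apply uclos_lim with (fun n x => / qpoch (u x) q n) (/ L * / L * qpoch_err q s)%R (Cmod q).
- now apply Cmod_q_range.
- intros n; now apply uclos_inv_qpoch with s.
- intros n x Hx; specialize (Hb x Hx).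
  assert (N1 : qpoch (u x) q n <> 0) by (apply qpoch_neq0_small; auto; lra).
  assert (N2 : qpoch_inf (u x) q <> 0) by (apply qpoch_inf_neq0_small; auto; lra).
  replace (/ qpoch_inf (u x) q - / qpoch (u x) q n)
    with (/ qpoch_inf (u x) q * / qpoch (u x) q n * (qpoch (u x) q n - qpoch_inf (u x) q))
    by (field; auto).
  rewrite !Cmod_mult, !Cmod_inv by auto.
  assert (E1 := qpoch_inf_lower q Hq s (u x) Hs Hb).
  assert (E2 := qpoch_lower q Hq s (u x) n Hs Hb).
  assert (E3 := qpoch_inf_err q Hq s (u x) n Hb).
  fold L in E1, E2.
  assert (P : forall y, (L <= y)%R -> (0 <= / y <= / L)%R).
  { intros y Hy; split; [left; apply Rinv_0_lt_compat; lra|apply Rinv_le_contravar; lra]. }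
  rewrite !Rmult_assoc.
  apply Rmult_le_compat; try apply P; auto.
  { apply Rmult_le_pos; [apply P; auto|apply Cmod_ge_0]. }
  apply Rmult_le_compat; try apply P; auto using Cmod_ge_0.
Qed.

End UniformClosure.

(** * Complex integrals over the circle *)

Definition is_CInt (f : R -> C) (a b : R) (l : C) : Prop :=
  is_RInt (V := C_R_NormedModule) f a b l.

Lemma is_CInt_pair (f : R -> C) a b l :
  is_RInt (fun x => Re (f x)) a b (Re l) -> is_RInt (fun x => Im (f x)) a b (Im l) ->
  is_CInt f a b l.
Proof.
intros H1 H2; destruct l as [l1 l2]; unfold is_CInt.
exact (is_RInt_fct_extend_pair (U := R_NormedModule) (V := R_NormedModule) f a b l1 l2 H1 H2).
Qed.

Lemma is_CInt_Re f a b l : is_CInt f a b l -> is_RInt (fun x => Re (f x)) a b (Re l).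
Proof.
intros H; exact (is_RInt_fct_extend_fst (U := R_NormedModule) (V := R_NormedModule) f a b l H).
Qed.

Lemma is_CInt_Im f a b l : is_CInt f a b l -> is_RInt (fun x => Im (f x)) a b (Im l).
Proof.
intros H; exact (is_RInt_fct_extend_snd (U := R_NormedModule) (V := R_NormedModule) f a b l H).
Qed.

Lemma is_CInt_plus f g a b l m : is_CInt f a b l -> is_CInt g a b m ->
  is_CInt (fun x => f x + g x) a b (l + m).
Proof. intros H1 H2; exact (is_RInt_plus (V := C_R_NormedModule) f g a b l m H1 H2). Qed.

Lemma is_CInt_ext f g a b l : (forall x, f x = g x) -> is_CInt f a b l -> is_CInt g a b l.
Proof. intros E H; apply (is_RInt_ext (V := C_R_NormedModule) f); auto. Qed.

Lemma is_CInt_scal c f a b l : is_CInt f a b l -> is_CInt (fun x => c * f x) a b (c * l).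
Proof.
intros H; assert (HR := is_CInt_Re _ _ _ _ H); assert (HI := is_CInt_Im _ _ _ _ H).
apply is_CInt_pair; simpl.
- apply (is_RInt_minus (V := R_NormedModule));
    apply (is_RInt_scal (V := R_NormedModule)); assumption.
- apply (is_RInt_plus (V := R_NormedModule));
    apply (is_RInt_scal (V := R_NormedModule)); assumption.
Qed.

Lemma is_CInt_minus f g a b l m : is_CInt f a b l -> is_CInt g a b m ->
  is_CInt (fun x => f x - g x) a b (l - m).
Proof.
intros H1 H2.
replace (l - m) with (l + - (1) * m) by ring.
apply is_CInt_ext with (fun x => f x + - (1) * g x); [intros; ring|].
apply is_CInt_plus; auto; now apply is_CInt_scal.
Qed.

Lemma is_CInt_const c a b : is_CInt (fun _ => c) a b (RtoC (b - a) * c).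
Proof.
apply is_CInt_pair; simpl.
- replace ((b - a) * fst c - 0 * snd c)%R with (scal (b - a)%R (fst c)).
  + apply (is_RInt_const (V := R_NormedModule)).
  + unfold scal; simpl; unfold mult; simpl; ring.
- replace ((b - a) * snd c + 0 * fst c)%R with (scal (b - a)%R (snd c)).
  + apply (is_RInt_const (V := R_NormedModule)).
  + unfold scal; simpl; unfold mult; simpl; ring.
Qed.

Lemma is_CInt_unique f a b l m : is_CInt f a b l -> is_CInt f a b m -> l = m.
Proof.
intros H1 H2.
rewrite <- (is_RInt_unique (V := C_R_CompleteNormedModule) f a b l H1).
now apply (is_RInt_unique (V := C_R_CompleteNormedModule)).
Qed.

Local Notation Ccontinuous := (continuous (T := R_UniformSpace) (U := C_R_NormedModule)).

Lemma is_CInt_continuous f a b :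
  (forall x, Ccontinuous f x) -> exists l, is_CInt f a b l.
Proof.
intros H; apply (ex_RInt_continuous (V := C_R_CompleteNormedModule) f a b); intros z _; apply H.
Qed.

(** The factor 2 comes from bounding real and imaginary parts separately. *)
Lemma is_CInt_norm f a b l B : (a <= b)%R -> (forall x, (Cmod (f x) <= B)%R) ->
  is_CInt f a b l -> (Cmod l <= 2 * ((b - a) * B))%R.
Proof.
intros Hab Hf H.
assert (E : forall g m, (forall x, (Rabs (g x) <= B)%R) -> is_RInt g a b m -> (Rabs m <= (b - a) * B)%R).
{ intros g m Hg Hm.
  apply (norm_RInt_le_const (V := R_NormedModule) g a b m B Hab); auto. }
assert (E1 : (Rabs (Re l) <= (b - a) * B)%R).
{ apply (E (fun x => Re (f x))); [|now apply is_CInt_Re].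
  intros x; apply Rle_trans with (2 := Hf x), re_le_Cmod. }
assert (E2 : (Rabs (Im l) <= (b - a) * B)%R).
{ apply (E (fun x => Im (f x))); [|now apply is_CInt_Im].
  intros x; apply Rle_trans with (2 := Hf x), im_le_Cmod. }
replace l with (RtoC (Re l) + Ci * RtoC (Im l)) by (destruct l; unfold Cplus, Cmult; simpl; f_equal; ring).
apply Rle_trans with (1 := Cmod_triangle _ _).
rewrite Cmod_mult, !Cmod_R, Cmod_Ci; lra.
Qed.

Lemma is_CInt_lim (g : nat -> R -> C) (f : R -> C) (I : nat -> C) a b :
  (forall n, is_CInt (g n) a b (I n)) ->
  (forall eps, (0 < eps)%R -> exists N, forall n x, (N <= n)%nat -> (Cmod (g n x - f x) < eps)%R) ->
  exists l, Ccv I l /\ is_CInt f a b l.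
Proof.
intros HI Hu.
destruct (filterlim_RInt (V := C_R_CompleteNormedModule) g a b eventually
            eventually_filter f I HI) as [l [Hl1 Hl2]].
- intros P [eps HP]; destruct (Hu eps (cond_pos eps)) as [N HN].
  exists N; intros n Hn; apply HP; intros x.
  specialize (HN n x Hn); split.
  + exact (Rle_lt_trans _ _ _ (re_le_Cmod (g n x - f x)) HN).
  + exact (Rle_lt_trans _ _ _ (im_le_Cmod (g n x - f x)) HN).
- exists l; split; auto.
  intros eps He.
  assert (He2 : (0 < eps / 2)%R) by lra.
  assert (B := Hl1 (ball (M := C_R_CompleteNormedModule) l (mkposreal _ He2)) (locally_ball _ _)).
  destruct B as [N HN]; exists N; intros n Hn.
  destruct (HN n Hn) as [B1 B2].
  change (Rabs (Re (I n - l)) < eps / 2)%R in B1.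
  change (Rabs (Im (I n - l)) < eps / 2)%R in B2.
  set (w := I n - l) in *.
  replace w with (RtoC (Re w) + Ci * RtoC (Im w)) by (destruct w; unfold Cplus, Cmult; simpl; f_equal; ring).
  apply Rle_lt_trans with (1 := Cmod_triangle _ _).
  rewrite Cmod_mult, !Cmod_R, Cmod_Ci; lra.
Qed.

Lemma cis_plus a b : cis (a + b) = cis a * cis b.
Proof. unfold cis, Cmult; simpl; rewrite cos_plus, sin_plus; f_equal; ring. Qed.

Lemma cis_0 : cis 0 = 1.
Proof. unfold cis; now rewrite cos_0, sin_0. Qed.

Lemma Cmod_cis u : Cmod (cis u) = 1%R.
Proof.
unfold cis, Cmod; simpl; rewrite !Rmult_1_r.
generalize (sin2_cos2 u); unfold Rsqr; intros E; rewrite Rplus_comm, E; apply sqrt_1.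
Qed.

Lemma cis_neq0 u : cis u <> 0.
Proof. apply Cmod_gt_0; rewrite Cmod_cis; lra. Qed.

Lemma cis_inv u : / cis u = cis (- u).
Proof.
assert (E : cis u * cis (- u) = 1) by (rewrite <- cis_plus, Rplus_opp_r; apply cis_0).
replace (cis (- u)) with (/ cis u * (cis u * cis (- u))) by (field; apply cis_neq0).
rewrite E; ring.
Qed.

Lemma cis_pow u n : cis u ^ n = cis (INR n * u).
Proof.
induction n as [|n IH]; [simpl; now rewrite Rmult_0_l, cis_0|].
rewrite Cpow_S, IH, S_INR, <- cis_plus; f_equal; ring.
Qed.

Lemma is_CInt_cis_mult x : x <> 0%R -> sin (x * (2 * PI)) = 0%R -> cos (x * (2 * PI)) = 1%R ->
  is_CInt (fun th => cis (x * th)) 0 (2 * PI) 0.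
Proof.
intros Hx Hs Hc; apply is_CInt_pair; simpl.
- replace 0%R with (minus (sin (x * (2 * PI)) / x)%R (sin (x * 0) / x)%R) at 2.
  2:{ rewrite Hs, Rmult_0_r, sin_0; unfold minus, plus, opp; simpl; field; auto. }
  apply (is_RInt_derive (V := R_CompleteNormedModule) (fun th => (sin (x * th) / x)%R)).
  + intros y _; auto_derive; auto; field; auto.
  + intros y _; apply (ex_derive_continuous (V := R_NormedModule)); auto_derive; auto.
- replace 0%R with (minus (- cos (x * (2 * PI)) / x)%R (- cos (x * 0) / x)%R) at 2.
  2:{ rewrite Hc, Rmult_0_r, cos_0; unfold minus, plus, opp; simpl; field; auto. }
  apply (is_RInt_derive (V := R_CompleteNormedModule) (fun th => (- cos (x * th) / x)%R)).
  + intros y _; auto_derive; auto; field; auto.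
  + intros y _; apply (ex_derive_continuous (V := R_NormedModule)); auto_derive; auto.
Qed.

Lemma cis_2PI_nat n : cis (INR n * (2 * PI)) = 1.
Proof.
rewrite <- cis_pow; replace (cis (2 * PI)) with (RtoC 1); [apply Cpow_1_l|].
unfold cis; now rewrite cos_2PI, sin_2PI.
Qed.

(** A difference of naturals stands for an integer frequency, matching the pair of exponents of a
    Laurent monomial. *)
Lemma is_CInt_cis_nat k m : k <> m ->
  is_CInt (fun th => cis ((INR k - INR m) * th)) 0 (2 * PI) 0.
Proof.
intros H.
assert (E : cis ((INR k - INR m) * (2 * PI)) = 1).
{ replace ((INR k - INR m) * (2 * PI))%R with (INR k * (2 * PI) + - (INR m * (2 * PI)))%R by ring.
  rewrite cis_plus, <- cis_inv, !cis_2PI_nat; field. }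
apply is_CInt_cis_mult.
- intros E'; apply H, INR_eq; lra.
- exact (f_equal Im E).
- exact (f_equal Re E).
Qed.

(** * Contour shift *)

(** Two natural exponents instead of one integer: closure under products is then addition of
    exponents, at the price of a non-unique representation. *)
Definition is_laurent_mono (f : C -> C) : Prop :=
  exists c (k m : nat), forall z, f z = c * z ^ k * (/ z) ^ m.

Lemma laurent_mono_const c : is_laurent_mono (fun _ => c).
Proof. exists c, O, O; intros z; simpl; ring. Qed.

Lemma laurent_mono_mult f g : is_laurent_mono f -> is_laurent_mono g ->
  is_laurent_mono (fun z => f z * g z).
Proof.
intros [c [k [m Hf]]] [d [k' [m' Hg]]]; exists (c * d), (k + k')%nat, (m + m')%nat.
intros z; rewrite Hf, Hg, !Cpow_add_r; ring.
Qed.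

Definition annulus (s : R) (z : C) : Prop := (s <= Cmod z <= 1)%R.

Lemma laurent_mono_bounded s f : (0 < s)%R -> is_laurent_mono f ->
  exists B, forall z, annulus s z -> (Cmod (f z) <= B)%R.
Proof.
intros Hs [c [k [m Hf]]]; exists (Cmod c * 1 * (/ s) ^ m)%R; intros z [H1 H2].
rewrite Hf, !Cmod_mult, !Cmod_pow.
assert (Hz : z <> 0) by (apply Cmod_gt_0; lra).
rewrite Cmod_inv by auto.
apply Rmult_le_compat.
- apply Rmult_le_pos; [apply Cmod_ge_0|apply pow_le, Cmod_ge_0].
- apply pow_le; left; apply Rinv_0_lt_compat; lra.
- apply Rmult_le_compat_l; [apply Cmod_ge_0|].
  rewrite <- (pow1 k); apply pow_incr; split; auto using Cmod_ge_0.
- apply pow_incr; split; [left; apply Rinv_0_lt_compat; lra|].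
  apply Rinv_le_contravar; auto.
Qed.

Definition laurent (s : R) := uclos C (annulus s) is_laurent_mono.

(** Cauchy's theorem for Laurent polynomials, by orthogonality: on each circle only the monomials
    with equal exponents contribute, and these are constants, so the integral does not depend on the
    radius. *)
Lemma laurent_span_int s p : (0 < s)%R -> span C (annulus s) is_laurent_mono p ->
  exists I, forall w, annulus s w -> is_CInt (fun th => p (w * cis th)) 0 (2 * PI) I.
Proof.
intros Hs; induction 1 as [f [c [k [m Hf]]]|f g _ [I1 H1] _ [I2 H2]|f g _ [I H] E].
- exists (if Nat.eq_dec k m then RtoC (2 * PI) * c else 0); intros w [Hw _].
  assert (Hw0 : w <> 0) by (apply Cmod_gt_0; lra).
  apply is_CInt_ext with (fun th => c * w ^ k * (/ w) ^ m * cis ((INR k - INR m) * th)).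
  { intros th; rewrite Hf.
    replace (/ (w * cis th)) with (/ w * / cis th) by (field; auto using cis_neq0).
    replace ((INR k - INR m) * th)%R with (INR k * th + INR m * - th)%R by ring.
    rewrite cis_plus, <- !cis_pow, <- cis_inv, !Cpow_mult_l; ring. }
  destruct (Nat.eq_dec k m) as [->|N].
  + apply is_CInt_ext with (fun _ => c).
    { intros th; replace ((INR m - INR m) * th)%R with 0%R by ring; rewrite cis_0.
      replace (c * w ^ m * (/ w) ^ m * 1) with (c * (w ^ m * (/ w) ^ m)) by ring.
      rewrite <- Cpow_mult_l, Cinv_r, Cpow_1_l by auto; ring. }
    replace (2 * PI)%R with (2 * PI - 0)%R at 2 by ring; apply is_CInt_const.
  + replace (RtoC 0) with (c * w ^ k * (/ w) ^ m * 0) by ring.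
    now apply is_CInt_scal, is_CInt_cis_nat.
- exists (I1 + I2); intros w Hw; apply is_CInt_plus; auto.
- exists I; intros w Hw; apply is_CInt_ext with (2 := H w Hw); intros th; apply E.
  unfold annulus in *; rewrite Cmod_mult, Cmod_cis; lra.
Qed.

(** The approximants have integrals [I n] common to all circles of the annulus, and one sequence has
    one limit. This is the contour shift. *)
Lemma laurent_int s f : (0 < s <= 1)%R -> laurent s f ->
  exists I, forall w, annulus s w -> is_CInt (fun th => f (w * cis th)) 0 (2 * PI) I.
Proof.
intros Hs Hf.
assert (P : forall n : nat, exists p, span C (annulus s) is_laurent_mono p /\
              forall z, annulus s z -> (Cmod (f z - p z) <= / (INR n + 1))%R).
{ intros n; apply Hf; apply Rinv_0_lt_compat; generalize (pos_INR n); lra. }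
apply functional_choice in P; destruct P as [p Hp].
assert (Q : forall n : nat, exists I, forall w, annulus s w -> is_CInt (fun th => p n (w * cis th)) 0 (2 * PI) I).
{ intros n; apply laurent_span_int; [lra|]; apply Hp. }
apply functional_choice in Q; destruct Q as [I HI].
assert (L : forall w, annulus s w -> exists l, Ccv I l /\ is_CInt (fun th => f (w * cis th)) 0 (2 * PI) l).
{ intros w Hw; apply is_CInt_lim with (fun n th => p n (w * cis th)).
  - intros n; now apply HI.
  - intros eps He.
    destruct (archimed_cor1 eps He) as [N [HN HN0]]; exists N; intros n th Hn.
    rewrite Cmod_minus_comm.
    assert (Ha : annulus s (w * cis th)) by (unfold annulus in *; rewrite Cmod_mult, Cmod_cis; lra).
    apply Rle_lt_trans with (1 := proj2 (Hp n) _ Ha).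
    apply Rle_lt_trans with (2 := HN); apply Rinv_le_contravar.
    + apply lt_0_INR; lia.
    + generalize (le_INR _ _ Hn); lra. }
assert (H1 : annulus s 1) by (unfold annulus; rewrite Cmod_1; lra).
destruct (L 1 H1) as [l [Hl _]]; exists l; intros w Hw.
destruct (L w Hw) as [l' [Hl' H']]; now rewrite (Ccv_unique _ _ _ Hl Hl').
Qed.

(** * Finite sums *)

Fixpoint csum (f : nat -> C) (n : nat) : C :=
  match n with O => 0 | S m => csum f m + f m end.

Lemma csum_ext (f g : nat -> C) n : (forall k, (k < n)%nat -> f k = g k) -> csum f n = csum g n.
Proof.
induction n as [|n IH]; intros H; simpl; [easy|].
rewrite IH by (intros; apply H; lia); rewrite H by lia; easy.
Qed.

Lemma csum_plus f g n : csum (fun k => f k + g k) n = csum f n + csum g n.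
Proof. induction n as [|n IH]; simpl; [ring|rewrite IH; ring]. Qed.

Lemma csum_scal c f n : csum (fun k => c * f k) n = c * csum f n.
Proof. induction n as [|n IH]; simpl; [ring|rewrite IH; ring]. Qed.

Lemma csum_zero (f : nat -> C) n : (forall k, (k < n)%nat -> f k = 0) -> csum f n = 0.
Proof.
induction n as [|n IH]; intros H; simpl; [easy|].
rewrite IH, H by (intros; try apply H; lia); ring.
Qed.

Lemma csum_add f n m : csum f (n + m) = csum f n + csum (fun k => f (n + k)%nat) m.
Proof.
induction m as [|m IH]; [rewrite Nat.add_0_r; simpl; ring|].
rewrite Nat.add_succ_r; simpl; rewrite IH; ring.
Qed.

Lemma csum_Sl f n : csum f (S n) = f O + csum (fun k => f (S k)) n.
Proof. change (S n) with (1 + n)%nat; rewrite csum_add; simpl; ring. Qed.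

Lemma csum_exchange f n m :
  csum (fun i => csum (fun j => f i j) m) n = csum (fun j => csum (fun i => f i j) n) m.
Proof.
induction n as [|n IH]; simpl.
- symmetry; now apply csum_zero.
- now rewrite IH, <- csum_plus.
Qed.

Lemma csum_triangle f n :
  csum (fun k => csum (fun j => f k j) (S k)) n
  = csum (fun j => csum (fun m => f (j + m)%nat j) (n - j)) n.
Proof.
induction n as [|n IH]; [easy|].
assert (E : csum (fun j => csum (fun m => f (j + m)%nat j) (S n - j)) n
            = csum (fun j => csum (fun m => f (j + m)%nat j) (n - j) + f n j) n).
{ apply csum_ext; intros j Hj.
  replace (S n - j)%nat with (S (n - j)) by lia; cbn [csum].
  now replace (j + (n - j))%nat with n by lia. }
change (csum (fun k => csum (fun j => f k j) (S k)) n + csum (fun j => f n j) (S n)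
  = csum (fun j => csum (fun m => f (j + m)%nat j) (S n - j)) n
    + csum (fun m => f (n + m)%nat n) (S n - n)).
rewrite IH, E, csum_plus; replace (S n - n)%nat with 1%nat by lia.
cbn [csum]; rewrite Nat.add_0_r.
change (csum (fun j => f n j) n) with (csum (f n) n); ring.
Qed.

(** * Power series on a disc: integrals with a parameter and an identity theorem *)

Definition is_mono (f : C -> C) : Prop := exists c (k : nat), forall z, f z = c * z ^ k.

Definition cdisc (rho : R) (z : C) : Prop := (Cmod z <= rho)%R.

Definition analytic (rho : R) := uclos C (cdisc rho) is_mono.

(** The argument is a pair of an angle and a parameter. Continuity of the coefficient gives
    integrability; its boundedness is a separate clause because uniform approximation is required
    for all real angles. *)
Definition is_pmono (f : R * C -> C) : Prop :=
  exists (c : R -> C) (k : nat),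
    (forall th, Ccontinuous c th) /\
    (exists B, forall th, (Cmod (c th) <= B)%R) /\
    forall x, f x = c (fst x) * snd x ^ k.

Definition panalytic (rho : R) := uclos (R * C) (fun x => cdisc rho (snd x)) is_pmono.

Lemma continuous_C_pair (f1 f2 : R -> R) x : continuous f1 x -> continuous f2 x ->
  Ccontinuous (fun t => (f1 t, f2 t)) x.
Proof.
intros H1 H2 P [eps HP].
assert (A := H1 _ (locally_ball (f1 x) eps)); assert (B := H2 _ (locally_ball (f2 x) eps)).
unfold filtermap in *; generalize (filter_and _ _ A B); apply filter_imp.
intros t [Ht1 Ht2]; apply HP; split; auto.
Qed.

Lemma continuous_Cmult (f g : R -> C) x :
  Ccontinuous f x ->
  Ccontinuous g x ->
  Ccontinuous (fun t => f t * g t) x.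
Proof.
intros Hf Hg.
assert (F1 : continuous (fun t => fst (f t)) x).
{ apply (continuous_comp (V := C_R_NormedModule) f (fun z : C => fst z)); auto.
  apply (continuous_fst (U := R_UniformSpace) (V := R_UniformSpace)). }
assert (F2 : continuous (fun t => snd (f t)) x).
{ apply (continuous_comp (V := C_R_NormedModule) f (fun z : C => snd z)); auto.
  apply (continuous_snd (U := R_UniformSpace) (V := R_UniformSpace)). }
assert (G1 : continuous (fun t => fst (g t)) x).
{ apply (continuous_comp (V := C_R_NormedModule) g (fun z : C => fst z)); auto.
  apply (continuous_fst (U := R_UniformSpace) (V := R_UniformSpace)). }
assert (G2 : continuous (fun t => snd (g t)) x).
{ apply (continuous_comp (V := C_R_NormedModule) g (fun z : C => snd z)); auto.
  apply (continuous_snd (U := R_UniformSpace) (V := R_UniformSpace)). }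
apply continuous_C_pair.
- apply (continuous_minus (V := R_NormedModule)); now apply (continuous_mult (K := R_AbsRing)).
- apply (continuous_plus (V := R_NormedModule)); now apply (continuous_mult (K := R_AbsRing)).
Qed.

Lemma pmono_const c : is_pmono (fun _ => c).
Proof.
exists (fun _ => c), O; split; [|split].
- intros th; apply (continuous_const (V := C_R_NormedModule)).
- exists (Cmod c); intros; apply Rle_refl.
- intros; simpl; ring.
Qed.

Lemma pmono_mult f g : is_pmono f -> is_pmono g -> is_pmono (fun x => f x * g x).
Proof.
intros [c [k [Hc [[B HB] E]]]] [c' [k' [Hc' [[B' HB'] E']]]].
exists (fun th => c th * c' th), (k + k')%nat; split; [|split].
- intros th; now apply continuous_Cmult.
- exists (B * B')%R; intros th; rewrite Cmod_mult; apply Rmult_le_compat; auto using Cmod_ge_0.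
- intros x; rewrite E, E', Cpow_add_r; ring.
Qed.

Lemma pmono_bounded rho f : is_pmono f ->
  exists B, forall x : R * C, cdisc rho (snd x) -> (Cmod (f x) <= B)%R.
Proof.
intros [c [k [_ [[B HB] E]]]]; exists (B * rho ^ k)%R; intros x Hx.
rewrite E, Cmod_mult, Cmod_pow; apply Rmult_le_compat; auto using Cmod_ge_0.
- apply pow_le, Cmod_ge_0.
- apply pow_incr; split; auto using Cmod_ge_0.
Qed.

Lemma continuous_cis_mult x th :
  Ccontinuous (fun t => cis (x * t)) th.
Proof.
apply continuous_C_pair; apply (ex_derive_continuous (V := R_NormedModule)); auto_derive; auto.
Qed.

Lemma pmono_cis : is_pmono (fun x => cis (fst x)).
Proof.
exists (fun th => cis (1 * th)), O; split; [|split].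
- apply continuous_cis_mult.
- exists 1%R; intros; rewrite Cmod_cis; lra.
- intros x; rewrite Rmult_1_l; simpl; ring.
Qed.

Lemma pmono_inv_cis : is_pmono (fun x => / cis (fst x)).
Proof.
exists (fun th => cis (-1 * th)), O; split; [|split].
- apply continuous_cis_mult.
- exists 1%R; intros; rewrite Cmod_cis; lra.
- intros x; rewrite cis_inv; replace (-1 * fst x)%R with (- fst x)%R by ring; simpl; ring.
Qed.

Lemma pmono_snd : is_pmono (fun x => snd x).
Proof.
exists (fun _ => 1), 1%nat; split; [|split].
- intros th; apply (continuous_const (V := C_R_NormedModule)).
- exists 1%R; intros; rewrite Cmod_1; lra.
- intros x; simpl; ring.
Qed.

Lemma pspan_int rho p : span (R * C) (fun x => cdisc rho (snd x)) is_pmono p ->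
  exists P, span C (cdisc rho) is_mono P /\
    forall z, cdisc rho z -> is_CInt (fun th => p (th, z)) 0 (2 * PI) (P z).
Proof.
induction 1 as [f [c [k [Hc [_ E]]]]|f g _ [P1 [S1 H1]] _ [P2 [S2 H2]]|f g _ [P [HS H]] E].
- destruct (is_CInt_continuous c 0 (2 * PI) Hc) as [I HI].
  exists (fun z => I * z ^ k); split; [apply span_base; now exists I, k|].
  intros z _; rewrite Cmult_comm.
  apply is_CInt_ext with (fun th => z ^ k * c th); [intros; rewrite E; simpl; ring|].
  now apply is_CInt_scal.
- exists (fun z => P1 z + P2 z); split; [now apply span_plus|].
  intros z Hz; apply (is_CInt_plus (fun th => f (th, z)) (fun th => g (th, z))); auto.
- exists P; split; auto; intros z Hz; apply is_CInt_ext with (2 := H z Hz).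
  intros th; now apply E.
Qed.

Lemma Rinv_INR1_pos n : (0 < / (INR n + 1))%R.
Proof. apply Rinv_0_lt_compat; generalize (pos_INR n); lra. Qed.

Lemma Rinv_INR1_lt eps : (0 < eps)%R ->
  exists N, forall n, (N <= n)%nat -> (/ (INR n + 1) < eps)%R.
Proof.
intros He; destruct (archimed_cor1 eps He) as [N [HN HN0]]; exists N; intros n Hn.
apply Rle_lt_trans with (2 := HN); apply Rinv_le_contravar; [apply lt_0_INR; lia|].
generalize (le_INR _ _ Hn); lra.
Qed.

(** Integrating a uniform approximant over the angle gives a polynomial in the parameter, and a
    small error integrates to a small error; so the integral is again a uniform limit of
    polynomials. *)
Lemma panalytic_int rho f : panalytic rho f ->
  exists F, analytic rho F /\
    forall z, cdisc rho z -> is_CInt (fun th => f (th, z)) 0 (2 * PI) (F z).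
Proof.
intros Hf.
assert (L : forall z, exists l, cdisc rho z -> is_CInt (fun th => f (th, z)) 0 (2 * PI) l).
(* Outside the disc the claim is vacuous; 0 is a placeholder that makes the chosen [F] total. *)
{ intros z; destruct (classic (cdisc rho z)) as [Hz|Hz]; [|now exists 0].
  assert (P : forall n : nat, exists p, span (R * C) (fun x => cdisc rho (snd x)) is_pmono p /\
              forall x, cdisc rho (snd x) -> (Cmod (f x - p x) <= / (INR n + 1))%R).
  { intros n; apply Hf, Rinv_INR1_pos. }
  apply functional_choice in P; destruct P as [p Hp].
  assert (Q : forall n : nat, exists I, is_CInt (fun th => p n (th, z)) 0 (2 * PI) I).
  { intros n; destruct (pspan_int rho (p n) (proj1 (Hp n))) as [P [_ HP]]; exists (P z); auto. }
  apply functional_choice in Q; destruct Q as [I HI].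
  destruct (is_CInt_lim (fun n th => p n (th, z)) (fun th => f (th, z)) I 0 (2 * PI) HI) as [l [_ Hl]].
  - intros eps He; destruct (Rinv_INR1_lt eps He) as [N HN]; exists N; intros n th Hn.
    rewrite Cmod_minus_comm.
    apply Rle_lt_trans with (1 := proj2 (Hp n) (th, z) Hz); auto.
  - now exists l. }
apply functional_choice in L; destruct L as [F HF]; exists F; split; auto.
intros eps He.
assert (HPI := PI_RGT_0).
assert (He' : (0 < eps / (2 * (2 * PI)))%R) by (apply Rdiv_lt_0_compat; lra).
destruct (Hf _ He') as [p [Hp Ep]].
destruct (pspan_int rho p Hp) as [P [HP IP]]; exists P; split; auto.
intros z Hz.
assert (D := is_CInt_minus _ _ _ _ _ _ (HF z Hz) (IP z Hz)).
apply is_CInt_norm with (B := (eps / (2 * (2 * PI)))%R) in D; [|lra|].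
- apply Rle_trans with (1 := D); right; field; lra.
- intros th; now apply (Ep (th, z)).
Qed.

(** Coefficients form a total sequence that vanishes from [N] on, so that polynomials of different
    degrees can be added and truncated anywhere. *)
Lemma span_mono_poly rho p : span C (cdisc rho) is_mono p ->
  exists (c : nat -> C) N, (forall k, (N <= k)%nat -> c k = 0) /\
    forall z, cdisc rho z -> p z = csum (fun k => c k * z ^ k) N.
Proof.
induction 1 as [f [c [k E]]|f g _ [c1 [N1 [Z1 H1]]] _ [c2 [N2 [Z2 H2]]]|f g _ [c [N [Z H]]] E].
- exists (fun i => if Nat.eq_dec i k then c else 0), (S k); split.
  + intros i Hi; destruct (Nat.eq_dec i k); [lia|easy].
  + intros z _; rewrite E; cbn [csum].
    rewrite (csum_zero (fun i => (if Nat.eq_dec i k then c else 0) * z ^ i)).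
    * destruct (Nat.eq_dec k k); [ring|lia].
    * intros i Hi; destruct (Nat.eq_dec i k); [lia|ring].
- exists (fun k => c1 k + c2 k), (N1 + N2)%nat; split.
  + intros k Hk; rewrite Z1, Z2 by lia; ring.
  + intros z Hz; rewrite H1, H2 by auto.
    rewrite (csum_ext (fun k => (c1 k + c2 k) * z ^ k) (fun k => c1 k * z ^ k + c2 k * z ^ k)) by (intros; ring).
    rewrite (csum_plus (fun k => c1 k * z ^ k) (fun k => c2 k * z ^ k)); f_equal.
    * rewrite csum_add, (csum_zero (fun k => c1 (N1 + k)%nat * z ^ (N1 + k))); [ring|].
      intros k _; rewrite Z1 by lia; ring.
    * rewrite Nat.add_comm, csum_add, (csum_zero (fun k => c2 (N2 + k)%nat * z ^ (N2 + k))); [ring|].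
      intros k _; rewrite Z2 by lia; ring.
- exists c, N; split; auto; intros z Hz; rewrite <- E; auto.
Qed.

Lemma is_CInt_csum (f : nat -> R -> C) (I : nat -> C) a b n :
  (forall k, (k < n)%nat -> is_CInt (f k) a b (I k)) ->
  is_CInt (fun x => csum (fun k => f k x) n) a b (csum I n).
Proof.
induction n as [|n IH]; intros H.
- replace (csum I 0) with (RtoC (b - a) * 0) by (simpl; ring); apply is_CInt_const.
- apply (is_CInt_plus (fun x => csum (fun k => f k x) n)).
  + apply IH; intros; apply H; lia.
  + apply H; lia.
Qed.

(** The coefficient is extracted by integrating against e^(-ik theta) on |z| = rho; the 2 is the one
    of [is_CInt_norm]. *)
Lemma cauchy_estimate rho (c : nat -> C) N B : (0 <= rho)%R -> (forall k, (N <= k)%nat -> c k = 0) ->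
  (forall z, cdisc rho z -> (Cmod (csum (fun k => c k * z ^ k)%C N) <= B)%R) ->
  forall k, (Cmod (c k) * rho ^ k <= 2 * B)%R.
Proof.
intros Hr Hc HB k.
assert (HB0 : (0 <= B)%R).
{ apply Rle_trans with (2 := HB 0 ltac:(unfold cdisc; rewrite Cmod_0; lra)); apply Cmod_ge_0. }
destruct (Nat.le_gt_cases N k) as [L|L].
{ rewrite Hc, Cmod_0 by auto; lra. }
assert (H2 : (0 < 2 * PI)%R) by (generalize PI_RGT_0; lra).
assert (I : is_CInt (fun th => csum (fun i => c i * RtoC rho ^ i * cis ((INR i - INR k) * th)) N)
              0 (2 * PI) (csum (fun i => if Nat.eq_dec i k then RtoC (2 * PI) * (c k * RtoC rho ^ k) else 0) N)).
{ apply is_CInt_csum; intros i Hi; destruct (Nat.eq_dec i k) as [->|Hik].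
  - apply is_CInt_ext with (fun _ => c k * RtoC rho ^ k).
    { intros th; replace ((INR k - INR k) * th)%R with 0%R by ring; rewrite cis_0; ring. }
    replace (2 * PI)%R with (2 * PI - 0)%R at 2 by ring; apply is_CInt_const.
  - replace (RtoC 0) with (c i * RtoC rho ^ i * 0) by ring.
    now apply is_CInt_scal, is_CInt_cis_nat. }
replace (csum _ N) with (RtoC (2 * PI) * (c k * RtoC rho ^ k)) in I.
2:{ set (g := fun i => if Nat.eq_dec i k then RtoC (2 * PI) * (c k * RtoC rho ^ k) else 0).
    assert (Eg : g k = RtoC (2 * PI) * (c k * RtoC rho ^ k)).
    { unfold g; destruct (Nat.eq_dec k k); [easy|lia]. }
    replace N with (k + S (N - S k))%nat by lia.
    rewrite csum_add, csum_Sl, Nat.add_0_r, Eg, (csum_zero g), (csum_zero (fun j => g (k + S j)%nat)).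
    - ring.
    - intros j _; unfold g; destruct (Nat.eq_dec (k + S j) k); [lia|easy].
    - intros j Hj; unfold g; destruct (Nat.eq_dec j k); [lia|easy]. }
apply is_CInt_norm with (B := B) in I; [|lra|].
- rewrite !Cmod_mult, Cmod_pow, !Cmod_R, (Rabs_pos_eq (2 * PI)), (Rabs_pos_eq rho) in I by lra.
  nra.
- intros th.
  replace (csum _ N) with (cis (- (INR k * th)) * csum (fun i => c i * (RtoC rho * cis th) ^ i) N).
  + rewrite Cmod_mult, Cmod_cis, Rmult_1_l; apply HB.
    unfold cdisc; rewrite Cmod_mult, Cmod_cis, Cmod_R, Rabs_pos_eq; lra.
  + rewrite <- csum_scal; apply csum_ext; intros i _.
    replace ((INR i - INR k) * th)%R with (- (INR k * th) + INR i * th)%R by ring.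
    rewrite cis_plus, <- (cis_pow th i), Cpow_mult_l; ring.
Qed.

(** The bound does not involve the degree [N], so it holds uniformly along approximants of growing
    degree. *)
Lemma poly_tail rho (c : nat -> C) N A L z : (0 < rho)%R ->
  (forall k, (N <= k)%nat -> c k = 0) -> (forall k : nat, (Cmod (c k) * rho ^ k <= A)%R) ->
  (Cmod z < rho)%R ->
  (Cmod (csum (fun k => c k * z ^ k) N - csum (fun k => c k * z ^ k) L)%C
     <= A / (1 - Cmod z / rho) * (Cmod z / rho) ^ L)%R.
Proof.
intros Hr Hc HA Hz.
assert (Hs : (0 <= Cmod z / rho < 1)%R).
{ split; [apply Rmult_le_pos; [apply Cmod_ge_0|left; now apply Rinv_0_lt_compat]|].
  apply Rmult_lt_reg_r with rho; auto; field_simplify; lra. }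
assert (HA0 : (0 <= A)%R).
{ apply Rle_trans with (2 := HA O), Rmult_le_pos; [apply Cmod_ge_0|apply pow_le; lra]. }
set (p := csum (fun k => c k * z ^ k)).
assert (Hstep : forall n, (Cmod (p (S n) - p n) <= A * (Cmod z / rho) ^ n)%R).
{ intros n; replace (p (S n) - p n) with (c n * z ^ n) by (unfold p; simpl; ring).
  rewrite Cmod_mult, Cmod_pow; unfold Rdiv; rewrite Rpow_mult_distr, pow_inv.
  rewrite <- (Rmult_comm (/ rho ^ n)), <- Rmult_assoc.
  apply Rmult_le_compat_r; [apply pow_le, Cmod_ge_0|].
  apply Rmult_le_reg_r with (rho ^ n)%R; [now apply pow_lt|].
  rewrite Rmult_assoc, Rinv_l, Rmult_1_r by (apply pow_nonzero; lra); apply HA. }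
replace (p N) with (p (L + N)%nat).
- apply Rle_trans with (1 := geom_tail p A _ Hs Hstep L N).
  apply Rmult_le_compat_l.
  + apply Rmult_le_pos; auto; left; apply Rinv_0_lt_compat; lra.
  + generalize (pow_le (Cmod z / rho) (L + N) (proj1 Hs)); lra.
- unfold p; rewrite Nat.add_comm, csum_add, (csum_zero (fun k => c (N + k)%nat * z ^ (N + k))); [ring|].
  intros k _; rewrite Hc by lia; ring.
Qed.

(** Every approximant is within 1 of F, so it is bounded by B + 1, and Cauchy's estimate bounds all
    coefficients of all approximants at once by 2 (B + 1). *)
Lemma poly_approx_seq rho F : (0 < rho)%R -> analytic rho F ->
  exists (c : nat -> nat -> C) (N : nat -> nat) A,
    (forall n k, (N n <= k)%nat -> c n k = 0) /\
    (forall n k : nat, (Cmod (c n k) * rho ^ k <= A)%R) /\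
    forall n (z : C), cdisc rho z ->
      (Cmod (F z - csum (fun k => c n k * z ^ k) (N n))%C <= / (INR n + 1))%R.
Proof.
intros Hr HF.
assert (P : forall n : nat, exists cN : (nat -> C) * nat,
  (forall k, (snd cN <= k)%nat -> fst cN k = 0) /\
  forall z, cdisc rho z ->
   (Cmod (F z - csum (fun k => fst cN k * z ^ k) (snd cN))%C <= / (INR n + 1))%R).
{ intros n; destruct (HF _ (Rinv_INR1_pos n)) as [p [Hp Ep]].
  destruct (span_mono_poly rho p Hp) as [c [N [Hc H]]]; exists (c, N); split; auto.
  intros z Hz; simpl; rewrite <- H; auto. }
apply functional_choice in P; destruct P as [cN H].
assert (BF : exists B, (0 < B)%R /\ forall z, cdisc rho z -> (Cmod (F z) <= B)%R).
{ apply (uclos_bounded C (cdisc rho) is_mono); auto.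
  intros f [c [k E]]; exists (Cmod c * rho ^ k)%R; intros x Hx.
  rewrite E, Cmod_mult, Cmod_pow; apply Rmult_le_compat_l; [apply Cmod_ge_0|].
  apply pow_incr; split; auto using Cmod_ge_0. }
destruct BF as [B [HB BF]].
exists (fun n => fst (cN n)), (fun n => snd (cN n)), (2 * (B + 1))%R; split; [|split].
- intros n; apply H.
- intros n; apply (cauchy_estimate rho _ (snd (cN n))); [lra|apply H|].
  intros z Hz; destruct (H n) as [_ H2]; specialize (H2 z Hz); specialize (BF z Hz).
  assert (L : (/ (INR n + 1) <= 1)%R).
  { rewrite <- Rinv_1; apply Rinv_le_contravar; generalize (pos_INR n); lra. }
  rewrite Cmod_minus_comm in H2.
  generalize (Cmod_minus_ge (csum (fun k => fst (cN n) k * z ^ k) (snd (cN n))) (F z)); lra.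
- intros n; apply H.
Qed.

(** At a tiny zero w of F the approximants tend to 0, their terms below degree k tend to 0 by
    induction, and the tail beyond k is O(|w|^(k+1)). Dividing by |w|^k leaves the k-th coefficient
    arbitrarily small. *)
Lemma analytic_coef_to_0 rho F (z : nat -> C) (c : nat -> nat -> C) N A : (0 < rho)%R ->
  (forall n k, (N n <= k)%nat -> c n k = 0) ->
  (forall n k : nat, (Cmod (c n k) * rho ^ k <= A)%R) ->
  (forall n (z : C), cdisc rho z -> (Cmod (F z - csum (fun k => c n k * z ^ k) (N n))%C <= / (INR n + 1))%R) ->
  Ccv z 0 -> (forall m, z m <> 0) -> (forall m, cdisc rho (z m) -> F (z m) = 0) ->
  forall k, Ccv (fun n => c n k) 0.
Proof.
intros Hr Hc HA HF Hz Hz0 HFz k.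
induction k as [k IH] using (well_founded_induction Wf_nat.lt_wf).
intros eps He.
assert (A0 : (0 <= A)%R).
{ apply Rle_trans with (2 := HA O O), Rmult_le_pos; [apply Cmod_ge_0|apply pow_le; lra]. }
assert (Prk : (0 < rho ^ (S k))%R) by now apply pow_lt.
(* A zero w of F so small that the tail beyond degree k is negligible against w^k. *)
set (dl := Rmin (rho / 2) (eps * rho ^ (S k) / (8 * (A + 1)))%R).
assert (Hdl : (0 < dl)%R).
{ apply Rmin_case; [lra|]. apply Rdiv_lt_0_compat; [apply Rmult_lt_0_compat; lra|lra]. }
destruct (Hz dl Hdl) as [m Hm]; specialize (Hm m (Nat.le_refl _)).
set (w := z m) in *.
replace (w - 0) with w in Hm by ring.
assert (Hw1 := Rlt_le_trans _ _ _ Hm (Rmin_l _ _)).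
assert (Hw2 := Rlt_le_trans _ _ _ Hm (Rmin_r _ _)).
assert (Hw0 : (0 < Cmod w)%R) by (apply Cmod_gt_0; apply Hz0).
assert (Pwk : (0 < Cmod w ^ k)%R) by now apply pow_lt.
assert (Fw : F w = 0) by (apply HFz; unfold cdisc; fold w; lra).
(* Three errors, each at most a quarter of eps |w|^k: the approximation at w, the terms below degree
   k, and the tail. *)
set (eta := (eps * Cmod w ^ k / 4)%R).
assert (Heta : (0 < eta)%R) by (unfold eta; nra).
destruct (Rinv_INR1_lt eta Heta) as [N1 HN1].
assert (L : forall j, (j <= k)%nat -> Ccv (fun n => csum (fun i => c n i * w ^ i) j) 0).
{ clear - IH; induction j as [|j IHj]; intros H; [exact (Ccv_const 0)|].
  replace (RtoC 0) with (0 + w ^ j * 0) by ring.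
  apply Ccv_ext with (fun n => csum (fun i => c n i * w ^ i) j + w ^ j * c n j).
  { intros n; simpl; ring. }
  apply Ccv_plus; [apply IHj; lia|apply Ccv_scal, IH; lia]. }
destruct (L k (Nat.le_refl k) eta Heta) as [N2 HN2].
exists (N1 + N2)%nat; intros n Hn.
specialize (HN1 n ltac:(lia)); specialize (HN2 n ltac:(lia)).
assert (T := poly_tail rho (c n) (N n) A (S k) w Hr (Hc n) (HA n) ltac:(lra)).
assert (E := HF n w ltac:(unfold cdisc; lra)).
rewrite Fw in E; cbn [csum] in T.
replace (c n k - 0) with (c n k) by ring.
set (P := csum (fun k => c n k * w ^ k) (N n)) in *.
set (Q := csum (fun i => c n i * w ^ i) k) in *.
assert (I : (Cmod (c n k * w ^ k) <= / (INR n + 1) + Cmod Q + A / (1 - Cmod w / rho) * (Cmod w / rho) ^ S k)%R).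
{ replace (c n k * w ^ k) with (- (P - (Q + c n k * w ^ k)) + (- (Q - 0) + - (0 - P))) by ring.
  apply Rle_trans with (1 := Cmod_triangle _ _).
  generalize (Cmod_triangle (- (Q - 0)) (- (0 - P))); rewrite !Cmod_opp.
  replace (Q - 0) with Q by ring; lra. }
replace (Q - 0) with Q in HN2 by ring.
rewrite Cmod_mult, Cmod_pow in I.
assert (T2 : (A / (1 - Cmod w / rho) * (Cmod w / rho) ^ S k <= eps / 4 * Cmod w ^ k)%R).
{ assert (S1 : (0 < Cmod w / rho < / 2)%R).
  { split; [apply Rdiv_lt_0_compat; lra|].
    apply Rmult_lt_reg_r with rho; auto; unfold Rdiv; rewrite Rmult_assoc, Rinv_l; lra. }
  apply Rle_trans with (2 * A * (Cmod w / rho) ^ S k)%R.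
  - apply Rmult_le_compat_r; [apply pow_le; lra|].
    unfold Rdiv at 1; rewrite (Rmult_comm 2); apply Rmult_le_compat_l; auto.
    replace 2%R with (/ / 2)%R by lra; apply Rinv_le_contravar; lra.
  - unfold Rdiv at 1; rewrite Rpow_mult_distr, pow_inv.
    replace (2 * A * (Cmod w ^ S k * / rho ^ S k))%R
      with (2 * A * Cmod w * / rho ^ S k * Cmod w ^ k)%R by (simpl; ring).
    apply Rmult_le_compat_r; [lra|].
    apply Rmult_le_reg_r with (rho ^ S k)%R; auto.
    rewrite Rmult_assoc, Rinv_l, Rmult_1_r by lra.
    apply Rle_trans with (2 * (A + 1) * (eps * rho ^ S k / (8 * (A + 1))))%R.
    + apply Rmult_le_compat; lra.
    + right; field; lra. }
unfold eta in *.
apply Rmult_lt_reg_r with (Cmod w ^ k)%R; auto; nra.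
Qed.

(** No power series of F is formed. As each fixed coefficient of the approximants tends to 0, F w
    splits into an approximation error, a uniformly small tail, and a finite head that tends to
    0. *)
Lemma analytic_identity rho F (z : nat -> C) : (0 < rho)%R -> analytic rho F ->
  Ccv z 0 -> (forall m, z m <> 0) -> (forall m, cdisc rho (z m) -> F (z m) = 0) ->
  forall w, (Cmod w < rho)%R -> F w = 0.
Proof.
intros Hr HF Hz Hz0 HFz w Hw.
destruct (poly_approx_seq rho F Hr HF) as [c [N [A [Hc [HA HP]]]]].
assert (L := analytic_coef_to_0 rho F z c N A Hr Hc HA HP Hz Hz0 HFz).
assert (A0 : (0 <= A)%R).
{ apply Rle_trans with (2 := HA O O), Rmult_le_pos; [apply Cmod_ge_0|apply pow_le; lra]. }
apply Cmod_small_eq0; intros eps He.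
assert (Hs : (0 <= Cmod w / rho < 1)%R).
{ split; [apply Rmult_le_pos; [apply Cmod_ge_0|left; now apply Rinv_0_lt_compat]|].
  apply Rmult_lt_reg_r with rho; auto; unfold Rdiv; rewrite Rmult_assoc, Rinv_l; lra. }
set (s := (Cmod w / rho)%R) in *.
assert (He3 : (0 < eps / 3)%R) by lra.
destruct (geom_small (A / (1 - s)) s _ Hs He3) as [k Hk]; specialize (Hk k (Nat.le_refl _)).
assert (L' : Ccv (fun n => csum (fun i => c n i * w ^ i) k) 0).
{ clear - L; induction k as [|k IH]; [exact (Ccv_const 0)|].
  replace (RtoC 0) with (0 + w ^ k * 0) by ring.
  apply Ccv_ext with (fun n => csum (fun i => c n i * w ^ i) k + w ^ k * c n k).
  { intros n; simpl; ring. }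
  apply Ccv_plus; [apply IH|apply Ccv_scal, L]. }
destruct (L' _ He3) as [N2 HN2]; destruct (Rinv_INR1_lt _ He3) as [N1 HN1].
set (n := (N1 + N2)%nat).
specialize (HN1 n ltac:(unfold n; lia)); specialize (HN2 n ltac:(unfold n; lia)).
assert (T := poly_tail rho (c n) (N n) A k w Hr (Hc n) (HA n) Hw); fold s in T.
assert (E := HP n w ltac:(unfold cdisc; lra)).
set (P := csum (fun k => c n k * w ^ k) (N n)) in *.
set (Q := csum (fun i => c n i * w ^ i) k) in *.
replace (F w) with ((F w - P) + ((P - Q) + (Q - 0))) by ring.
apply Rle_trans with (1 := Cmod_triangle _ _).
generalize (Cmod_triangle (P - Q) (Q - 0)); lra.
Qed.

Lemma Ccv_pow u l k : Ccv u l -> Ccv (fun n => u n ^ k) (l ^ k).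
Proof.
intros H; induction k as [|k IH]; simpl; [apply Ccv_const|now apply Ccv_mult].
Qed.

Lemma analytic_cv_0 rho F (z : nat -> C) : (0 < rho)%R -> analytic rho F ->
  Ccv z 0 -> (forall m, cdisc rho (z m)) -> Ccv (fun m => F (z m)) (F 0).
Proof.
intros Hr HF Hz Hd eps He.
destruct (HF (eps / 4)%R ltac:(lra)) as [p [Hp Ep]].
destruct (span_mono_poly rho p Hp) as [c [N [Hc H]]].
assert (L : Ccv (fun m => csum (fun k => c k * z m ^ k) N) (csum (fun k => c k * 0 ^ k) N)).
{ clear - Hz; induction N as [|N IH]; [exact (Ccv_const 0)|].
  apply (Ccv_plus (fun m => csum (fun k => c k * z m ^ k) N)); auto.
  now apply Ccv_scal, Ccv_pow. }
destruct (L (eps / 4)%R ltac:(lra)) as [M HM]; exists M; intros n Hn; specialize (HM n Hn).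
assert (D0 : cdisc rho 0) by (unfold cdisc; rewrite Cmod_0; lra).
rewrite <- !H in HM by auto.
apply Rle_lt_trans with (1 := Cmod_minus_le _ (p (z n)) _).
assert (E1 := Cmod_minus_le (p (z n)) (p 0) (F 0)).
assert (E2 := Ep 0 D0); assert (E3 := Ep (z n) (Hd n)).
rewrite (Cmod_minus_comm (F 0)) in E2; lra.
Qed.

Lemma panalytic_const rho c : panalytic rho (fun _ => c).
Proof. apply uclos_const, pmono_const. Qed.

Lemma panalytic_snd rho : panalytic rho (fun x => snd x).
Proof. apply uclos_base, pmono_snd. Qed.

Lemma panalytic_cis rho : panalytic rho (fun x => cis (fst x)).
Proof. apply uclos_base, pmono_cis. Qed.

Lemma panalytic_inv_cis rho : panalytic rho (fun x => / cis (fst x)).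
Proof. apply uclos_base, pmono_inv_cis. Qed.

Lemma panalytic_plus rho f g : panalytic rho f -> panalytic rho g -> panalytic rho (fun x => f x + g x).
Proof. apply uclos_plus. Qed.

Lemma panalytic_mult rho f g : panalytic rho f -> panalytic rho g -> panalytic rho (fun x => f x * g x).
Proof. apply uclos_mult; [apply pmono_mult|apply pmono_bounded]. Qed.

Lemma panalytic_minus rho f g : panalytic rho f -> panalytic rho g -> panalytic rho (fun x => f x - g x).
Proof. apply uclos_minus; [apply pmono_const|apply pmono_mult|apply pmono_bounded]. Qed.

Lemma panalytic_qpoch rho q u n : panalytic rho u -> panalytic rho (fun x => qpoch (u x) q n).
Proof. apply uclos_qpoch; [apply pmono_const|apply pmono_mult|apply pmono_bounded]. Qed.

Lemma panalytic_qpoch_inf rho q u : (Cmod q < 1)%R ->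
  panalytic rho u -> panalytic rho (fun x => qpoch_inf (u x) q).
Proof. intros; eapply uclos_qpoch_inf; eauto using pmono_const, pmono_mult, pmono_bounded. Qed.

Lemma panalytic_inv_qpoch_inf rho q u s : (Cmod q < 1)%R -> (s < 1)%R -> panalytic rho u ->
  (forall x, cdisc rho (snd x) -> (Cmod (u x) <= s)%R) ->
  panalytic rho (fun x => / qpoch_inf (u x) q).
Proof. intros; eapply uclos_inv_qpoch_inf; eauto using pmono_const, pmono_mult, pmono_bounded. Qed.

Lemma panalytic_csum rho (f : nat -> R * C -> C) n : (forall k, panalytic rho (f k)) ->
  panalytic rho (fun x => csum (fun k => f k x) n).
Proof.
intros H; induction n as [|n IH]; simpl; [apply panalytic_const|now apply panalytic_plus].
Qed.

(** Spreading S z over the circle as the constant S z/(2 pi) turns the difference of the two sides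
    into one parameter integral, to which the identity theorem applies. The formula is tested only
    at those z m that lie in the disc. *)
Lemma circle_int_identity rho (f : R * C -> C) (S : C -> C) (z : nat -> C) : (0 < rho)%R ->
  panalytic rho f -> panalytic rho (fun x => S (snd x)) ->
  Ccv z 0 -> (forall m, z m <> 0) ->
  (forall m, cdisc rho (z m) -> is_CInt (fun th => f (th, z m)) 0 (2 * PI) (S (z m))) ->
  forall w, (Cmod w < rho)%R -> is_CInt (fun th => f (th, w)) 0 (2 * PI) (S w).
Proof.
intros Hr Hf HS Hz Hz0 HI w Hw.
assert (HPI : RtoC (2 * PI) <> 0).
{ intros E; injection E; generalize PI_RGT_0; lra. }
set (g := fun x : R * C => f x - / RtoC (2 * PI) * S (snd x)).
assert (Hg : panalytic rho g).
{ apply panalytic_minus; auto; apply panalytic_mult; auto using panalytic_const. }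
destruct (panalytic_int rho g Hg) as [F [HF HFI]].
assert (C0 : forall c, is_CInt (fun _ => / RtoC (2 * PI) * c) 0 (2 * PI) c).
{ intros c; generalize (is_CInt_const (/ RtoC (2 * PI) * c) 0 (2 * PI)).
  replace (RtoC (2 * PI - 0) * (/ RtoC (2 * PI) * c)) with c; auto.
  replace (2 * PI - 0)%R with (2 * PI)%R by ring.
  rewrite Cmult_assoc, Cinv_r, Cmult_1_l by exact HPI; reflexivity. }
assert (E : F w = 0).
{ apply (analytic_identity rho F z); auto.
  intros m Hm; apply (is_CInt_unique (fun th => g (th, z m)) 0 (2 * PI)); auto.
  replace (RtoC 0) with (S (z m) - S (z m)) by ring.
  apply (is_CInt_minus (fun th => f (th, z m)) (fun _ => / RtoC (2 * PI) * S (z m))); auto. }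
assert (Dw : cdisc rho w) by (unfold cdisc; lra).
apply is_CInt_ext with (fun th => g (th, w) + / RtoC (2 * PI) * S w).
{ intros th; unfold g; simpl; ring. }
generalize (is_CInt_plus _ _ _ _ _ _ (HFI w Dw) (C0 (S w))).
now rewrite E, Cplus_0_l.
Qed.

Lemma circle_int_cv_0 rho (f : R * C -> C) (z : nat -> C) I I0 : (0 < rho)%R ->
  panalytic rho f -> Ccv z 0 -> (forall m, cdisc rho (z m)) ->
  (forall m, is_CInt (fun th => f (th, z m)) 0 (2 * PI) (I m)) ->
  is_CInt (fun th => f (th, RtoC 0)) 0 (2 * PI) I0 -> Ccv I I0.
Proof.
intros Hr Hf Hz Hd HI HI0.
destruct (panalytic_int rho f Hf) as [F [HF HFI]].
assert (D0 : cdisc rho 0) by (unfold cdisc; rewrite Cmod_0; lra).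
rewrite (is_CInt_unique _ _ _ _ _ HI0 (HFI 0 D0)).
apply Ccv_ext with (fun m => F (z m)).
{ intros m; apply (is_CInt_unique _ _ _ _ _ (HFI (z m) (Hd m)) (HI m)). }
now apply (analytic_cv_0 rho).
Qed.

(** * The Askey-Wilson integral *)

Lemma laurent_const s c : laurent s (fun _ => c).
Proof. apply uclos_const, laurent_mono_const. Qed.

Lemma laurent_id s : laurent s (fun z => z).
Proof. apply uclos_base; exists 1, 1%nat, O; intros; simpl; ring. Qed.

Lemma laurent_inv s : laurent s (fun z => / z).
Proof. apply uclos_base; exists 1, O, 1%nat; intros; simpl; ring. Qed.

Lemma laurent_mult s f g : (0 < s)%R -> laurent s f -> laurent s g -> laurent s (fun z => f z * g z).
Proof.
intros Hs; apply uclos_mult; [apply laurent_mono_mult|intros; now apply laurent_mono_bounded].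
Qed.

Lemma laurent_qpoch_inf s q u : (0 < s)%R -> (Cmod q < 1)%R ->
  laurent s u -> laurent s (fun z => qpoch_inf (u z) q).
Proof.
intros; eapply uclos_qpoch_inf; eauto using laurent_mono_const, laurent_mono_mult, laurent_mono_bounded.
Qed.

Lemma laurent_inv_qpoch_inf s q u r : (0 < s)%R -> (Cmod q < 1)%R -> (r < 1)%R ->
  laurent s u -> (forall z, annulus s z -> (Cmod (u z) <= r)%R) ->
  laurent s (fun z => / qpoch_inf (u z) q).
Proof.
intros; eapply uclos_inv_qpoch_inf; eauto using laurent_mono_const, laurent_mono_mult, laurent_mono_bounded.
Qed.

Section AskeyWilson.
Variable q : C.
Hypothesis Hq : (0 < Cmod q < 1)%R.

Let Hq1 : (Cmod q < 1)%R := proj2 Hq.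

Lemma q_neq0 : q <> 0.
Proof. apply Cmod_gt_0, Hq. Qed.

Definition ibase (z : C) : C := qpoch_inf (z * z) q * qpoch_inf (/ z * / z) q.

(* 1 / h(u). *)
Definition ihh (u z : C) : C := / qpoch_inf (u * z) q * / qpoch_inf (u * / z) q.

Definition aw_weight (a b c d z : C) : C :=
  ibase z * ihh a z * ihh b z * ihh c z * ihh d z.

Lemma Cmod_mult_cis u th : Cmod (u * cis th) = Cmod u.
Proof. rewrite Cmod_mult, Cmod_cis; ring. Qed.

Lemma Cmod_mult_inv_cis u th : Cmod (u * / cis th) = Cmod u.
Proof. rewrite cis_inv; apply Cmod_mult_cis. Qed.

Lemma inv_qpoch_inf_shift u : (Cmod u < 1)%R -> / qpoch_inf (u * q) q = (1 - u) * / qpoch_inf u q.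
Proof.
intros Hu; rewrite (qpoch_inf_S q Hq1 u).
assert (N : qpoch_inf (u * q) q <> 0).
{ apply qpoch_inf_neq0_small; auto; rewrite Cmod_mult; generalize (Cmod_ge_0 u); nra. }
field; split; auto; apply Cminus_neq0, not_eq_sym, Cmod_lt_neq; rewrite Cmod_1; auto.
Qed.

Lemma ihh_shift u th : (Cmod u < 1)%R ->
  ihh (u * q) (cis th) = (1 - u * cis th) * (1 - u * / cis th) * ihh u (cis th).
Proof.
intros Hu; unfold ihh.
replace (u * q * cis th) with (u * cis th * q) by ring.
replace (u * q * / cis th) with (u * / cis th * q) by ring.
rewrite !inv_qpoch_inf_shift; [ring| |]; now rewrite ?Cmod_mult_cis, ?Cmod_mult_inv_cis.
Qed.

(* The integrand is F(z) - F(q z) with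
   F(z) = z (z^2, q z^-2; q)_inf / prod_u (u z, q u / z; q)_inf, where u runs over a, b, c, d. *)
Lemma aw_contour_shift a b c d :
  (Cmod a < 1)%R -> (Cmod b < 1)%R -> (Cmod c < 1)%R -> (Cmod d < 1)%R ->
  is_CInt (fun th => aw_weight a b c d (cis th)
      * ((1 - a * b * c * d) * (cis th + / cis th)
         - (a + b + c + d - (a * b * c + a * b * d + a * c * d + b * c * d)))) 0 (2 * PI) 0.
Proof.
intros Ha Hb Hc Hd.
set (G := fun u z => / qpoch_inf (u * z) q * / qpoch_inf (u * q * / z) q).
set (F := fun z => z * (qpoch_inf (z * z) q * qpoch_inf (q * (/ z * / z)) q)
                   * (G a z * G b z * (G c z * G d z))).
assert (H0 := proj1 Hq).
(* On |q| <= |z| <= 1 both |u z| and |u q/z| are at most |u|. With u/z in place of u q/z there could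
   be a pole at z = u inside the annulus. *)
assert (HG : forall u, (Cmod u < 1)%R -> laurent (Cmod q) (G u)).
{ intros u Hu; apply laurent_mult; auto; apply laurent_inv_qpoch_inf with (Cmod u); auto.
  - apply laurent_mult; auto using laurent_const, laurent_id.
  - intros z [Hz1 Hz2]; rewrite Cmod_mult; generalize (Cmod_ge_0 u); nra.
  - apply laurent_mult; auto using laurent_const, laurent_inv.
  - intros z [Hz1 Hz2]; assert (Hz0 : z <> 0) by (apply Cmod_gt_0; lra).
    rewrite !Cmod_mult, Cmod_inv by auto.
    rewrite <- (Rmult_1_r (Cmod u)) at 2; rewrite Rmult_assoc.
    apply Rmult_le_compat_l; [apply Cmod_ge_0|].
    apply Rmult_le_reg_r with (Cmod z); [lra|]; rewrite Rmult_assoc, Rinv_l; lra. }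
assert (HF : laurent (Cmod q) F).
{ apply laurent_mult; auto.
  - apply laurent_mult; auto using laurent_id.
    apply laurent_mult; auto; apply laurent_qpoch_inf; auto.
    + apply laurent_mult; auto using laurent_id.
    + apply laurent_mult; auto using laurent_const.
      apply laurent_mult; auto using laurent_inv.
  - apply laurent_mult; auto; apply laurent_mult; auto. }
destruct (laurent_int (Cmod q) F ltac:(lra) HF) as [I HI].
assert (I1 := HI 1 ltac:(unfold annulus; rewrite Cmod_1; lra)).
assert (I2 := HI q ltac:(unfold annulus; lra)).
replace (RtoC 0) with (I - I) by ring.
apply is_CInt_ext with (2 := is_CInt_minus _ _ _ _ _ _ I1 I2).
intros th; rewrite Cmult_1_l; unfold aw_weight, ibase, ihh, F, G.
set (z := cis th).
assert (Hz : z <> 0) by apply cis_neq0.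
assert (Hz1 : Cmod z = 1%R) by apply Cmod_cis.
assert (Hq0 := q_neq0).
assert (Hzi : Cmod (/ z) = 1%R) by (rewrite Cmod_inv, Hz1 by auto; apply Rinv_1).
assert (Su : forall u, (Cmod u < 1)%R -> / qpoch_inf (u * (q * z)) q = (1 - u * z) * / qpoch_inf (u * z) q).
{ intros u Hu; replace (u * (q * z)) with (u * z * q) by ring.
  apply inv_qpoch_inf_shift; rewrite Cmod_mult, Hz1; lra. }
assert (Sv : forall u, (Cmod u < 1)%R -> / qpoch_inf (u * q * / z) q = (1 - u * / z) * / qpoch_inf (u * / z) q).
{ intros u Hu; replace (u * q * / z) with (u * / z * q) by ring.
  apply inv_qpoch_inf_shift; rewrite Cmod_mult, Hzi; lra. }
assert (Sw : forall u, u * q * / (q * z) = u * / z) by (intros; field; auto).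
rewrite !Sw, !Su, !Sv by auto.
replace (q * (/ z * / z)) with (/ z * / z * q) by ring.
replace (q * (/ (q * z) * / (q * z))) with (/ z * / z * / q) by (field; auto).
replace (q * z * (q * z)) with (z * z * q * q) by ring.
rewrite (qpoch_inf_S q Hq1 (z * z)), (qpoch_inf_S q Hq1 (/ z * / z)).
rewrite (qpoch_inf_S q Hq1 (/ z * / z * / q)).
replace (/ z * / z * / q * q) with (/ z * / z) by (field; auto).
rewrite (qpoch_inf_S q Hq1 (/ z * / z)), (qpoch_inf_S q Hq1 (z * z * q)).
set (A := qpoch_inf (z * z * q * q) q); set (B := qpoch_inf (/ z * / z * q) q).
generalize (/ qpoch_inf (a * z) q) (/ qpoch_inf (b * z) q) (/ qpoch_inf (c * z) q) (/ qpoch_inf (d * z) q).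
generalize (/ qpoch_inf (a * / z) q) (/ qpoch_inf (b * / z) q) (/ qpoch_inf (c * / z) q) (/ qpoch_inf (d * / z) q).
intros; field; auto.
Qed.

Lemma panalytic_ihh_fixed rho u : (Cmod u < 1)%R -> panalytic rho (fun x => ihh u (cis (fst x))).
Proof.
intros Hu; apply panalytic_mult; apply panalytic_inv_qpoch_inf with (Cmod u); auto.
- apply panalytic_mult; auto using panalytic_const, panalytic_cis.
- intros x _; rewrite Cmod_mult_cis; lra.
- apply panalytic_mult; auto using panalytic_const, panalytic_inv_cis.
- intros x _; rewrite Cmod_mult_inv_cis; lra.
Qed.

Lemma panalytic_ihh_var rho : (rho < 1)%R -> panalytic rho (fun x => ihh (snd x) (cis (fst x))).
Proof.
intros Hr; apply panalytic_mult; apply panalytic_inv_qpoch_inf with rho; auto.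
- apply panalytic_mult; auto using panalytic_snd, panalytic_cis.
- intros x Hx; rewrite Cmod_mult_cis; auto.
- apply panalytic_mult; auto using panalytic_snd, panalytic_inv_cis.
- intros x Hx; rewrite Cmod_mult_inv_cis; auto.
Qed.

Lemma panalytic_ibase rho : panalytic rho (fun x => ibase (cis (fst x))).
Proof.
apply panalytic_mult; apply panalytic_qpoch_inf; auto; apply panalytic_mult;
  auto using panalytic_cis, panalytic_inv_cis.
Qed.

Lemma panalytic_is_CInt rho f z : panalytic rho f -> cdisc rho z ->
  exists l, is_CInt (fun th => f (th, z)) 0 (2 * PI) l.
Proof. intros Hf Hz; destruct (panalytic_int rho f Hf) as [F [_ H]]; exists (F z); auto. Qed.

Lemma panalytic_aw_fixed rho a b c d :
  (Cmod a < 1)%R -> (Cmod b < 1)%R -> (Cmod c < 1)%R -> (Cmod d < 1)%R ->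
  panalytic rho (fun x => aw_weight a b c d (cis (fst x))).
Proof.
intros; unfold aw_weight; do 4 (apply panalytic_mult; [|now apply panalytic_ihh_fixed]).
apply panalytic_ibase.
Qed.

Lemma panalytic_aw_var rho b c d : (rho < 1)%R ->
  (Cmod b < 1)%R -> (Cmod c < 1)%R -> (Cmod d < 1)%R ->
  panalytic rho (fun x => aw_weight (snd x) b c d (cis (fst x))).
Proof.
intros; unfold aw_weight; do 3 (apply panalytic_mult; [|now apply panalytic_ihh_fixed]).
apply panalytic_mult; [apply panalytic_ibase|now apply panalytic_ihh_var].
Qed.

Lemma aw_int_ex a b c d :
  (Cmod a < 1)%R -> (Cmod b < 1)%R -> (Cmod c < 1)%R -> (Cmod d < 1)%R ->
  exists l, is_CInt (fun th => aw_weight a b c d (cis th)) 0 (2 * PI) l.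
Proof.
intros; apply (panalytic_is_CInt 1 (fun x => aw_weight a b c d (cis (fst x))) 0).
- now apply panalytic_aw_fixed.
- unfold cdisc; rewrite Cmod_0; lra.
Qed.

(** The shift a -> a q multiplies the weight by (1 - a z)(1 - a/z). Times 1 - abcd, this differs
    from the constant (1 - ab)(1 - ac)(1 - ad) by -a times the factor that [aw_contour_shift]
    integrates to 0. *)
Lemma aw_step a b c d I :
  (Cmod a < 1)%R -> (Cmod b < 1)%R -> (Cmod c < 1)%R -> (Cmod d < 1)%R ->
  is_CInt (fun th => aw_weight a b c d (cis th)) 0 (2 * PI) I ->
  is_CInt (fun th => (1 - a * b * c * d) * aw_weight (a * q) b c d (cis th)) 0 (2 * PI)
     ((1 - a * b) * (1 - a * c) * (1 - a * d) * I).
Proof.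
intros Ha Hb Hc Hd HI.
assert (S0 := is_CInt_scal (- a) _ _ _ _ (aw_contour_shift a b c d Ha Hb Hc Hd)).
assert (S1 := is_CInt_scal ((1 - a * b) * (1 - a * c) * (1 - a * d)) _ _ _ _ HI).
assert (S2 := is_CInt_plus _ _ _ _ _ _ S0 S1).
rewrite Cmult_0_r, Cplus_0_l in S2.
apply is_CInt_ext with (2 := S2); intros th.
unfold aw_weight; rewrite ihh_shift by auto; field; apply cis_neq0.
Qed.

(** Iterating [aw_step] m times replaces a by a q^m; as m grows the integral tends to the one with a
    = 0, since it is analytic in that parameter. *)
Lemma aw_remove_param a b c d I I0 :
  (Cmod a < 1)%R -> (Cmod b < 1)%R -> (Cmod c < 1)%R -> (Cmod d < 1)%R ->
  is_CInt (fun th => aw_weight a b c d (cis th)) 0 (2 * PI) I ->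
  is_CInt (fun th => aw_weight 0 b c d (cis th)) 0 (2 * PI) I0 ->
  qpoch_inf (a * b) q * qpoch_inf (a * c) q * qpoch_inf (a * d) q * I
  = qpoch_inf (a * b * c * d) q * I0.
Proof.
intros Ha Hb Hc Hd HI HI0.
assert (Ham : forall m, (Cmod (a * q ^ m) <= Cmod a)%R) by (intros; now apply Cmod_mult_qpow_le).
assert (J : forall m, exists l, is_CInt (fun th => aw_weight (a * q ^ m) b c d (cis th)) 0 (2 * PI) l).
{ intros m; specialize (Ham m); apply aw_int_ex; auto; lra. }
apply functional_choice in J; destruct J as [J HJ].
assert (Z : Ccv (fun m => a * q ^ m) 0).
{ apply (Ccv_le _ _ (Cmod a) (Cmod q)); [lra|intros n].
  replace (a * q ^ n - 0) with (a * q ^ n) by ring; rewrite Cmod_mult, Cmod_pow; lra. }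
assert (CJ : Ccv J I0).
(* A radius strictly between |a| and 1: all points a q^m lie in the disc, and 1/h is analytic in its
   parameter there. *)
{ set (rho := ((1 + Cmod a) / 2)%R).
  apply (circle_int_cv_0 rho (fun x => aw_weight (snd x) b c d (cis (fst x))) (fun m => a * q ^ m));
    auto; unfold rho.
  - generalize (Cmod_ge_0 a); lra.
  - apply panalytic_aw_var; auto; lra.
  - intros m; unfold cdisc; specialize (Ham m); lra. }
assert (E : forall m, qpoch (a * b) q m * qpoch (a * c) q m * qpoch (a * d) q m * I
                      = qpoch (a * b * c * d) q m * J m).
{ induction m as [|m IH].
  - simpl; replace I with (J O); [ring|].
    apply (is_CInt_unique _ _ _ _ _ (HJ O)); apply is_CInt_ext with (2 := HI).
    intros th; now replace (a * q ^ 0) with a by (simpl; ring).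
  - cbn [qpoch].
    assert (Hm : (Cmod (a * q ^ m) < 1)%R) by (specialize (Ham m); lra).
    assert (S1 := aw_step _ b c d _ Hm Hb Hc Hd (HJ m)).
    assert (S2 := is_CInt_scal (1 - a * q ^ m * b * c * d) _ _ _ _ (HJ (S m))).
    assert (T : (1 - a * q ^ m * b * c * d) * J (S m)
       = (1 - a * q ^ m * b) * (1 - a * q ^ m * c) * (1 - a * q ^ m * d) * J m).
    { apply (is_CInt_unique _ _ _ _ _ S2); apply is_CInt_ext with (2 := S1).
      intros th; now replace (a * q ^ S m) with (a * q ^ m * q) by (simpl; ring). }
    replace (qpoch (a * b * c * d) q m * (1 - a * b * c * d * q ^ m) * J (S m))
      with (qpoch (a * b * c * d) q m * ((1 - a * q ^ m * b * c * d) * J (S m))) by ring.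
    rewrite T.
    transitivity ((qpoch (a * b) q m * qpoch (a * c) q m * qpoch (a * d) q m * I)
      * ((1 - a * q ^ m * b) * (1 - a * q ^ m * c) * (1 - a * q ^ m * d))); [ring|].
    rewrite IH; ring. }
eapply Ccv_unique; [|apply Ccv_mult; [apply (qpoch_cv q Hq1)|exact CJ]].
apply Ccv_ext with (1 := E).
apply Ccv_mult; [|apply Ccv_const].
repeat apply Ccv_mult; now apply qpoch_cv.
Qed.

(** Once one parameter is 0, the product abcd and all pairs involving that parameter vanish, so each
    later removal contributes only the pair factors not yet present. *)
Lemma aw_int_const a b c d I I0 :
  (Cmod a < 1)%R -> (Cmod b < 1)%R -> (Cmod c < 1)%R -> (Cmod d < 1)%R ->
  is_CInt (fun th => aw_weight a b c d (cis th)) 0 (2 * PI) I ->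
  is_CInt (fun th => aw_weight 0 0 0 0 (cis th)) 0 (2 * PI) I0 ->
  qpoch_inf (a * b) q * qpoch_inf (a * c) q * qpoch_inf (a * d) q
    * qpoch_inf (b * c) q * qpoch_inf (b * d) q * qpoch_inf (c * d) q * I
  = qpoch_inf (a * b * c * d) q * I0.
Proof.
intros Ha Hb Hc Hd HI HI0.
assert (H0 : (Cmod 0 < 1)%R) by (rewrite Cmod_0; lra).
destruct (aw_int_ex 0 b c d) as [I1 HI1]; auto.
destruct (aw_int_ex 0 0 c d) as [I2 HI2]; auto.
destruct (aw_int_ex 0 0 0 d) as [I3 HI3]; auto.
assert (E1 := aw_remove_param a b c d I I1 Ha Hb Hc Hd HI HI1).
assert (E2 : qpoch_inf (b * 0) q * qpoch_inf (b * c) q * qpoch_inf (b * d) q * I1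
             = qpoch_inf (b * 0 * c * d) q * I2).
{ apply (aw_remove_param b 0 c d); auto.
  apply is_CInt_ext with (2 := HI1); intros th; unfold aw_weight; ring. }
assert (E3 : qpoch_inf (c * 0) q * qpoch_inf (c * 0) q * qpoch_inf (c * d) q * I2
             = qpoch_inf (c * 0 * 0 * d) q * I3).
{ apply (aw_remove_param c 0 0 d); auto.
  - apply is_CInt_ext with (2 := HI2); intros th; unfold aw_weight; ring. }
assert (E4 : qpoch_inf (d * 0) q * qpoch_inf (d * 0) q * qpoch_inf (d * 0) q * I3
             = qpoch_inf (d * 0 * 0 * 0) q * I0).
{ apply (aw_remove_param d 0 0 0); auto.
  apply is_CInt_ext with (2 := HI3); intros th; unfold aw_weight; ring. }
rewrite ?Cmult_0_r, ?Cmult_0_l, ?Cmult_0_r, ?Cmult_0_l, qpoch_inf_0 in E2, E3, E4 by auto.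
rewrite !Cmult_1_l in *.
rewrite E4 in E3.
transitivity (qpoch_inf (b * c) q * qpoch_inf (b * d) q * qpoch_inf (c * d) q *
   (qpoch_inf (a * b) q * qpoch_inf (a * c) q * qpoch_inf (a * d) q * I)); [ring|].
rewrite E1.
transitivity (qpoch_inf (a * b * c * d) q *
   (qpoch_inf (c * d) q * (qpoch_inf (b * c) q * qpoch_inf (b * d) q * I1))); [ring|].
rewrite E2, E3; ring.
Qed.

End AskeyWilson.

Lemma RtoC_neq0 x : x <> 0%R -> RtoC x <> 0.
Proof. intros H E; apply H; now injection E. Qed.

Lemma one_minus_neq0 x : (Cmod x < 1)%R -> 1 - x <> 0.
Proof. intros H; apply Cminus_neq0, not_eq_sym, Cmod_lt_neq; now rewrite Cmod_1. Qed.

Lemma Cmult_eq_reg_l (a x y : C) : a <> 0 -> a * x = a * y -> x = y.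
Proof.
intros Ha E; replace x with (/ a * (a * x)) by (field; auto); rewrite E; field; auto.
Qed.

(* For the parameters h, -h, q, -q with h^2 = q the weight is the trigonometric polynomial
   2 - z^2 - z^-2, which determines the constant. *)
Lemma aw_const h I0 : (0 < Cmod h < 1)%R ->
  is_CInt (fun th => aw_weight (h * h) 0 0 0 0 (cis th)) 0 (2 * PI) I0 ->
  qpoch_inf (h * h) (h * h) * I0 = RtoC (4 * PI).
Proof.
intros Hh HI0; set (q := h * h) in *.
assert (Hq : (0 < Cmod q < 1)%R).
{ unfold q; rewrite Cmod_mult; nra. }
assert (Hq1 := proj2 Hq).
assert (Hqq : (Cmod (q * q) < 1)%R) by now apply Cmod_sq_lt1.
assert (Hmh : (Cmod (- h) < 1)%R) by (rewrite Cmod_opp; lra).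
assert (Hmq : (Cmod (- q) < 1)%R) by (rewrite Cmod_opp; lra).
assert (HI : is_CInt (fun th => aw_weight q h (- h) q (- q) (cis th)) 0 (2 * PI) (RtoC (4 * PI))).
{ apply is_CInt_ext with (fun th => 2 - cis ((INR 2 - INR 0) * th) - cis ((INR 0 - INR 2) * th)).
  - intros th.
    replace ((INR 2 - INR 0) * th)%R with (INR 2 * th)%R by (simpl; ring).
    replace ((INR 0 - INR 2) * th)%R with (INR 2 * - th)%R by (simpl; ring).
    rewrite <- !cis_pow, <- cis_inv; unfold aw_weight, ibase, ihh.
    (* Opposite signs combine to base q^2, giving (u^2 q; q^2)_inf (u^2 q^2; q^2)_inf = (u^2 q;
       q)_inf. This cancels all but the first factor of (z^2; q)_inf and of (z^-2; q)_inf. *)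
    assert (D : forall u, Cmod u = 1%R ->
      qpoch_inf (h * u) q * qpoch_inf (- h * u) q * (qpoch_inf (q * u) q * qpoch_inf (- q * u) q)
      = qpoch_inf (u * u * q) q).
    { intros u Hu; replace (- h * u) with (- (h * u)) by ring; replace (- q * u) with (- (q * u)) by ring.
      rewrite !qpoch_inf_sq by auto.
      replace (h * u * (h * u)) with (u * u * q) by (unfold q; ring).
      replace (q * u * (q * u)) with (u * u * q * q) by ring.
      now apply qpoch_inf_dup. }
    set (z := cis th); assert (Hz : z <> 0) by apply cis_neq0.
    assert (Hz1 : Cmod z = 1%R) by apply Cmod_cis.
    assert (Hz2 : Cmod (/ z) = 1%R) by (rewrite Cmod_inv, Hz1 by auto; apply Rinv_1).
    rewrite (qpoch_inf_S q Hq1 (z * z)), (qpoch_inf_S q Hq1 (/ z * / z)).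
    rewrite <- (D z Hz1), <- (D (/ z) Hz2).
    assert (N : forall u v, (Cmod u < 1)%R -> Cmod v = 1%R -> qpoch_inf (u * v) q <> 0).
    { intros u v Hu Hv; apply qpoch_inf_neq0_small; auto; rewrite Cmod_mult, Hv; lra. }
    field; repeat split; auto; apply N; auto; lra.
  - replace (RtoC (4 * PI)) with (RtoC (2 * PI - 0) * 2 - 0 - 0).
    + apply is_CInt_minus; [apply is_CInt_minus|].
      * apply is_CInt_const.
      * now apply is_CInt_cis_nat.
      * now apply is_CInt_cis_nat.
    + unfold Cminus; rewrite <- RtoC_mult, <- RtoC_opp, <- !RtoC_plus; f_equal; ring. }
assert (E := aw_int_const q Hq h (- h) q (- q) _ I0 ltac:(lra) Hmh Hq1 Hmq HI HI0).
replace (h * - h) with (- q) in E by (unfold q; ring).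
replace (h * - q) with (- (h * q)) in E by ring.
replace (- h * q) with (- (h * q)) in E by ring.
replace (- h * - q) with (h * q) in E by ring.
replace (q * - q) with (- q * q) in E by ring.
replace (- q * q * - q) with (q * q * q) in E by ring.
set (B := qpoch_inf (- q) q) in *; set (A := qpoch_inf q q).
set (X := qpoch_inf (q * q * q) (q * q)).
assert (E1 : B = (1 + q) * qpoch_inf (- q * q) q).
{ unfold B; rewrite (qpoch_inf_S q Hq1 (- q)); f_equal; ring. }
assert (E2 : qpoch_inf (h * q) q * qpoch_inf (- (h * q)) q = X).
{ rewrite qpoch_inf_sq by auto; unfold X; f_equal; unfold q; ring. }
assert (E3 : A * B = qpoch_inf (q * q) (q * q)) by (apply qpoch_inf_sq; auto).
assert (E4 : qpoch_inf (q * q) (q * q) * X = qpoch_inf (q * q) q) by (apply qpoch_inf_dup; auto).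
assert (E5 : A = (1 - q) * qpoch_inf (q * q) q) by (apply qpoch_inf_S; auto).
assert (E6 : qpoch_inf (q * q) q = (1 - q * q) * qpoch_inf (q * q * q) q) by (apply qpoch_inf_S; auto).
assert (NA : A <> 0) by now apply qpoch_inf_neq0_small.
assert (NB : B <> 0) by now apply qpoch_inf_neq0_small.
assert (N1 : 1 - q <> 0) by now apply one_minus_neq0.
assert (N2 : 1 + q <> 0).
{ replace (1 + q) with (1 - - q) by ring; now apply one_minus_neq0. }
assert (N3 : qpoch_inf (q * q * q) q <> 0).
{ apply qpoch_inf_neq0_small; auto; apply Cmod_mult_lt1; auto. }
(* Euler's identity (-q; q)_inf (q; q^2)_inf = 1, with the first factor of (q; q^2)_inf split
   off. *)
assert (XB : (1 - q) * B * X = 1).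
{ apply (Cmult_eq_reg_l A); auto; transitivity ((1 - q) * (A * B * X)); [ring|].
  rewrite E3, E4, <- E5; ring. }
assert (E7 : A = (1 - q) * ((1 - q) * (1 + q)) * qpoch_inf (q * q * q) q) by (rewrite E5, E6; ring).
apply (Cmult_eq_reg_l (qpoch_inf (q * q * q) q)); auto.
transitivity (A * (qpoch_inf (q * q * q) q * I0)); [ring|].
rewrite <- E, E7.
transitivity (((1 - q) * B * X) * ((1 - q) * B * X) * qpoch_inf (q * q * q) q * RtoC (4 * PI)).
- rewrite <- E2, E1; ring.
- rewrite XB; ring.
Qed.

Lemma aw_integral h a b c d : (0 < Cmod h < 1)%R ->
  (Cmod a < 1)%R -> (Cmod b < 1)%R -> (Cmod c < 1)%R -> (Cmod d < 1)%R ->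
  let q := h * h in
  is_CInt (fun th => aw_weight q a b c d (cis th)) 0 (2 * PI)
    (RtoC (4 * PI) * qpoch_inf (a * b * c * d) q
     / (qpoch_inf q q * (qpoch_inf (a * b) q * qpoch_inf (a * c) q * qpoch_inf (a * d) q
        * qpoch_inf (b * c) q * qpoch_inf (b * d) q * qpoch_inf (c * d) q))).
Proof.
intros Hh Ha Hb Hc Hd q.
assert (Hq : (0 < Cmod q < 1)%R) by (unfold q; rewrite Cmod_mult; nra).
assert (Hq1 := proj2 Hq).
assert (H0 : (Cmod 0 < 1)%R) by (rewrite Cmod_0; lra).
destruct (aw_int_ex q Hq 0 0 0 0 H0 H0 H0 H0) as [I0 HI0].
destruct (aw_int_ex q Hq a b c d) as [I HI]; auto.
assert (E0 := aw_const h I0 Hh HI0); fold q in E0.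
assert (E := aw_int_const q Hq a b c d I I0 Ha Hb Hc Hd HI HI0).
assert (N := qpoch_inf_mult_neq0 q Hq1).
assert (Nq : qpoch_inf q q <> 0) by now apply qpoch_inf_neq0_small.
replace (_ / _) with I; auto.
rewrite <- E0.
match goal with |- _ = _ / (?x * ?y) => apply (Cmult_eq_reg_l (x * y)) end.
- repeat apply Cmult_neq_0; auto.
- transitivity (qpoch_inf q q * (qpoch_inf (a * b) q * qpoch_inf (a * c) q * qpoch_inf (a * d) q
    * qpoch_inf (b * c) q * qpoch_inf (b * d) q * qpoch_inf (c * d) q * I)); [ring|].
  rewrite E; field; repeat split; auto.
Qed.

(** * The integral of h(r)/(h(a)h(b)h(c)h(d)h(t)) *)

(** This is b^n (r/b; q)_n without the division: a polynomial in b and r that makes sense at b =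
    0. *)
Fixpoint bpoch (b r q : C) (n : nat) : C :=
  match n with O => 1 | S m => bpoch b r q m * (b - r * q ^ m) end.

Lemma bpoch_shift b r q n : bpoch (b * q) r q (S n) = q ^ n * (b * q - r) * bpoch b r q n.
Proof.
induction n as [|n IH]; [simpl; ring|].
transitivity (bpoch (b * q) r q (S n) * (b * q - r * q ^ S n)); [reflexivity|].
rewrite IH; simpl; ring.
Qed.

(** The factor of index m vanishes at b = r q^m; this makes the 8-phi-7 terminate there. *)
Lemma bpoch_zero r q m j : (m < j)%nat -> bpoch (r * q ^ m) r q j = 0.
Proof.
induction j as [|j IH]; intros H; [lia|simpl].
destruct (Nat.eq_dec m j) as [->|N]; [ring|rewrite IH by lia; ring].
Qed.

(** What remains of [telescope_step] at j = i + 1, with Q = q^i, after all common products are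
    cancelled. *)
Lemma telescoping_core a c d b t r q Q :
  (t * ((1 - a * b) * (1 - c * b) * (1 - d * b)) * (Q * (b * q - r)) * (t - r * Q) * (1 - a * c * d * t * (q * Q))
   - b * ((1 - a * t) * (1 - c * t) * (1 - d * t)) * (Q * (t * q - r)) * (b - r * Q) * (1 - a * c * d * b * (q * Q))
   - (t - b) * (1 - b * t) * (b - r * Q) * (t - r * Q)
       * (1 - a * c * d * b * (q * Q)) * (1 - a * c * d * t * (q * Q)))
   * (1 - a * c * d * r * (q * Q * Q))
  = (t - b) * b * t * ((1 - a * c * (q * Q)) * (1 - a * d * (q * Q)) * (1 - c * d * (q * Q))
        * (1 - a * c * d * r * Q) * (b - r * Q) * (t - r * Q)
     - (1 - q * Q) * ((1 - a * r * Q) * (1 - c * r * Q) * (1 - d * r * Q))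
        * (1 - a * c * d * b * (q * Q)) * (1 - a * c * d * t * (q * Q))).
Proof. ring. Qed.

(** [X] will contain the summation index besides a complex parameter, so that one bound serves all
    terms of a series. *)
Definition bounded_on {X} (A : X -> Prop) (f : X -> C) : Prop :=
  exists B, (0 <= B)%R /\ forall x, A x -> (Cmod (f x) <= B)%R.

Section Bounds.
Variables (X : Type) (A : X -> Prop) (q : C).
Hypothesis Hq : (Cmod q < 1)%R.

Lemma bounded_on_le f B : (forall x, A x -> (Cmod (f x) <= B)%R) -> bounded_on A f.
Proof.
intros H; exists (Rabs B); split; [apply Rabs_pos|].
intros x Hx; apply Rle_trans with (1 := H x Hx), Rle_abs.
Qed.

Lemma bounded_on_const c : bounded_on A (fun _ => c).
Proof. apply bounded_on_le with (Cmod c); intros; lra. Qed.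

Lemma bounded_on_mult f g : bounded_on A f -> bounded_on A g -> bounded_on A (fun x => f x * g x).
Proof.
intros [B [_ H]] [B' [_ H']]; apply bounded_on_le with (B * B')%R; intros x Hx.
rewrite Cmod_mult; apply Rmult_le_compat; auto using Cmod_ge_0.
Qed.

Lemma bounded_on_minus f g : bounded_on A f -> bounded_on A g -> bounded_on A (fun x => f x - g x).
Proof.
intros [B [_ H]] [B' [_ H']]; apply bounded_on_le with (B + B')%R; intros x Hx.
apply Rle_trans with (1 := Cmod_minus_triangle _ _); generalize (H x Hx) (H' x Hx); lra.
Qed.

Lemma bounded_on_qpow f k : bounded_on A f -> bounded_on A (fun x => f x * q ^ k x).
Proof.
intros [B [_ H]]; apply bounded_on_le with B; intros x Hx.
apply Rle_trans with (2 := H x Hx); now apply Cmod_mult_qpow_le.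
Qed.

Lemma bounded_on_qpoch f k : bounded_on A f -> bounded_on A (fun x => qpoch (f x) q (k x)).
Proof.
intros [B [_ H]]; apply bounded_on_le with (exp (B / (1 - Cmod q))); intros x Hx.
apply qpoch_bound; auto.
Qed.

Lemma bounded_on_qpoch_inf f : bounded_on A f -> bounded_on A (fun x => qpoch_inf (f x) q).
Proof.
intros [B [_ H]]; apply bounded_on_le with (exp (B / (1 - Cmod q))); intros x Hx.
apply qpoch_inf_bound; auto.
Qed.

Lemma bounded_on_inv_qpoch f k s : (s < 1)%R -> (forall x, A x -> (Cmod (f x) <= s)%R) ->
  bounded_on A (fun x => / qpoch (f x) q (k x)).
Proof.
intros Hs H; apply bounded_on_le with (/ exp (- (s / (1 - s) / (1 - Cmod q))))%R; intros x Hx.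
specialize (H x Hx).
rewrite Cmod_inv by (apply qpoch_neq0_small; auto; lra).
apply Rinv_le_contravar; [apply exp_pos|now apply qpoch_lower].
Qed.

Lemma bounded_on_inv_qpoch_inf f s : (s < 1)%R -> (forall x, A x -> (Cmod (f x) <= s)%R) ->
  bounded_on A (fun x => / qpoch_inf (f x) q).
Proof.
intros Hs H; apply bounded_on_le with (/ exp (- (s / (1 - s) / (1 - Cmod q))))%R; intros x Hx.
specialize (H x Hx).
rewrite Cmod_inv by (apply qpoch_inf_neq0_small; auto; lra).
apply Rinv_le_contravar; [apply exp_pos|now apply qpoch_inf_lower].
Qed.

End Bounds.

(** The factors are at most rho (1 + (B/rho) |q|^k). The rate rho^n, beyond mere boundedness, is
    what makes the series converge. *)
Lemma bpoch_bound rho B b r q n : (Cmod q < 1)%R -> (0 < rho)%R ->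
  (Cmod b <= rho)%R -> (Cmod r <= B)%R ->
  (Cmod (bpoch b r q n) <= rho ^ n * exp (B / rho / (1 - Cmod q)))%R.
Proof.
intros Hq Hrho Hb Hr; assert (K := Cmod_q_range q Hq).
assert (HB : (0 <= B / rho)%R).
{ apply Rmult_le_pos; [generalize (Cmod_ge_0 r); lra|left; now apply Rinv_0_lt_compat]. }
set (R := (B / rho)%R) in *.
apply Rle_trans with (rho ^ n * exp (R * ((1 - Cmod q ^ n) / (1 - Cmod q))))%R.
- induction n as [|n IH]; simpl.
  + rewrite Cmod_1; replace (R * ((1 - 1) / (1 - Cmod q)))%R with 0%R by (field; lra).
    rewrite exp_0; lra.
  + rewrite Cmod_mult.
    replace (R * ((1 - Cmod q * Cmod q ^ n) / (1 - Cmod q)))%R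
      with (R * ((1 - Cmod q ^ n) / (1 - Cmod q)) + R * Cmod q ^ n)%R by (field; lra).
    rewrite exp_plus.
    replace (rho * rho ^ n * (exp (R * ((1 - Cmod q ^ n) / (1 - Cmod q))) * exp (R * Cmod q ^ n)))%R
      with (rho ^ n * exp (R * ((1 - Cmod q ^ n) / (1 - Cmod q))) * (rho * exp (R * Cmod q ^ n)))%R by ring.
    apply Rmult_le_compat; auto using Cmod_ge_0.
    apply Rle_trans with (rho * (1 + R * Cmod q ^ n))%R.
    * apply Rle_trans with (1 := Cmod_minus_triangle _ _).
      rewrite Cmod_mult, Cmod_pow.
      replace (rho * (1 + R * Cmod q ^ n))%R with (rho + B * Cmod q ^ n)%R by (unfold R; field; lra).
      apply Rplus_le_compat; auto.
      apply Rmult_le_compat_r; [apply pow_le; lra|auto].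
    * apply Rmult_le_compat_l; [lra|apply exp_ineq1_le].
- apply Rmult_le_compat_l; [apply pow_le; lra|].
  apply exp_le, Rmult_le_compat_l; auto.
  unfold Rdiv; rewrite <- (Rmult_1_l (/ (1 - Cmod q))) at 2.
  apply Rmult_le_compat_r; [left; apply Rinv_0_lt_compat; lra|].
  generalize (pow_le (Cmod q) n (proj1 K)); lra.
Qed.

(** * Series with geometric majorants *)

Definition Cseries (f : nat -> C) : C := Clim (csum f).

Lemma Cseries_err f B kappa : (0 <= kappa < 1)%R ->
  (forall k, (Cmod (f k) <= B * kappa ^ k)%R) ->
  forall n, (Cmod (csum f n - Cseries f) <= B / (1 - kappa) * kappa ^ n)%R.
Proof.
intros Hk H; apply Clim_geom; auto.
intros n; simpl; replace (csum f n + f n - csum f n) with (f n) by ring; auto.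
Qed.

Lemma Cseries_cv f B kappa : (0 <= kappa < 1)%R ->
  (forall k, (Cmod (f k) <= B * kappa ^ k)%R) -> Ccv (csum f) (Cseries f).
Proof. intros Hk H; eapply Ccv_le; [exact Hk|now apply Cseries_err]. Qed.

(** Weierstrass' M-test within the uniform closure. *)
Lemma panalytic_series rho (f : nat -> R * C -> C) B kappa : (0 <= kappa < 1)%R ->
  (forall k, panalytic rho (f k)) ->
  (forall k x, cdisc rho (snd x) -> (Cmod (f k x) <= B * kappa ^ k)%R) ->
  panalytic rho (fun x => Cseries (fun k => f k x)).
Proof.
intros Hk Hf Hb.
apply (uclos_lim _ _ _ _ (fun n x => csum (fun k => f k x) n) (B / (1 - kappa))%R kappa); auto.
- intros n; now apply panalytic_csum.
- intros n x Hx; rewrite Cmod_minus_comm.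
  now apply (Cseries_err (fun k => f k x) B kappa Hk (fun k => Hb k x Hx)).
Qed.

Lemma panalytic_bpoch rho u v q n : panalytic rho u -> panalytic rho v ->
  panalytic rho (fun x => bpoch (u x) (v x) q n).
Proof.
intros Hu Hv; induction n as [|n IH]; simpl; [apply panalytic_const|].
apply panalytic_mult; auto; apply panalytic_minus; auto.
apply panalytic_mult; auto using panalytic_const.
Qed.

(** * The five-parameter integral: contiguous relation, terminating case, analytic continuation *)

Section FiveParameters.
Variables (q a c d r : C).
Hypothesis Hq : (0 < Cmod q < 1)%R.
Hypothesis Ha : (Cmod a < 1)%R.
Hypothesis Hc : (Cmod c < 1)%R.
Hypothesis Hd : (Cmod d < 1)%R.

Let Hq1 : (Cmod q < 1)%R := proj2 Hq.

(* The five-parameter integral is a multiple of the sum over j of vcoef j * psi j b * psi j t;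
   psi j b collects everything that depends on b. *)
Definition psi (j : nat) (b : C) : C :=
  qpoch_inf (a * c * d * b * q ^ j) q * bpoch b r q j
  * (/ qpoch_inf (a * b) q * / qpoch_inf (c * b) q * / qpoch_inf (d * b) q).

(** Shifted infinite products such as (ar q^j; q)_inf represent 1/(ar; q)_j up to a constant, so
    there is no denominator and the expression is entire in r. *)
Definition vnum (j : nat) : C :=
  qpoch (a * c) q j * qpoch (a * d) q j * qpoch (c * d) q j
  * (qpoch_inf (a * r * q ^ j) q * qpoch_inf (c * r * q ^ j) q * qpoch_inf (d * r * q ^ j) q).

(** With lam = acdr/q, 1/(lam q^j; q)_inf is (lam; q)_j/(lam; q)_inf. So this contains the
    very-well-poised part (1 - lam q^(2j)) (lam; q)_j/(q; q)_j of the series, and all its poles in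
    r. *)
Definition vcoef (j : nat) : C :=
  (1 - a * c * d * r * / q * q ^ (2 * j)) * / qpoch q q j
  * / qpoch_inf (a * c * d * r * / q * q ^ j) q * vnum j.

(* Antidifference, in j, of the contiguous relation satisfied by vcoef j * psi j b * psi j t. *)
Definition telescope (b t : C) (j : nat) : C :=
  match j with
  | O => 0
  | S i => (t - b) * b * t * (bpoch b r q i * bpoch t r q i)
      * (qpoch (a * c) q j * qpoch (a * d) q j * qpoch (c * d) q j)
      * (qpoch_inf (a * r * q ^ i) q * qpoch_inf (c * r * q ^ i) q * qpoch_inf (d * r * q ^ i) q)
      * (qpoch_inf (a * c * d * b * q ^ j) q * qpoch_inf (a * c * d * t * q ^ j) q)
      * (/ qpoch_inf (a * b) q * / qpoch_inf (c * b) q * / qpoch_inf (d * b) q)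
      * (/ qpoch_inf (a * t) q * / qpoch_inf (c * t) q * / qpoch_inf (d * t) q)
      * (/ qpoch q q i * / qpoch_inf (a * c * d * r * q ^ i) q)
  end.

Hypothesis Hr : (Cmod r < Cmod q)%R.

Lemma Cmod_r_lt1 : (Cmod r < 1)%R.
Proof. lra. Qed.

Lemma Cmod_acd_lt1 x : (Cmod x < 1)%R -> (Cmod (a * c * d * x) < 1)%R.
Proof. intros; repeat apply Cmod_mult_lt1; auto. Qed.

(** The purpose of the assumption |r| < |q|: it keeps the denominators of [vcoef] away from 0. *)
Lemma Cmod_lam : (Cmod (a * c * d * r * / q) < 1)%R.
Proof.
assert (Q0 : q <> 0) by now apply q_neq0.
replace (a * c * d * r * / q) with (a * c * d * (r * / q)) by ring.
apply Cmod_acd_lt1; rewrite Cmod_mult, Cmod_inv by auto.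
apply Rmult_lt_reg_r with (Cmod q); [lra|]; rewrite Rmult_assoc, Rinv_l; lra.
Qed.

Lemma psi_shift j b : (Cmod b < 1)%R ->
  psi j (b * q) = qpoch_inf (a * c * d * b * q ^ S j) q * bpoch (b * q) r q j
   * ((1 - a * b) * (1 - c * b) * (1 - d * b))
   * (/ qpoch_inf (a * b) q * / qpoch_inf (c * b) q * / qpoch_inf (d * b) q).
Proof.
intros Hb; unfold psi.
replace (a * c * d * (b * q) * q ^ j) with (a * c * d * b * q ^ S j) by (simpl; ring).
replace (a * (b * q)) with (a * b * q) by ring.
replace (c * (b * q)) with (c * b * q) by ring.
replace (d * (b * q)) with (d * b * q) by ring.
rewrite !(inv_qpoch_inf_shift q Hq) by now apply Cmod_mult_lt1.
ring.
Qed.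

(** Since t (1 - b z)(1 - b/z) - b (1 - t z)(1 - t/z) = (t - b)(1 - b t), the integral I satisfies t
    I(bq, t) - b I(b, tq) = (t - b)(1 - b t) I(b, t). The left side here is the defect of this
    relation in a single term of the series. *)
Lemma telescope_step b t j : (Cmod b < 1)%R -> (Cmod t < 1)%R ->
  vcoef j * (t * psi j (b * q) * psi j t - b * psi j b * psi j (t * q)
     - (t - b) * (1 - b * t) * psi j b * psi j t)
  = telescope b t (S j) - telescope b t j.
Proof.
intros Hb Ht.
assert (Q0 : q <> 0) by now apply q_neq0.
rewrite !psi_shift by auto; unfold psi, vcoef, vnum, telescope.
assert (Ib : forall x, qpoch_inf (a * c * d * x * q ^ j) q
   = (1 - a * c * d * x * q ^ j) * qpoch_inf (a * c * d * x * q ^ S j) q).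
{ intros x; rewrite (qpoch_inf_S q Hq1 (a * c * d * x * q ^ j)); f_equal; f_equal; simpl; ring. }
rewrite (Ib b), (Ib t).
set (Xb := qpoch_inf (a * c * d * b * q ^ S j) q); set (Xt := qpoch_inf (a * c * d * t * q ^ S j) q).
set (Yb := / qpoch_inf (a * b) q * / qpoch_inf (c * b) q * / qpoch_inf (d * b) q).
set (Yt := / qpoch_inf (a * t) q * / qpoch_inf (c * t) q * / qpoch_inf (d * t) q).
assert (Lr : (Cmod (a * c * d * r) < 1)%R) by (apply Cmod_acd_lt1; lra).
(* [telescope] at 0 is 0 by definition and has no preceding index, so j = 0 is checked directly; for
   j = i + 1 all products are reduced to index i and [telescoping_core] finishes. *)
destruct j as [|i].
- assert (L0 : qpoch_inf (a * c * d * r * / q * q ^ 0) q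
    = (1 - a * c * d * r * / q) * qpoch_inf (a * c * d * r) q).
  { replace (a * c * d * r * / q * q ^ 0) with (a * c * d * r * / q) by (simpl; ring).
    rewrite (qpoch_inf_S q Hq1); f_equal; f_equal; field; auto. }
  rewrite L0.
  replace (a * c * d * r * q ^ 0) with (a * c * d * r) by (simpl; ring).
  assert (N1 : 1 - a * c * d * r * / q <> 0) by apply one_minus_neq0, Cmod_lam.
  assert (N2 : qpoch_inf (a * c * d * r) q <> 0) by now apply qpoch_inf_neq0_small.
  cbn [qpoch bpoch Nat.mul Nat.add]; simpl (q ^ 0).
  set (L := qpoch_inf (a * c * d * r) q) in *.
  set (A1 := qpoch_inf (a * r * 1) q); set (C1 := qpoch_inf (c * r * 1) q).
  set (D1 := qpoch_inf (d * r * 1) q).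
  assert (N3 : q - a * c * d * r <> 0).
  { intros E; apply N1; replace (a * c * d * r) with q; [field; auto|].
    replace q with (q - a * c * d * r + a * c * d * r) by ring; rewrite E; ring. }
  field; repeat split; auto.
- assert (EL : a * c * d * r * / q * q ^ S i = a * c * d * r * q ^ i) by (simpl; field; auto).
  assert (EL2 : a * c * d * r * / q * q ^ (2 * S i) = a * c * d * r * (q * q ^ i * q ^ i)).
  { replace (2 * S i)%nat with (S (S (i + i))) by lia; rewrite !Cpow_S, Cpow_add_r; field; auto. }
  rewrite EL, EL2, !bpoch_shift.
  assert (Ir : forall x, qpoch_inf (x * r * q ^ i) q = (1 - x * r * q ^ i) * qpoch_inf (x * r * q ^ S i) q).
  { intros x; rewrite (qpoch_inf_S q Hq1 (x * r * q ^ i)); f_equal; f_equal; simpl; ring. }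
  assert (IL : qpoch_inf (a * c * d * r * q ^ i) q
    = (1 - a * c * d * r * q ^ i) * qpoch_inf (a * c * d * r * q ^ S i) q).
  { rewrite (qpoch_inf_S q Hq1 (a * c * d * r * q ^ i)); f_equal; f_equal; simpl; ring. }
  rewrite (Ir a), (Ir c), (Ir d), IL.
  assert (N1 : 1 - a * c * d * r * q ^ i <> 0) by now apply one_minus_neq0, Cmod_mult_qpow_lt1.
  assert (N2 : qpoch_inf (a * c * d * r * q ^ S i) q <> 0)
    by now apply qpoch_inf_neq0_small, Cmod_mult_qpow_lt1.
  assert (N3 : qpoch q q i <> 0) by now apply qpoch_neq0_small.
  assert (N4 : 1 - q * q ^ i <> 0) by now apply one_minus_neq0, Cmod_mult_qpow_lt1.
  set (L := qpoch_inf (a * c * d * r * q ^ S i) q) in *.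
  set (A1 := qpoch_inf (a * r * q ^ S i) q); set (C1 := qpoch_inf (c * r * q ^ S i) q).
  set (D1 := qpoch_inf (d * r * q ^ S i) q).
  replace (qpoch q q (S i)) with (qpoch q q i * (1 - q * q ^ i)) by reflexivity.
  replace (qpoch (a * c) q (S (S i))) with (qpoch (a * c) q (S i) * (1 - a * c * (q * q ^ i))) by reflexivity.
  replace (qpoch (a * d) q (S (S i))) with (qpoch (a * d) q (S i) * (1 - a * d * (q * q ^ i))) by reflexivity.
  replace (qpoch (c * d) q (S (S i))) with (qpoch (c * d) q (S i) * (1 - c * d * (q * q ^ i))) by reflexivity.
  cbn [bpoch].
  replace (q ^ S i) with (q * q ^ i) by reflexivity.
  set (Q := q ^ i) in *; set (qi := qpoch q q i) in *.
  set (P1 := qpoch (a * c) q (S i)); set (P2 := qpoch (a * d) q (S i)); set (P3 := qpoch (c * d) q (S i)).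
  set (Bb := bpoch b r q i); set (Bt := bpoch t r q i).
  assert (K := telescoping_core a c d b t r q Q).
  set (COM := Bb * Bt * (P1 * P2 * P3) * (A1 * C1 * D1) * (Xb * Xt) * Yb * Yt
        * / (qi * (1 - q * Q) * (1 - a * c * d * r * Q) * L)).
  match type of K with ?x = ?y => transitivity (COM * x); [|rewrite K] end;
    unfold COM; field; auto.
Qed.

Lemma telescope_sum b t n : (Cmod b < 1)%R -> (Cmod t < 1)%R ->
  t * csum (fun j => vcoef j * psi j (b * q) * psi j t) n
  - b * csum (fun j => vcoef j * psi j b * psi j (t * q)) n
  - (t - b) * (1 - b * t) * csum (fun j => vcoef j * psi j b * psi j t) n
  = telescope b t n.
Proof.
intros Hb Ht; induction n as [|n IH]; [simpl; ring|].
cbn [csum].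
replace (telescope b t (S n)) with (telescope b t n + (telescope b t (S n) - telescope b t n)) by ring.
rewrite <- telescope_step, <- IH by auto; ring.
Qed.

Variable h : C.
Hypothesis Hh : q = h * h.

Definition nr_const : C :=
  RtoC (4 * PI) / (qpoch_inf q q * (qpoch_inf (a * c) q * qpoch_inf (a * d) q * qpoch_inf (c * d) q)).

Lemma Cmod_h : (0 < Cmod h < 1)%R.
Proof.
assert (E : (Cmod q = Cmod h * Cmod h)%R) by now rewrite Hh, Cmod_mult.
generalize (Cmod_ge_0 h); intros P; split.
- destruct P as [P|P]; auto; rewrite <- P in E; lra.
- destruct (Rlt_le_dec (Cmod h) 1); auto; nra.
Qed.

Lemma aw_integral_acd t : (Cmod t < 1)%R ->
  is_CInt (fun th => aw_weight q a c d t (cis th)) 0 (2 * PI)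
   (nr_const * (qpoch_inf (a * c * d * t) q
      * (/ qpoch_inf (a * t) q * / qpoch_inf (c * t) q * / qpoch_inf (d * t) q))).
Proof.
intros Ht; assert (H := aw_integral h a c d t Cmod_h Ha Hc Hd Ht); cbv zeta in H.
rewrite <- Hh in H.
match type of H with is_CInt _ _ _ ?x => replace (_ * _) with x; [exact H|] end.
assert (N := qpoch_inf_mult_neq0 q Hq1).
assert (Nq : qpoch_inf q q <> 0) by now apply qpoch_inf_neq0_small.
unfold nr_const; field; repeat split; auto.
Qed.

(** At b = r q^m the quotient h(r)/h(b) is a finite product, and m = 0 is the Askey-Wilson integral.
    The induction solves the contiguous relation for the value at b q, which divides by t and calls
    the hypothesis at t q as well; hence t <> 0 and the generalization over t. *)
Lemma nr_terminating (m : nat) (t : C) : t <> 0 -> (Cmod t < 1)%R ->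
  is_CInt (fun th => aw_weight q a c d t (cis th)
             * (qpoch (r * cis th) q m * qpoch (r * / cis th) q m)) 0 (2 * PI)
   (nr_const * csum (fun j => vcoef j * psi j (r * q ^ m) * psi j t) (S m)).
Proof.
assert (Q0 : q <> 0) by now apply q_neq0.
assert (R1 := Cmod_r_lt1).
revert t; induction m as [|m IH]; intros t Ht0 Ht.
- replace (csum _ 1) with (qpoch_inf (a * c * d * t) q
      * (/ qpoch_inf (a * t) q * / qpoch_inf (c * t) q * / qpoch_inf (d * t) q)).
  + apply is_CInt_ext with (2 := aw_integral_acd t Ht); intros th; simpl; ring.
  + cbn [csum]; unfold vcoef, vnum, psi; cbn [qpoch bpoch Nat.mul Nat.add Cpow].
    rewrite !Cmult_1_r, !Cmult_1_l, Cplus_0_l.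
    rewrite (qpoch_inf_S q Hq1 (a * c * d * r * / q)).
    replace (a * c * d * r * / q * q) with (a * c * d * r) by (field; auto).
    assert (N1 : 1 - a * c * d * r * / q <> 0) by apply one_minus_neq0, Cmod_lam.
    assert (N2 : qpoch_inf (a * c * d * r) q <> 0).
    { apply qpoch_inf_neq0_small, Cmod_acd_lt1; auto. }
    assert (N := qpoch_inf_mult_neq0 q Hq1).
    set (L := qpoch_inf (a * c * d * r) q) in *.
    set (M := 1 - a * c * d * r * / q) in *.
    field; repeat split; auto.
- set (b := r * q ^ m).
  assert (Hb : (Cmod b < 1)%R) by now apply Cmod_mult_qpow_lt1.
  assert (Htq : (Cmod (t * q) < 1)%R) by (apply Cmod_mult_lt1; auto).
  assert (I1 := IH (t * q) (Cmult_neq_0 _ _ Ht0 Q0) Htq).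
  assert (I2 := IH t Ht0 Ht).
  assert (I3 := is_CInt_scal (/ t) _ _ _ _ (is_CInt_plus _ _ _ _ _ _ (is_CInt_scal b _ _ _ _ I1)
     (is_CInt_scal ((t - b) * (1 - b * t)) _ _ _ _ I2))).
  replace (r * q ^ S m) with (b * q) by (unfold b; simpl; ring).
  assert (T := telescope_sum b t (S (S m)) Hb Ht).
  (* The factor of index m is zero at b = r q^m. It removes the boundary term of the telescoping and
     the last term of the two sums at b, while the sum at b q keeps all its m + 2 terms. *)
  assert (Z0 : bpoch b r q (S m) = 0) by (apply bpoch_zero; lia).
  assert (Z1 : telescope b t (S (S m)) = 0) by (unfold telescope; rewrite Z0; ring).
  assert (Z2 : psi (S m) b = 0) by (unfold psi; rewrite Z0; ring).
  assert (Zs : forall y, csum (fun j => vcoef j * psi j b * psi j y) (S (S m))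
                     = csum (fun j => vcoef j * psi j b * psi j y) (S m)).
  { intros y; change (csum (fun j => vcoef j * psi j b * psi j y) (S m)
       + vcoef (S m) * psi (S m) b * psi (S m) y = csum (fun j => vcoef j * psi j b * psi j y) (S m)).
    rewrite Z2; ring. }
  rewrite !Zs, Z1 in T.
  match type of I3 with is_CInt _ _ _ ?x => replace (nr_const * _) with x end.
  + apply is_CInt_ext with (2 := I3); intros th.
    unfold aw_weight; rewrite ihh_shift by auto.
    cbn [qpoch]; fold b; set (z := cis th).
    assert (Hz : z <> 0) by apply cis_neq0.
    set (W := ibase q z * ihh q a z * ihh q c z * ihh q d z).
    replace (r * z * q ^ m) with (b * z) by (unfold b; ring).
    replace (r * / z * q ^ m) with (b * / z) by (unfold b; ring).
    field; auto.
  + fold b; apply (Cmult_eq_reg_l t); auto.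
    match type of T with _ * ?x - _ * ?y - _ * ?w = _ =>
      replace (t * (nr_const * x)) with (nr_const * (t * x)) by ring;
      replace (t * x) with (b * y + (t - b) * (1 - b * t) * w + (t * x - b * y - (t - b) * (1 - b * t) * w)) by ring
    end.
    rewrite T; field; auto.
Qed.

(* The integrand of the Nassrallah-Rahman integral, without its balancing condition. *)
Definition nr_weight (b t z : C) : C :=
  ibase q z * ihh q a z * ihh q c z * ihh q d z * ihh q b z * ihh q t z
  * (qpoch_inf (r * z) q * qpoch_inf (r * / z) q).

Definition nr_term (b t : C) (j : nat) : C := vcoef j * psi j b * psi j t.

Lemma psi_bound rho : (0 < rho < 1)%R ->
  exists B, (0 <= B)%R /\ forall j b, (Cmod b <= rho)%R -> (Cmod (psi j b) <= B * rho ^ j)%R.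
Proof.
intros Hrho.
set (A := fun x : nat * C => (Cmod (snd x) <= rho)%R).
assert (BB : forall w, bounded_on A (fun x => w * snd x)).
{ intros w; apply bounded_on_mult; [apply bounded_on_const|].
  apply bounded_on_le with rho; auto. }
assert (BI : forall w, (Cmod w < 1)%R -> bounded_on A (fun x => / qpoch_inf (w * snd x) q)).
{ intros w Hw; apply bounded_on_inv_qpoch_inf with rho; auto; [lra|].
  intros x Hx; unfold A in Hx; rewrite Cmod_mult; generalize (Cmod_ge_0 w) (Cmod_ge_0 (snd x)); nra. }
assert (BF : bounded_on A (fun x => qpoch_inf (a * c * d * snd x * q ^ fst x) q
  * (/ qpoch_inf (a * snd x) q * / qpoch_inf (c * snd x) q * / qpoch_inf (d * snd x) q))).
{ apply bounded_on_mult.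
  - apply bounded_on_qpoch_inf, (bounded_on_qpow _ A q Hq1 (fun x => a * c * d * snd x)); auto.
  - repeat apply bounded_on_mult; auto. }
destruct BF as [B [HB BF]].
exists (B * exp (Cmod r / rho / (1 - Cmod q)))%R; split.
{ apply Rmult_le_pos; auto; left; apply exp_pos. }
intros j b Hb; unfold psi.
replace (_ * _) with ((qpoch_inf (a * c * d * b * q ^ j) q
   * (/ qpoch_inf (a * b) q * / qpoch_inf (c * b) q * / qpoch_inf (d * b) q)) * bpoch b r q j) by ring.
rewrite Cmod_mult, Rmult_assoc, (Rmult_comm (exp _)).
apply Rmult_le_compat; auto using Cmod_ge_0.
- exact (BF (j, b) Hb).
- apply bpoch_bound; auto; lra.
Qed.

Lemma bounded_vnum : bounded_on (fun _ : nat => True) vnum.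
Proof.
unfold vnum; repeat apply bounded_on_mult; apply bounded_on_qpoch || apply bounded_on_qpoch_inf;
  auto using bounded_on_const; apply (bounded_on_qpow _ _ q Hq1); apply bounded_on_const.
Qed.

Lemma bounded_vcoef : bounded_on (fun _ : nat => True) vcoef.
Proof.
unfold vcoef; apply bounded_on_mult; [|apply bounded_vnum].
apply bounded_on_mult; [apply bounded_on_mult|].
- apply bounded_on_minus; [apply bounded_on_const|].
  apply (bounded_on_qpow _ _ q Hq1 (fun _ => a * c * d * r * / q)); apply bounded_on_const.
- apply bounded_on_inv_qpoch with (Cmod q); auto; intros; apply Rle_refl.
- apply bounded_on_inv_qpoch_inf with (Cmod (a * c * d * r * / q)); auto using Cmod_lam.
  intros j _; now apply Cmod_mult_qpow_le.
Qed.

(** Each of the two [psi] contributes rho^j, hence the ratio rho^2. *)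
Lemma nr_term_bound rho : (0 < rho < 1)%R ->
  exists B, forall b t j, (Cmod b <= rho)%R -> (Cmod t <= rho)%R ->
    (Cmod (nr_term b t j) <= B * (rho * rho) ^ j)%R.
Proof.
intros Hrho; destruct (psi_bound rho Hrho) as [B [HB H]]; destruct bounded_vcoef as [V [HV HV']].
exists (V * B * B)%R; intros b t j Hb Ht; unfold nr_term; rewrite !Cmod_mult, Rpow_mult_distr.
replace (V * B * B * (rho ^ j * rho ^ j))%R with (V * (B * rho ^ j) * (B * rho ^ j))%R by ring.
repeat apply Rmult_le_compat; auto using Cmod_ge_0.
apply Rmult_le_pos; apply Cmod_ge_0.
Qed.

Lemma panalytic_psi rho j : (rho < 1)%R -> panalytic rho (fun x => psi j (snd x)).
Proof.
intros Hrho; unfold psi.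
assert (BI : forall w, (Cmod w < 1)%R -> panalytic rho (fun x => / qpoch_inf (w * snd x) q)).
{ intros w Hw; apply panalytic_inv_qpoch_inf with rho; auto.
  - apply panalytic_mult; auto using panalytic_const, panalytic_snd.
  - intros x Hx; unfold cdisc in Hx; rewrite Cmod_mult; generalize (Cmod_ge_0 w) (Cmod_ge_0 (snd x)); nra. }
apply panalytic_mult; [apply panalytic_mult|].
- apply panalytic_qpoch_inf; auto.
  apply panalytic_mult; auto using panalytic_const.
  apply panalytic_mult; auto using panalytic_const, panalytic_snd.
- apply panalytic_bpoch; auto using panalytic_const, panalytic_snd.
- repeat apply panalytic_mult; auto.
Qed.

(** Both sides are analytic in b. The points r q^m, where the formula is known, tend to 0 and differ
    from 0 because r <> 0. *)
Lemma nr_integral_t_neq0 (b t : C) : r <> 0 -> t <> 0 -> (Cmod b < 1)%R -> (Cmod t < 1)%R ->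
  is_CInt (fun th => nr_weight b t (cis th)) 0 (2 * PI) (nr_const * Cseries (nr_term b t)).
Proof.
intros Hr0 Ht0 Hb Ht.
set (rho := ((1 + Rmax (Cmod b) (Rmax (Cmod t) (Cmod r))) / 2)%R).
assert (R1 := Cmod_r_lt1).
assert (M1 : (Rmax (Cmod b) (Rmax (Cmod t) (Cmod r)) < 1)%R) by (repeat apply Rmax_case; auto).
assert (M2 := Rmax_l (Cmod b) (Rmax (Cmod t) (Cmod r))).
assert (M3 := Rmax_r (Cmod b) (Rmax (Cmod t) (Cmod r))).
assert (M4 := Rmax_l (Cmod t) (Cmod r)); assert (M5 := Rmax_r (Cmod t) (Cmod r)).
assert (B0 := Cmod_ge_0 b).
assert (Hrho : (0 < rho < 1)%R) by (unfold rho; lra).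
assert (Q0 : q <> 0) by now apply q_neq0.
destruct (nr_term_bound rho Hrho) as [B HB].
assert (Hrr : (0 <= rho * rho < 1)%R) by nra.
apply (circle_int_identity rho (fun x => nr_weight (snd x) t (cis (fst x)))
   (fun z => nr_const * Cseries (nr_term z t)) (fun m => r * q ^ m)); try lra.
- unfold nr_weight; apply panalytic_mult; [|apply panalytic_mult].
  + apply panalytic_mult; [|now apply panalytic_ihh_fixed].
    apply panalytic_mult; [|apply panalytic_ihh_var; auto; lra].
    do 3 (apply panalytic_mult; [|now apply panalytic_ihh_fixed]).
    now apply panalytic_ibase.
  + apply panalytic_qpoch_inf; auto; apply panalytic_mult; auto using panalytic_const, panalytic_cis.
  + apply panalytic_qpoch_inf; auto; apply panalytic_mult; auto using panalytic_const, panalytic_inv_cis.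
- apply panalytic_mult; [apply panalytic_const|].
  apply (panalytic_series rho (fun k x => nr_term (snd x) t k) B (rho * rho)); auto.
  + intros k; unfold nr_term; apply panalytic_mult; [|apply panalytic_const].
    apply panalytic_mult; [apply panalytic_const|apply panalytic_psi; lra].
  + intros k x Hx; apply HB; auto; unfold rho; lra.
- apply (Ccv_le _ _ (Cmod r) (Cmod q)); [lra|intros n].
  replace (r * q ^ n - 0) with (r * q ^ n) by ring; rewrite Cmod_mult, Cmod_pow; lra.
- intros m; apply Cmult_neq_0; auto; now apply Cpow_nz.
- intros m Hm; cbn [fst snd].
  assert (T := nr_terminating m t Ht0 Ht).
  replace (Cseries (nr_term (r * q ^ m) t))
    with (csum (fun j => vcoef j * psi j (r * q ^ m) * psi j t) (S m)).
  + apply is_CInt_ext with (2 := T); intros th.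
    unfold nr_weight, aw_weight.
    set (z := cis th).
    assert (E : forall u, Cmod u = 1%R -> qpoch_inf (r * u) q = qpoch (r * u) q m * qpoch_inf (r * q ^ m * u) q).
    { intros u Hu; rewrite (qpoch_inf_split q Hq1 (r * u) m); do 2 f_equal; ring. }
    assert (N : forall u, Cmod u = 1%R -> qpoch_inf (r * q ^ m * u) q <> 0).
    { intros u Hu; apply qpoch_inf_neq0_small; auto; rewrite Cmod_mult, Hu, Rmult_1_r.
      now apply Cmod_mult_qpow_lt1. }
    assert (Hz1 : Cmod z = 1%R) by apply Cmod_cis.
    assert (Hz2 : Cmod (/ z) = 1%R) by (unfold z; rewrite cis_inv; apply Cmod_cis).
    rewrite (E z Hz1), (E (/ z) Hz2).
    generalize (N z Hz1) (N (/ z) Hz2); intros N1 N2.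
    set (W := ibase q z * ihh q a z * ihh q c z * ihh q d z).
    set (Y := ihh q t z); unfold ihh.
    field; auto.
  + assert (CV : Ccv (csum (nr_term (r * q ^ m) t)) (Cseries (nr_term (r * q ^ m) t))).
    { apply (Cseries_cv _ B (rho * rho)); auto.
      intros k; apply HB; [exact Hm|unfold rho; lra]. }
    apply (Ccv_unique (fun n => csum (nr_term (r * q ^ m) t) (S m + n))).
    * apply Ccv_ext with (fun _ => csum (nr_term (r * q ^ m) t) (S m)); [|apply Ccv_const].
      intros n; rewrite csum_add, (csum_zero (fun k => nr_term (r * q ^ m) t (S m + k))); [ring|].
      intros k _; unfold nr_term, psi; rewrite bpoch_zero by lia; ring.
    * apply (Ccv_subseq (csum (nr_term (r * q ^ m) t)) _ (fun n => S m + n)%nat); auto; intros; lia.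
- unfold rho; lra.
Qed.

(** Integrand and series are symmetric in b and t, so t <> 0 is traded for b <> 0: t may vanish in
    the theorem, whereas b is a nonzero power of q. *)
Lemma nr_integral (b t : C) : r <> 0 -> b <> 0 -> (Cmod b < 1)%R -> (Cmod t < 1)%R ->
  is_CInt (fun th => nr_weight b t (cis th)) 0 (2 * PI) (nr_const * Cseries (nr_term b t)).
Proof.
intros Hr0 Hb0 Hb Ht.
replace (Cseries (nr_term b t)) with (Cseries (nr_term t b)).
- apply is_CInt_ext with (2 := nr_integral_t_neq0 t b Hr0 Hb0 Ht Hb).
  intros th; unfold nr_weight; ring.
- apply (f_equal Cseries), functional_extensionality; intros j; unfold nr_term; ring.
Qed.

End FiveParameters.

(** * Terminating summations *)

(** The pattern of Pascal's rule: inner terms split in two, and each end term belongs to one sum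
    only. *)
Lemma csum_split_shift (f u v : nat -> C) n :
  f O = u O -> (forall k, (k < n)%nat -> f (S k) = u (S k) + v k) -> f (S n) = v n ->
  csum f (S (S n)) = csum u (S n) + csum v (S n).
Proof.
intros H0 H1 H2; rewrite csum_Sl, (csum_Sl u); cbn [csum].
rewrite H0, H2, (csum_ext (fun k => f (S k)) (fun k => u (S k) + v k)) by auto.
rewrite csum_plus; ring.
Qed.

(* [qtri q n] is q^(n(n-1)/2). *)
Fixpoint qtri (q : C) (n : nat) : C :=
  match n with O => 1 | S m => qtri q m * q ^ m end.

Lemma qtri_add q m n : qtri q (m + n) = qtri q m * qtri q n * q ^ (m * n).
Proof.
induction n as [|n IH].
- rewrite Nat.add_0_r, Nat.mul_0_r; simpl; ring.
- rewrite Nat.add_succ_r, Nat.mul_succ_r; cbn [qtri]; rewrite IH, !Cpow_add_r; ring.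
Qed.

Section Terminating.
Variable q : C.
Hypothesis Hq : (0 < Cmod q < 1)%R.

Let Hq1 : (Cmod q < 1)%R := proj2 Hq.
Let Hq0 : q <> 0 := q_neq0 q Hq.

Lemma qtri_neq0 n : qtri q n <> 0.
Proof.
induction n as [|n IH]; simpl; [apply RtoC_neq0; lra|].
apply Cmult_neq_0; auto; now apply Cpow_nz.
Qed.

Lemma qfact_neq0 n : qpoch q q n <> 0.
Proof. now apply qpoch_neq0_small. Qed.

Definition gbin (n k : nat) : C := qpoch q q n / (qpoch q q k * qpoch q q (n - k)).

(** The q-Pfaff-Saalschuetz sum cleared of denominators, so that A, B, E are arbitrary. The
    induction uses (1 - AE)(1 - BE) = (1 - E)(1 - ABE) + (1 - A)(1 - B) E, with the hypothesis at
    (A, B, Eq) and at (Aq, Bq, E). *)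
Lemma q_saalschutz n A B E :
  csum (fun k => gbin n k * qpoch A q k * qpoch B q k * E ^ k
                 * qpoch (A * B * E * q ^ k) q (n - k) * qpoch E q (n - k)) (S n)
  = qpoch (A * E) q n * qpoch (B * E) q n.
Proof.
revert A B E; induction n as [|n IH]; intros A B E.
- simpl; unfold gbin; simpl; field; apply RtoC_neq0; lra.
- rewrite !(qpoch_Sl _ q n).
  transitivity ((1 - E) * (1 - A * B * E) * (qpoch (A * (E * q)) q n * qpoch (B * (E * q)) q n)
    + (1 - A) * (1 - B) * E * (qpoch (A * q * E) q n * qpoch (B * q * E) q n)).
  2:{ replace (A * (E * q)) with (A * E * q) by ring; replace (B * (E * q)) with (B * E * q) by ring.
      replace (A * q * E) with (A * E * q) by ring; replace (B * q * E) with (B * E * q) by ring; ring. }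
  rewrite <- !IH, <- !csum_scal.
  apply csum_split_shift.
  + unfold gbin; rewrite !Nat.sub_0_r.
    change (q ^ 0) with (RtoC 1); change (E ^ 0) with (RtoC 1); change ((E * q) ^ 0) with (RtoC 1).
    change (qpoch A q 0) with (RtoC 1); change (qpoch B q 0) with (RtoC 1).
    change (qpoch q q 0) with (RtoC 1).
    rewrite (qpoch_Sl (A * B * E * 1) q n), (qpoch_Sl E q n).
    replace (A * B * (E * q) * 1) with (A * B * E * q) by ring.
    replace (A * B * E * 1) with (A * B * E) by ring.
    assert (N := qfact_neq0 n); assert (N' := qfact_neq0 (S n)).
    field; auto.
  + intros k Hk.
    destruct (Nat.le_exists_sub (S k) n Hk) as [m [Em _]].
    replace n with (S k + m)%nat in * by lia.
    replace (S (S k + m) - S k)%nat with (S m) by lia.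
    replace (S k + m - S k)%nat with m by lia.
    replace (S k + m - k)%nat with (S m) by lia.
    unfold gbin.
    replace (S (S k + m) - S k)%nat with (S m) by lia.
    replace (S k + m - S k)%nat with m by lia.
    replace (S k + m - k)%nat with (S m) by lia.
    rewrite (qpoch_Sl A q k), (qpoch_Sl B q k), (qpoch_Sl E q m).
    rewrite (qpoch_Sl (A * B * E * q ^ S k)).
    replace (A * B * (E * q) * q ^ S k) with (A * B * E * q ^ S k * q) by ring.
    replace (A * q * (B * q) * E * q ^ k) with (A * B * E * q ^ S k * q) by (simpl; ring).
    replace (qpoch (A * B * E * q ^ S k * q) q (S m))
      with (qpoch (A * B * E * q ^ S k * q) q m * (1 - A * B * E * q ^ S k * q * q ^ m)) by reflexivity.
    replace (qpoch q q (S (S k + m))) with (qpoch q q (S k + m) * (1 - q * q ^ (S k + m))) by reflexivity.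
    replace (qpoch q q (S m)) with (qpoch q q m * (1 - q * q ^ m)) by reflexivity.
    replace (qpoch q q (S k)) with (qpoch q q k * (1 - q * q ^ k)) by reflexivity.
    assert (N1 := qfact_neq0 k); assert (N2 := qfact_neq0 m).
    assert (N3 : 1 - q * q ^ k <> 0) by now apply one_minus_neq0, Cmod_mult_qpow_lt1.
    assert (N4 : 1 - q * q ^ m <> 0) by now apply one_minus_neq0, Cmod_mult_qpow_lt1.
    rewrite Cpow_add_r, !Cpow_mult_l.
    replace (q ^ S k) with (q * q ^ k) by reflexivity.
    replace (E ^ S k) with (E * E ^ k) by reflexivity.
    field; auto.
  + unfold gbin; rewrite !Nat.sub_diag.
    rewrite (qpoch_Sl A q n), (qpoch_Sl B q n).
    assert (N := qfact_neq0 n); assert (N' := qfact_neq0 (S n)).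
    change (qpoch q q 0) with (RtoC 1); change (E ^ S n) with (E * E ^ n).
    change (qpoch E q 0) with (RtoC 1).
    change (qpoch (A * B * E * q ^ S n) q 0) with (RtoC 1).
    change (qpoch (A * q * (B * q) * E * q ^ n) q 0) with (RtoC 1).
    field; auto.
Qed.

(** Reversal of the order of the factors, relating (q^(1-M)/x; q)_M to (x; q)_M. *)
Lemma qpoch_reverse (x : C) M : x <> 0 ->
  qpoch (q / (q ^ M * x)) q M * x ^ M * qtri q M = (- (1)) ^ M * qpoch x q M.
Proof.
intros Hx; induction M as [|M IH]; [simpl; ring|].
rewrite qpoch_Sl.
assert (NM : q ^ M <> 0) by now apply Cpow_nz.
replace (q / (q ^ S M * x) * q) with (q / (q ^ M * x)) by (simpl; field; auto).
cbn [qtri qpoch].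
transitivity ((qpoch (q / (q ^ M * x)) q M * x ^ M * qtri q M) * ((1 - q / (q ^ S M * x)) * x * q ^ M)).
{ simpl; ring. }
rewrite IH; simpl; field; auto.
Qed.

(** [q_saalschutz] at A = x y q^(n-1)/e, B = e, E = q^(1-n)/y, where reversal turns (E; q)_(n-k)
    into (y q^k; q)_(n-k). In this form the coefficients are those of a series containing (q^-n;
    q)_k. *)
Lemma q_saalschutz_rev (n : nat) (x y e : C) : y <> 0 -> e <> 0 ->
  csum (fun k => gbin n k * (- (1)) ^ k * qtri q (S k) / q ^ (n * k)
       * qpoch (x * y * q ^ n / (e * q)) q k * qpoch e q k
       * qpoch (x * q ^ k) q (n - k) * qpoch (y * q ^ k) q (n - k)) (S n)
  = e ^ n * qpoch (x / e) q n * qpoch (y / e) q n.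
Proof.
intros Hy He.
assert (Nn : q ^ n <> 0) by now apply Cpow_nz.
assert (Ny : y ^ n <> 0) by now apply Cpow_nz.
assert (Ne : e ^ n <> 0) by now apply Cpow_nz.
assert (Nt := qtri_neq0 n).
assert (Nye : y / e <> 0).
{ intros E; apply Hy; replace y with (y / e * e) by (field; auto); rewrite E; ring. }
assert (S1 := q_saalschutz n (x * y * q ^ n / (e * q)) e (q / (q ^ n * y))).
replace (x * y * q ^ n / (e * q) * (q / (q ^ n * y))) with (x / e) in S1 by (field; auto).
replace (e * (q / (q ^ n * y))) with (q / (q ^ n * (y / e))) in S1 by (field; auto).
assert (R := qpoch_reverse (y / e) n Nye).
replace ((y / e) ^ n) with (y ^ n / e ^ n) in R.
2:{ unfold Cdiv; rewrite Cpow_mult_l, Cpow_inv; auto. }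
assert (SQ : (- (1)) ^ n * (- (1)) ^ n = 1).
{ rewrite <- Cpow_mult_l; replace (- (1) * - (1)) with (RtoC 1) by ring; apply Cpow_1_l. }
transitivity ((- (1)) ^ n * y ^ n * qtri q n *
   (qpoch (x / e) q n * qpoch (q / (q ^ n * (y / e))) q n)).
- rewrite <- S1, <- csum_scal; apply csum_ext; intros k Hk.
  destruct (Nat.le_exists_sub k n ltac:(lia)) as [M [EM _]].
  replace (n - k)%nat with M by lia.
  replace (x * y * q ^ n / (e * q) * e * (q / (q ^ n * y)) * q ^ k) with (x * q ^ k) by (field; auto).
  assert (Nk : q ^ k <> 0) by now apply Cpow_nz.
  assert (Nyk : y * q ^ k <> 0) by now apply Cmult_neq_0.
  assert (R2 := qpoch_reverse (y * q ^ k) M Nyk).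
  replace (q ^ M * (y * q ^ k)) with (q ^ n * y) in R2 by (rewrite EM, Cpow_add_r; ring).
  assert (Nm := qtri_neq0 M).
  assert (NM : (y * q ^ k) ^ M <> 0) by now apply Cpow_nz.
  replace (qpoch (q / (q ^ n * y)) q M) with ((- (1)) ^ M * qpoch (y * q ^ k) q M / ((y * q ^ k) ^ M * qtri q M))
    by (rewrite <- R2; field; auto).
  replace (qtri q n) with (qtri q M * qtri q k * q ^ (M * k)) by (rewrite EM; symmetry; apply qtri_add).
  replace ((q / (q ^ n * y)) ^ k) with (q ^ k / (q ^ (n * k) * y ^ k)).
  2:{ unfold Cdiv; rewrite Cpow_mult_l, Cpow_inv, Cpow_mult_l, <- Cpow_mult_r; auto.
      now apply Cmult_neq_0. }
  rewrite Cpow_mult_l, <- Cpow_mult_r, (Nat.mul_comm k M).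
  replace (y ^ n) with (y ^ M * y ^ k) by (rewrite EM; symmetry; apply Cpow_add_r).
  assert (SQM : (- (1)) ^ n * (- (1)) ^ M = (- (1)) ^ k).
  { apply (Cmult_eq_reg_l ((- (1)) ^ n)).
    - apply Cpow_nz; intros E; injection E; lra.
    - rewrite Cmult_assoc, SQ, EM, Cpow_add_r.
      replace ((- (1)) ^ M * (- (1)) ^ k * (- (1)) ^ k) with ((- (1)) ^ M * ((- (1)) ^ k * (- (1)) ^ k)) by ring.
      rewrite <- (Cpow_mult_l _ _ k); replace (- (1) * - (1)) with (RtoC 1) by ring; rewrite Cpow_1_l; ring. }
  cbn [qtri]; rewrite <- SQM.
  assert (Nnk : q ^ (n * k) <> 0) by now apply Cpow_nz.
  assert (NMk : q ^ (M * k) <> 0) by now apply Cpow_nz.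
  assert (NyM : y ^ M <> 0) by now apply Cpow_nz.
  assert (Nyk' : y ^ k <> 0) by now apply Cpow_nz.
  field; repeat split; auto.
- apply (Cmult_eq_reg_l (/ e ^ n)).
  { intros E; apply (f_equal (fun w => w * e ^ n)) in E.
    rewrite Cinv_l, Cmult_0_l in E by auto; injection E; lra. }
  transitivity ((- (1)) ^ n * qpoch (x / e) q n *
     (qpoch (q / (q ^ n * (y / e))) q n * (y ^ n / e ^ n) * qtri q n)); [unfold Cdiv; ring|].
  rewrite R.
  transitivity (((- (1)) ^ n * (- (1)) ^ n) * qpoch (x / e) q n * qpoch (y / e) q n); [ring|].
  rewrite SQ; field; auto.
Qed.

(* [pcoef n D k] is (q^-n, q^(n-1) D; q)_k q^k / (q; q)_k. *)
Definition pcoef (n : nat) (D : C) (k : nat) : C :=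
  gbin n k * (- (1)) ^ k * qtri q (S k) / q ^ (n * k) * qpoch (D * q ^ n / q) q k.

(** For k = j + m with j fixed, the coefficient turns into one for a sum over m of length N = n - j,
    so that the inner sum of a rearranged double sum is again of Saalschuetz type. *)
Lemma pcoef_split n D j N m : n = (j + N)%nat -> (m <= N)%nat ->
  pcoef n D (j + m) * gbin (j + m) j
  = pcoef n D j * (gbin N m * (- (1)) ^ m * qtri q (S m) / q ^ (N * m) * qpoch (D * q ^ n / q * q ^ j) q m).
Proof.
intros En Hm; unfold pcoef, gbin.
replace (n - (j + m))%nat with (N - m)%nat by lia.
replace (j + m - j)%nat with m by lia.
replace (n - j)%nat with N by lia.
rewrite (qpoch_add (D * q ^ n / q)), (Cpow_add_r (- (1))); cbn [qtri]; rewrite qtri_add, (Cpow_add_r q j m).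
replace (q ^ (n * (j + m))) with (q ^ (n * j) * q ^ (N * m) * q ^ (j * m)).
2:{ rewrite <- !Cpow_add_r; f_equal; rewrite En; ring. }
assert (N1 : q ^ (n * j) <> 0) by now apply Cpow_nz.
assert (N2 : q ^ (N * m) <> 0) by now apply Cpow_nz.
assert (N3 : q ^ (j * m) <> 0) by now apply Cpow_nz.
assert (F := qfact_neq0).
field; repeat split; auto.
Qed.

(* The balanced 4-phi-3 of the Askey-Wilson polynomial, with distinguished parameter a. *)
Definition aw_sum (n : nat) (a b c d z : C) : C :=
  csum (fun k => pcoef n (a * b * c * d) k * (qpoch (a * z) q k * qpoch (a * / z) q k)
     / (qpoch (a * b) q k * qpoch (a * c) q k * qpoch (a * d) q k)) (S n).

(** [q_saalschutz] with A = az, B = a/z, E = b/a expands (bz, b/z; q)_k in the products (az, a/z;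
    q)_j. After interchanging the sums, the sum over m = k - j is [q_saalschutz_rev] with x = bc
    q^j, y = bd q^j, e = b/a. *)
Lemma aw_sum_sears (n : nat) (a b c d z : C) : a <> 0 -> b <> 0 -> d <> 0 -> z <> 0 ->
  (Cmod a < 1)%R -> (Cmod b < 1)%R -> (Cmod c < 1)%R -> (Cmod d < 1)%R ->
  aw_sum n b a c d z
  = (b / a) ^ n * (qpoch (a * c) q n * qpoch (a * d) q n)
    / (qpoch (b * c) q n * qpoch (b * d) q n) * aw_sum n a b c d z.
Proof.
intros Ha0 Hb0 Hd0 Hz Ha Hb Hc Hd; unfold aw_sum.
assert (NP := qpoch_mult_neq0 q Hq1).
set (D := a * b * c * d).
replace (b * a * c * d) with D by (unfold D; ring).
set (f := fun k j => pcoef n D k / (qpoch (b * a) q k * qpoch (b * c) q k * qpoch (b * d) q k)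
   * (gbin k j * qpoch (a * z) q j * qpoch (a * / z) q j * (b / a) ^ j
      * qpoch (a * z * (a * / z) * (b / a) * q ^ j) q (k - j) * qpoch (b / a) q (k - j))).
transitivity (csum (fun k => csum (fun j => f k j) (S k)) (S n)).
{ apply csum_ext; intros k Hk; unfold f; rewrite csum_scal, q_saalschutz.
  replace (a * z * (b / a)) with (b * z) by (field; auto).
  replace (a * / z * (b / a)) with (b * / z) by (field; auto).
  field; auto. }
rewrite csum_triangle, <- csum_scal; apply csum_ext; intros j Hj.
set (N := (n - j)%nat); assert (En : n = (j + N)%nat) by (unfold N; lia).
replace (S n - j)%nat with (S N) by lia.
assert (Nyq : b * d * q ^ j <> 0).
{ repeat apply Cmult_neq_0; auto; now apply Cpow_nz. }
assert (Nba : b / a <> 0).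
{ intros E; apply Hb0; replace b with (b / a * a) by (field; auto); rewrite E; ring. }
assert (S2 := q_saalschutz_rev N (b * c * q ^ j) (b * d * q ^ j) (b / a) Nyq Nba).
replace (b * c * q ^ j * (b * d * q ^ j) * q ^ N / (b / a * q)) with (D * q ^ n / q * q ^ j) in S2.
2:{ unfold D; rewrite En, Cpow_add_r; field; auto. }
replace (b * c * q ^ j / (b / a)) with (a * c * q ^ j) in S2 by (field; auto).
replace (b * d * q ^ j / (b / a)) with (a * d * q ^ j) in S2 by (field; auto).
assert (SP : forall u v, qpoch (u * v) q n = qpoch (u * v) q j * qpoch (u * v * q ^ j) q N).
{ intros u v; rewrite <- qpoch_add, <- En; reflexivity. }
transitivity (pcoef n D j * (qpoch (a * z) q j * qpoch (a * / z) q j) * (b / a) ^ j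
  / (qpoch (b * a) q j * qpoch (b * c) q n * qpoch (b * d) q n)
  * ((b / a) ^ N * qpoch (a * c * q ^ j) q N * qpoch (a * d * q ^ j) q N)).
- rewrite <- S2, <- csum_scal; apply csum_ext; intros m Hm.
  unfold f.
  replace (j + m - j)%nat with m by lia.
  replace (a * z * (a * / z) * (b / a) * q ^ j) with (b * a * q ^ j) by (field; auto).
  assert (SQ : forall u v, qpoch (u * v) q n
     = qpoch (u * v) q (j + m) * qpoch (u * v * q ^ j * q ^ m) q (N - m)).
  { intros u v.
    replace (u * v * q ^ j * q ^ m) with (u * v * q ^ (j + m)) by (rewrite Cpow_add_r; ring).
    rewrite <- qpoch_add; f_equal; lia. }
  rewrite (SQ b c), (SQ b d), (qpoch_add (b * a)).
  assert (P := pcoef_split n D j N m En ltac:(lia)).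
  assert (N1 : qpoch (b * c * q ^ j * q ^ m) q (N - m) <> 0).
  { now apply qpoch_neq0_small, Cmod_mult_qpow_lt1, Cmod_mult_qpow_lt1, Cmod_mult_lt1. }
  assert (N2 : qpoch (b * d * q ^ j * q ^ m) q (N - m) <> 0).
  { now apply qpoch_neq0_small, Cmod_mult_qpow_lt1, Cmod_mult_qpow_lt1, Cmod_mult_lt1. }
  assert (N3 : qpoch (b * a * q ^ j) q m <> 0).
  { now apply qpoch_neq0_small, Cmod_mult_qpow_lt1, Cmod_mult_lt1. }
  transitivity ((pcoef n D (j + m) * gbin (j + m) j) * ((qpoch (a * z) q j * qpoch (a * / z) q j) * (b / a) ^ j
    * qpoch (b / a) q m / (qpoch (b * a) q j * qpoch (b * c) q (j + m) * qpoch (b * d) q (j + m)))).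
  { field; repeat split; auto. }
  rewrite P; set (G := gbin N m * _ * _ / _).
  field; repeat split; auto.
- rewrite (SP a c), (SP a d).
  replace ((b / a) ^ n) with ((b / a) ^ j * (b / a) ^ N) by (rewrite <- Cpow_add_r; f_equal; lia).
  set (X := (b / a) ^ j); set (Y := (b / a) ^ N).
  replace (b * a) with (a * b) by ring.
  field; repeat split; auto.
Qed.

Lemma bpoch_qpoch b e n : bpoch b (b * e) q n = b ^ n * qpoch e q n.
Proof. induction n as [|n IH]; simpl; [ring|rewrite IH; ring]. Qed.

(** For r = b e the dependence on k becomes the ratio (q/e; q)_k/(q^(1-j)/e; q)_k, the form in which
    the sum over k can be evaluated. *)
Lemma bpoch_mult_qpow (b e : C) j k : e <> 0 -> b <> 0 -> (forall i, (i < k)%nat -> q / (q ^ j * e) * q ^ i <> 1) ->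
  bpoch (b * q ^ k) (b * e) q j * qpoch (q / (q ^ j * e)) q k = qpoch (q / e) q k * bpoch b (b * e) q j.
Proof.
intros He Hb; induction k as [|k IH]; intros H.
- simpl; rewrite !Cmult_1_r; ring.
- specialize (IH ltac:(intros; apply H; lia)); specialize (H k ltac:(lia)).
  cbn [qpoch].
  replace (b * q ^ S k) with (b * q ^ k * q) by (simpl; ring).
  destruct j as [|i].
  + simpl; replace (q / (1 * e)) with (q / e) by (field; auto); ring.
  + rewrite bpoch_shift.
    cbn [bpoch] in IH.
    set (Z := 1 - q / (q ^ S i * e) * q ^ k) in *.
    assert (NZ : Z <> 0) by now apply Cminus_neq0, not_eq_sym.
    set (P := qpoch (q / (q ^ S i * e)) q k) in *.
    assert (Ni : q ^ i <> 0) by now apply Cpow_nz.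
    assert (E : b * q ^ k - b * e * q ^ i = - (b * e * q ^ i * Z)).
    { unfold Z; simpl; field; auto. }
    rewrite E in IH.
    assert (Nm : - (b * e * q ^ i) <> 0).
    { replace (- (b * e * q ^ i)) with (- (1) * (b * (e * q ^ i))) by ring.
      repeat apply Cmult_neq_0; auto; intros E'; injection E'; lra. }
    apply (Cmult_eq_reg_l (- (b * e * q ^ i))); auto.
    transitivity (bpoch (b * q ^ k) (b * e) q i * - (b * e * q ^ i * Z) * P * (q ^ i * (b * q ^ k * q - b * e))).
    { ring. }
    rewrite IH; simpl; field; auto.
Qed.

(** [q_saalschutz_rev] with x = D q^j, y = q^(1-j)/e, and q/e in the place of its e. The value
    contains (q^-j; q)_n, which is 0 for j < n: this is how the polynomial annihilates the first n
    terms. *)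
Lemma pcoef_bpoch_sum (n j : nat) (D b e : C) : e <> 0 -> b <> 0 -> (Cmod e < Cmod q ^ n)%R ->
  (Cmod D < 1)%R ->
  csum (fun k => pcoef n D k * bpoch (b * q ^ k) (b * e) q j / qpoch D q (j + k)) (S n)
  = if (j <? n)%nat then 0 else
    b ^ n * bpoch b (b * e) q (j - n) * qpoch (D * e * q ^ j / q) q n
    * (qpoch q q j / (qpoch q q (j - n) * qpoch D q (j + n))).
Proof.
intros He Hb Hen HD.
assert (Nj : q ^ j <> 0) by now apply Cpow_nz.
assert (He1 : (Cmod e < 1)%R).
{ apply Rlt_le_trans with (1 := Hen); rewrite <- (pow1 n); apply pow_incr; lra. }
(* Equality would mean q^(i+1) = e q^j, whereas |q|^(i+1) >= |q|^n > |e|. *)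
assert (Hne : forall i, (i < n)%nat -> q / (q ^ j * e) * q ^ i <> 1).
{ intros i Hi E.
  assert (E2 : q ^ S i = e * q ^ j).
  { replace (q ^ S i) with (q / (q ^ j * e) * q ^ i * (e * q ^ j)) by (simpl; field; auto).
    rewrite E; ring. }
  apply (f_equal Cmod) in E2; rewrite Cmod_mult, !Cmod_pow in E2.
  assert (L1 : (Cmod q ^ n <= Cmod q ^ S i)%R).
  { replace n with (S i + (n - S i))%nat by lia; rewrite pow_add.
    rewrite <- (Rmult_1_r (Cmod q ^ S i)) at 2; apply Rmult_le_compat_l; [apply pow_le; lra|].
    rewrite <- (pow1 (n - S i)); apply pow_incr; lra. }
  assert (L2 : (Cmod e * Cmod q ^ j <= Cmod e)%R).
  { rewrite <- (Rmult_1_r (Cmod e)) at 2; apply Rmult_le_compat_l; [apply Cmod_ge_0|].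
    rewrite <- (pow1 j); apply pow_incr; lra. }
  lra. }
assert (NZ : qpoch (q / (q ^ j * e)) q n <> 0) by now apply qpoch_neq0.
assert (Nqe : q / e <> 0).
{ intros E; apply Hq0; replace q with (q / e * e) by (field; auto); rewrite E; ring. }
assert (Ny : q / (q ^ j * e) <> 0).
{ intros E; apply Hq0; replace q with (q / (q ^ j * e) * (q ^ j * e)) by (field; auto); rewrite E; ring. }
assert (S2 := q_saalschutz_rev n (D * q ^ j) (q / (q ^ j * e)) (q / e) Ny Nqe).
replace (D * q ^ j * (q / (q ^ j * e)) * q ^ n / (q / e * q)) with (D * q ^ n / q) in S2 by (field; auto).
replace (D * q ^ j / (q / e)) with (D * e * q ^ j / q) in S2 by (field; auto).
replace (q / (q ^ j * e) / (q / e)) with (/ q ^ j) in S2 by (field; auto).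
assert (ND : forall k, qpoch D q k <> 0) by (intros; now apply qpoch_neq0_small).
assert (NB : bpoch b (b * e) q j <> 0).
{ rewrite bpoch_qpoch; apply Cmult_neq_0; [now apply Cpow_nz|now apply qpoch_neq0_small]. }
transitivity (bpoch b (b * e) q j / (qpoch (q / (q ^ j * e)) q n * qpoch D q (j + n))
   * ((q / e) ^ n * qpoch (D * e * q ^ j / q) q n * qpoch (/ q ^ j) q n)).
- rewrite <- S2, <- csum_scal; apply csum_ext; intros k Hk.
  assert (B := bpoch_mult_qpow b e j k He Hb ltac:(intros; apply Hne; lia)).
  assert (SZ : qpoch (q / (q ^ j * e)) q n
     = qpoch (q / (q ^ j * e)) q k * qpoch (q / (q ^ j * e) * q ^ k) q (n - k)).
  { rewrite <- qpoch_add; f_equal; lia. }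
  assert (SD : qpoch D q (j + n) = qpoch D q (j + k) * qpoch (D * q ^ j * q ^ k) q (n - k)).
  { replace (D * q ^ j * q ^ k) with (D * q ^ (j + k)) by (rewrite Cpow_add_r; ring).
    rewrite <- qpoch_add; f_equal; lia. }
  assert (Nk := NZ); rewrite SZ in Nk.
  assert (Nk1 : qpoch (q / (q ^ j * e)) q k <> 0) by (intros E; apply Nk; rewrite E; ring).
  assert (Nk2 : qpoch (q / (q ^ j * e) * q ^ k) q (n - k) <> 0) by (intros E; apply Nk; rewrite E; ring).
  assert (Nk3 := ND (j + n)%nat); rewrite SD in Nk3.
  assert (Nk4 : qpoch (D * q ^ j * q ^ k) q (n - k) <> 0) by (intros E; apply Nk3; rewrite E; ring).
  replace (bpoch (b * q ^ k) (b * e) q j)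
    with (qpoch (q / e) q k * bpoch b (b * e) q j / qpoch (q / (q ^ j * e)) q k)
    by (rewrite <- B; field; auto).
  rewrite SZ, SD; unfold pcoef; set (G := gbin n k * _ * _ / _).
  field; repeat split; auto.
- destruct (Nat.ltb_spec j n) as [L|L].
  + replace (qpoch (/ q ^ j) q n) with (RtoC 0); [unfold Cdiv; ring|].
    replace n with (j + S (n - S j))%nat by lia; rewrite qpoch_add, qpoch_Sl, Cinv_l by auto; ring.
  + set (i := (j - n)%nat); assert (Ej : j = (i + n)%nat) by (unfold i; lia).
    assert (Ni : q ^ i <> 0) by now apply Cpow_nz.
    assert (Nn : q ^ n <> 0) by now apply Cpow_nz.
    assert (Nei : e * q ^ i <> 0) by now apply Cmult_neq_0.
    assert (NSi : q ^ S i <> 0) by now apply Cpow_nz.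
    assert (R1 := qpoch_reverse (e * q ^ i) n Nei).
    assert (R2 := qpoch_reverse (q ^ S i) n NSi).
    replace (q ^ n * (e * q ^ i)) with (q ^ j * e) in R1 by (rewrite Ej, Cpow_add_r; ring).
    replace (q / (q ^ n * q ^ S i)) with (/ q ^ j) in R2 by (rewrite Ej, Cpow_add_r; simpl; field; auto).
    assert (Nt := qtri_neq0 n).
    assert (Fj : qpoch q q j = qpoch q q i * qpoch (q ^ S i) q n).
    { rewrite Ej, qpoch_add; do 2 f_equal; simpl; ring. }
    assert (Be : bpoch b (b * e) q j = b ^ n * bpoch b (b * e) q i * qpoch (e * q ^ i) q n).
    { rewrite !bpoch_qpoch, Ej, qpoch_add, Cpow_add_r; ring. }
    assert (Nq2 : qpoch (e * q ^ i) q n <> 0) by now apply qpoch_neq0_small, Cmod_mult_qpow_lt1.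
    assert (Nen : (e * q ^ i) ^ n <> 0) by now apply Cpow_nz.
    assert (NSn : (q ^ S i) ^ n <> 0) by now apply Cpow_nz.
    assert (Nen' : e ^ n <> 0) by now apply Cpow_nz.
    (* Reversing (q^-j; q)_n and (q^(1-j)/e; q)_n makes the negative powers of q cancel. *)
    assert (Key : (q / e) ^ n * qpoch (/ q ^ j) q n * qpoch (e * q ^ i) q n
      = qpoch (q / (q ^ j * e)) q n * qpoch (q ^ S i) q n).
    { assert (P1 : (q / e) ^ n * (e * q ^ i) ^ n = (q ^ S i) ^ n).
      { rewrite <- Cpow_mult_l; f_equal; simpl; field; auto. }
      apply (Cmult_eq_reg_l ((q ^ S i) ^ n * (e * q ^ i) ^ n * qtri q n * (- (1)) ^ n)).
      { repeat apply Cmult_neq_0; auto; apply Cpow_nz; intros E; injection E; lra. }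
      transitivity ((qpoch (/ q ^ j) q n * (q ^ S i) ^ n * qtri q n)
          * ((- (1)) ^ n * qpoch (e * q ^ i) q n) * ((q / e) ^ n * (e * q ^ i) ^ n)); [ring|].
      rewrite R2, <- R1, P1; ring. }
    rewrite Be, Fj.
    set (Y := qpoch (D * e * q ^ j / q) q n); set (BI := bpoch b (b * e) q i).
    transitivity (b ^ n * BI * Y / (qpoch (q / (q ^ j * e)) q n * qpoch D q (j + n))
      * ((q / e) ^ n * qpoch (/ q ^ j) q n * qpoch (e * q ^ i) q n)).
    { field; auto. }
    rewrite Key; assert (F := qfact_neq0 i); field; auto.
Qed.

End Terminating.

(** * Integrals against the Askey-Wilson polynomials *)

Lemma Ccv_csum (f : nat -> nat -> C) (l : nat -> C) n :
  (forall k, (k < n)%nat -> Ccv (fun N => f N k) (l k)) ->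
  Ccv (fun N => csum (f N) n) (csum l n).
Proof.
induction n as [|n IH]; intros H; [exact (Ccv_const 0)|].
apply (Ccv_plus (fun N => csum (f N) n) (fun N => f N n)); [apply IH; intros; apply H; lia|apply H; lia].
Qed.

Section PolynomialIntegral.
Variables (h q a b c d t : C) (n : nat).
Hypothesis Hq : (0 < Cmod q < 1)%R.
Hypothesis Hh : q = h * h.
Hypothesis Ha : (Cmod a < 1)%R.
Hypothesis Hb : (Cmod b < 1)%R.
Hypothesis Hc : (Cmod c < 1)%R.
Hypothesis Hd : (Cmod d < 1)%R.
Hypothesis Ht : (Cmod t < 1)%R.
Hypothesis Hb0 : b <> 0.

Let Hq1 : (Cmod q < 1)%R := proj2 Hq.

Let D := b * a * c * d.

Lemma Cmod_D : (Cmod D < 1)%R.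
Proof. unfold D; repeat apply Cmod_mult_lt1; auto. Qed.

Lemma ihh_shift_pow u k th : (Cmod u < 1)%R ->
  ihh q (u * q ^ k) (cis th) = qpoch (u * cis th) q k * qpoch (u * / cis th) q k * ihh q u (cis th).
Proof.
intros Hu; induction k as [|k IH].
- replace (u * q ^ 0) with u by (simpl; ring); simpl; ring.
- replace (u * q ^ S k) with (u * q ^ k * q) by (simpl; ring).
  rewrite ihh_shift, IH by (auto; now apply Cmod_mult_qpow_lt1).
  simpl; ring.
Qed.

(* The first parameter of the 8-phi-7. *)
Definition mu (r : C) : C := a * c * d * r * q ^ (2 * n) * / q.

(** The term of index j = n + i after the sum over k has been carried out and multiplied by (mu r;
    q)_inf. No denominator depends on r. *)
Definition aw_poly_term (r : C) (i : nat) : C :=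
  (1 - mu r * q ^ (2 * i)) * qpoch (mu r) q i * / qpoch q q i * vnum q a c d r (n + i)
  * (bpoch t r q (n + i) * qpoch_inf (a * c * d * t * q ^ (n + i)) q)
  * (bpoch b r q i * / qpoch D q (2 * n + i)).

Definition aw_poly_const : C :=
  nr_const q a c d * qpoch_inf D q * b ^ n
  * (/ qpoch_inf (a * b) q * / qpoch_inf (c * b) q * / qpoch_inf (d * b) q)
  * (/ qpoch_inf (a * t) q * / qpoch_inf (c * t) q * / qpoch_inf (d * t) q).

(** (ab; q)_k/(ab; q)_inf = 1/(ab q^k; q)_inf, and likewise for bc and bd, so the denominators of
    the polynomial in base b cancel and k survives only in the summand of [pcoef_bpoch_sum]. *)
Lemma psi_pcoef r j k :
  pcoef q n D k / (qpoch (b * a) q k * qpoch (b * c) q k * qpoch (b * d) q k) * psi q a c d r j (b * q ^ k)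
  = qpoch_inf D q * (/ qpoch_inf (a * b) q * / qpoch_inf (c * b) q * / qpoch_inf (d * b) q)
    * (pcoef q n D k * bpoch (b * q ^ k) r q j / qpoch D q (j + k)).
Proof.
unfold psi.
assert (E : forall u, qpoch_inf (u * b) q = qpoch (b * u) q k * qpoch_inf (u * (b * q ^ k)) q).
{ intros u; rewrite (qpoch_inf_split q Hq1 (u * b) k); f_equal; f_equal; ring. }
rewrite !E.
rewrite (qpoch_inf_split q Hq1 D (j + k)).
replace (a * c * d * (b * q ^ k) * q ^ j) with (D * q ^ (j + k)) by (unfold D; rewrite Cpow_add_r; ring).
assert (N1 : forall u, (Cmod u < 1)%R -> qpoch (b * u) q k <> 0).
{ intros; apply qpoch_neq0_small; auto; now apply Cmod_mult_lt1. }
assert (N2 : forall u, (Cmod u < 1)%R -> qpoch_inf (u * (b * q ^ k)) q <> 0).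
{ intros; apply qpoch_inf_neq0_small; auto; apply Cmod_mult_lt1; auto; now apply Cmod_mult_qpow_lt1. }
assert (N3 : qpoch D q (j + k) <> 0) by (apply qpoch_neq0_small; auto; apply Cmod_D).
field; repeat split; auto.
Qed.

(** The factor (lam q^(n+j); q)_n produced by the summation cancels the head of (lam q^(n+j); q)_inf
    in [vcoef]. What remains is (mu q^j; q)_inf, and (mu; q)_inf divided by it is (mu; q)_j. *)
Lemma vcoef_aw_poly_term r j : (Cmod r < Cmod q)%R ->
  qpoch_inf (mu r) q * (vcoef q a c d r (n + j) * (qpoch (a * c * d * r * / q * q ^ (n + j)) q n
     * (qpoch q q (n + j) / qpoch q q j)))
  = (1 - mu r * q ^ (2 * j)) * qpoch (mu r) q j * / qpoch q q j * vnum q a c d r (n + j).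
Proof.
intros Hr; unfold vcoef.
assert (Hl : (Cmod (a * c * d * r * / q) < 1)%R) by now apply Cmod_lam.
set (lam := a * c * d * r * / q) in *.
assert (Em : mu r = lam * q ^ (2 * n)) by (unfold mu, lam; ring).
rewrite Em.
rewrite (qpoch_inf_split q Hq1 (lam * q ^ (n + j)) n), (qpoch_inf_split q Hq1 (lam * q ^ (2 * n)) j).
replace (lam * q ^ (n + j) * q ^ n) with (lam * q ^ (2 * n) * q ^ j).
2:{ rewrite <- !Cmult_assoc, <- !Cpow_add_r; do 2 f_equal; lia. }
replace (lam * q ^ (2 * n) * q ^ (2 * j)) with (lam * q ^ (2 * (n + j))).
2:{ rewrite <- !Cmult_assoc, <- !Cpow_add_r; do 2 f_equal; lia. }
assert (N1 : qpoch (lam * q ^ (n + j)) q n <> 0) by now apply qpoch_neq0_small, Cmod_mult_qpow_lt1.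
assert (N2 : qpoch_inf (lam * q ^ (2 * n) * q ^ j) q <> 0)
  by now apply qpoch_inf_neq0_small, Cmod_mult_qpow_lt1, Cmod_mult_qpow_lt1.
assert (N3 := qfact_neq0 q Hq).
field; repeat split; auto.
Qed.

(** The bound is uniform on |r| <= R for every R, as analyticity in r on arbitrary discs
    requires. *)
Lemma aw_poly_term_bound R : exists B kappa, (0 <= kappa < 1)%R /\
  forall r i, (Cmod r <= R)%R -> (Cmod (aw_poly_term r i) <= B * kappa ^ i)%R.
Proof.
set (rho := ((1 + Rmax (Cmod b) (Cmod t)) / 2)%R).
assert (M1 : (Rmax (Cmod b) (Cmod t) < 1)%R) by (apply Rmax_case; auto).
assert (M2 := Rmax_l (Cmod b) (Cmod t)); assert (M3 := Rmax_r (Cmod b) (Cmod t)).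
assert (B0 := Cmod_ge_0 b).
assert (Hrho : (0 < rho < 1)%R) by (unfold rho; lra).
set (A := fun x : C * nat => (Cmod (fst x) <= R)%R).
assert (BR : bounded_on A (fun x => fst x)) by (now apply bounded_on_le with R).
assert (BM : bounded_on A (fun x => mu (fst x))).
{ unfold mu; repeat apply bounded_on_mult; auto; apply bounded_on_const. }
assert (BF : bounded_on A (fun x => (1 - mu (fst x) * q ^ (2 * snd x)) * qpoch (mu (fst x)) q (snd x)
   * / qpoch q q (snd x) * vnum q a c d (fst x) (n + snd x)
   * qpoch_inf (a * c * d * t * q ^ (n + snd x)) q * / qpoch D q (2 * n + snd x))).
{ apply bounded_on_mult; [apply bounded_on_mult; [apply bounded_on_mult; [apply bounded_on_mult;
    [apply bounded_on_mult|]|]|]|].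
  - apply bounded_on_minus; [apply bounded_on_const|].
    now apply (bounded_on_qpow _ A q Hq1 (fun x => mu (fst x)) (fun x => (2 * snd x)%nat)).
  - now apply bounded_on_qpoch.
  - apply bounded_on_inv_qpoch with (Cmod q); auto; intros; apply Rle_refl.
  - unfold vnum; apply bounded_on_mult; repeat apply bounded_on_mult;
      first [apply bounded_on_qpoch_inf; auto | apply bounded_on_qpoch; auto];
      try apply bounded_on_const;
      [apply (bounded_on_qpow _ A q Hq1 (fun x => a * fst x) (fun x => (n + snd x)%nat))
      |apply (bounded_on_qpow _ A q Hq1 (fun x => c * fst x) (fun x => (n + snd x)%nat))
      |apply (bounded_on_qpow _ A q Hq1 (fun x => d * fst x) (fun x => (n + snd x)%nat))];
      apply bounded_on_mult; auto; apply bounded_on_const.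
  - apply bounded_on_qpoch_inf; auto.
    apply (bounded_on_qpow _ A q Hq1 (fun x => a * c * d * t) (fun x => (n + snd x)%nat)), bounded_on_const.
  - apply bounded_on_inv_qpoch with (Cmod D); auto using Cmod_D; intros; apply Rle_refl. }
destruct BF as [B [HB BF]].
set (X := exp (R / rho / (1 - Cmod q))).
exists (B * (rho ^ n * X) * X)%R, (rho * rho)%R; split; [nra|].
intros r i Hr; rewrite Rpow_mult_distr; unfold aw_poly_term.
match goal with |- (Cmod (?x * (?y * ?z) * (?v * ?w)) <= _)%R =>
  replace (x * (y * z) * (v * w)) with ((x * z * w) * y * v) by ring end.
rewrite (Cmod_mult _ (bpoch b r q i)), (Cmod_mult _ (bpoch t r q (n + i))).
replace (B * (rho ^ n * X) * X * (rho ^ i * rho ^ i))%R with (B * (rho ^ (n + i) * X) * (rho ^ i * X))%R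
  by (rewrite pow_add; ring).
repeat apply Rmult_le_compat; auto using Cmod_ge_0.
- apply Rmult_le_pos; apply Cmod_ge_0.
- exact (BF (r, i) Hr).
- unfold X; apply bpoch_bound; auto; unfold rho; lra.
- unfold X; apply bpoch_bound; auto; unfold rho; lra.
Qed.

(** The first bound on |r| is that of the five-parameter integral at each b q^k; the second gives
    |e| < |q|^n for e = r/b, the condition of [pcoef_bpoch_sum]. *)
Lemma aw_poly_integral_small (r : C) : r <> 0 -> (Cmod r < Cmod q)%R -> (Cmod r < Cmod b * Cmod q ^ n)%R ->
  is_CInt (fun th => qpoch_inf (mu r) q * (aw_sum q n b a c d (cis th) * nr_weight q a c d r b t (cis th)))
    0 (2 * PI) (aw_poly_const * Cseries (aw_poly_term r)).
Proof.
intros Hr0 Hr Hrb.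
assert (Hbq : forall k, (Cmod (b * q ^ k) < 1)%R) by (intros; now apply Cmod_mult_qpow_lt1).
assert (Q0 : q <> 0) by now apply q_neq0.
assert (Hbq0 : forall k, b * q ^ k <> 0) by (intros; apply Cmult_neq_0; auto; now apply Cpow_nz).
set (w := fun k => pcoef q n D k / (qpoch (b * a) q k * qpoch (b * c) q k * qpoch (b * d) q k)).
set (Sk := fun k => Cseries (nr_term q a c d r (b * q ^ k) t)).
assert (I1 : is_CInt (fun th => aw_sum q n b a c d (cis th) * nr_weight q a c d r b t (cis th)) 0 (2 * PI)
   (csum (fun k => w k * (nr_const q a c d * Sk k)) (S n))).
{ apply is_CInt_ext with (fun th => csum (fun k => w k * nr_weight q a c d r (b * q ^ k) t (cis th)) (S n)).
  - intros th; unfold aw_sum; rewrite Cmult_comm, <- csum_scal; apply csum_ext; intros k _.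
    unfold nr_weight; rewrite ihh_shift_pow by auto; unfold w; fold D; unfold Cdiv; ring.
  - apply is_CInt_csum; intros k _; apply is_CInt_scal.
    apply (nr_integral q a c d r Hq Ha Hc Hd Hr h Hh); auto. }
replace (aw_poly_const * Cseries (aw_poly_term r)) with
  (qpoch_inf (mu r) q * csum (fun k => w k * (nr_const q a c d * Sk k)) (S n));
  [now apply is_CInt_scal|].
set (rho := ((1 + Rmax (Cmod b) (Cmod t)) / 2)%R).
assert (M1 : (Rmax (Cmod b) (Cmod t) < 1)%R) by (apply Rmax_case; auto).
assert (M2 := Rmax_l (Cmod b) (Cmod t)); assert (M3 := Rmax_r (Cmod b) (Cmod t)).
assert (B0 := Cmod_ge_0 b).
assert (Hrho : (0 < rho < 1)%R) by (unfold rho; lra).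
destruct (nr_term_bound q a c d r Hq Ha Hc Hd Hr rho Hrho) as [B HB].
assert (CV : forall k, Ccv (csum (nr_term q a c d r (b * q ^ k) t)) (Sk k)).
{ intros k; apply (Cseries_cv _ B (rho * rho)); [nra|].
  intros j; apply HB; [|unfold rho; lra].
  apply Rle_trans with (Cmod b); [now apply Cmod_mult_qpow_le|unfold rho; lra]. }
(* Stated for partial sums of n + m terms, so that only finite sums are interchanged. Their first n
   terms vanish, and m tends to infinity afterwards. *)
assert (E : forall m, qpoch_inf (mu r) q *
    csum (fun k => w k * (nr_const q a c d * csum (nr_term q a c d r (b * q ^ k) t) (n + m))) (S n)
    = aw_poly_const * csum (aw_poly_term r) m).
{ intros m.
  transitivity (csum (fun j => qpoch_inf (mu r) q * nr_const q a c d * vcoef q a c d r j * psi q a c d r j t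
      * csum (fun k => w k * psi q a c d r j (b * q ^ k)) (S n)) (n + m)).
  { transitivity (csum (fun k => csum (fun j => qpoch_inf (mu r) q * nr_const q a c d * vcoef q a c d r j
        * psi q a c d r j t * (w k * psi q a c d r j (b * q ^ k))) (n + m)) (S n)).
    - rewrite <- csum_scal; apply csum_ext; intros k _.
      rewrite <- !csum_scal; apply csum_ext; intros j _; unfold nr_term; ring.
    - rewrite csum_exchange; apply csum_ext; intros j _; now rewrite csum_scal. }
  set (e := r / b).
  assert (Er : r = b * e) by (unfold e; field; auto).
  assert (He0 : e <> 0).
  { intros E; apply Hr0; rewrite Er, E; ring. }
  assert (Hen : (Cmod e < Cmod q ^ n)%R).
  { assert (Bp : (0 < Cmod b)%R) by now apply Cmod_gt_0.
    apply Rmult_lt_reg_l with (Cmod b); auto.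
    rewrite <- Cmod_mult, <- Er; auto. }
  set (X := qpoch_inf D q * (/ qpoch_inf (a * b) q * / qpoch_inf (c * b) q * / qpoch_inf (d * b) q)).
  assert (T : forall j, csum (fun k => w k * psi q a c d r j (b * q ^ k)) (S n)
     = X * (if (j <? n)%nat then 0 else
      b ^ n * bpoch b r q (j - n) * qpoch (D * e * q ^ j / q) q n
      * (qpoch q q j / (qpoch q q (j - n) * qpoch D q (j + n))))).
  { intros j; replace (bpoch b r q (j - n)) with (bpoch b (b * e) q (j - n)) by (now rewrite <- Er).
    rewrite <- (pcoef_bpoch_sum q Hq n j D b e He0 Hb0 Hen Cmod_D), <- csum_scal.
    apply csum_ext; intros k _; unfold w; rewrite psi_pcoef, <- Er; reflexivity. }
  rewrite csum_add, csum_zero, Cplus_0_l.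
  2:{ intros j Hj; rewrite T; apply Nat.ltb_lt in Hj; rewrite Hj; ring. }
  rewrite <- csum_scal; apply csum_ext; intros i _.
  rewrite T; replace (n + i <? n)%nat with false by (symmetry; apply Nat.ltb_ge; lia).
  replace (n + i - n)%nat with i by lia.
  replace (n + i + n)%nat with (2 * n + i)%nat by lia.
  replace (D * e * q ^ (n + i) / q) with (a * c * d * r * / q * q ^ (n + i)).
  2:{ unfold D, e; field; auto. }
  unfold aw_poly_term; rewrite <- vcoef_aw_poly_term by auto.
  unfold aw_poly_const, X, psi.
  assert (N1 := qfact_neq0 q Hq i).
  assert (N2 : qpoch D q (2 * n + i) <> 0) by (apply qpoch_neq0_small; auto; apply Cmod_D).
  generalize (/ qpoch_inf (a * b) q) (/ qpoch_inf (c * b) q) (/ qpoch_inf (d * b) q)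
    (/ qpoch_inf (a * t) q) (/ qpoch_inf (c * t) q) (/ qpoch_inf (d * t) q).
  intros; unfold Cdiv; field; auto. }
apply (Ccv_unique (fun m => qpoch_inf (mu r) q *
    csum (fun k => w k * (nr_const q a c d * csum (nr_term q a c d r (b * q ^ k) t) (n + m))) (S n))).
- apply Ccv_scal.
  apply (Ccv_csum (fun m k => w k * (nr_const q a c d * csum (nr_term q a c d r (b * q ^ k) t) (n + m)))).
  intros k _; do 2 apply Ccv_scal.
  apply (Ccv_subseq (csum (nr_term q a c d r (b * q ^ k) t)) _ (fun m => n + m)%nat); auto; intros; lia.
- eapply Ccv_ext; [intros m; symmetry; apply E|].
  apply Ccv_scal; destruct (aw_poly_term_bound (Cmod r)) as [B' [kappa [Hk HB']]].
  apply (Cseries_cv _ B' kappa); auto; intros k; apply HB'; lra.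
Qed.

Lemma panalytic_mu rho : panalytic rho (fun x => mu (snd x)).
Proof.
unfold mu; repeat apply panalytic_mult; auto using panalytic_const, panalytic_snd.
Qed.

Lemma panalytic_aw_poly_term rho i : panalytic rho (fun x => aw_poly_term (snd x) i).
Proof.
assert (V : forall u, panalytic rho (fun x => qpoch_inf (u * snd x * q ^ (n + i)) q)).
{ intros u; apply panalytic_qpoch_inf; auto.
  apply panalytic_mult; auto using panalytic_const.
  apply panalytic_mult; auto using panalytic_const, panalytic_snd. }
unfold aw_poly_term; apply panalytic_mult; [apply panalytic_mult; [apply panalytic_mult; [apply panalytic_mult;
  [apply panalytic_mult|]|]|]|].
- apply panalytic_minus; auto using panalytic_const.
  apply panalytic_mult; auto using panalytic_const, panalytic_mu.
- apply panalytic_qpoch, panalytic_mu.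
- apply panalytic_const.
- unfold vnum; apply panalytic_mult; [apply panalytic_const|].
  apply panalytic_mult; auto; apply panalytic_mult; auto.
- apply panalytic_mult; [|apply panalytic_const].
  apply panalytic_bpoch; auto using panalytic_const, panalytic_snd.
- apply panalytic_mult; [|apply panalytic_const].
  apply panalytic_bpoch; auto using panalytic_const, panalytic_snd.
Qed.

Lemma panalytic_aw_sum rho : panalytic rho (fun x => aw_sum q n b a c d (cis (fst x))).
Proof.
unfold aw_sum.
apply (panalytic_csum rho (fun k x => pcoef q n (b * a * c * d) k
   * (qpoch (b * cis (fst x)) q k * qpoch (b * / cis (fst x)) q k)
   / (qpoch (b * a) q k * qpoch (b * c) q k * qpoch (b * d) q k))).
intros k; apply panalytic_mult; [|apply panalytic_const].
apply panalytic_mult; [apply panalytic_const|].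
apply panalytic_mult; apply panalytic_qpoch; apply panalytic_mult;
  auto using panalytic_const, panalytic_cis, panalytic_inv_cis.
Qed.

(* The factor (mu r; q)_inf clears the poles in r of the series, so that both sides are
   entire in r. *)
Lemma aw_poly_integral r :
  is_CInt (fun th => qpoch_inf (mu r) q * (aw_sum q n b a c d (cis th) * nr_weight q a c d r b t (cis th)))
    0 (2 * PI) (aw_poly_const * Cseries (aw_poly_term r)).
Proof.
set (rho := (Cmod r + 1)%R).
assert (Hrho : (0 < rho)%R) by (unfold rho; generalize (Cmod_ge_0 r); lra).
(* Half the minimum, so that every point delta q^m meets both smallness conditions; these points
   accumulate at 0 and determine the analytic functions. *)
set (delta := (Rmin (Cmod q) (Cmod b * Cmod q ^ n) / 2)%R).
assert (Bp : (0 < Cmod b * Cmod q ^ n)%R).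
{ apply Rmult_lt_0_compat; [now apply Cmod_gt_0|apply pow_lt, Hq]. }
assert (Hdelta : (0 < delta)%R) by (unfold delta; apply Rmin_case; lra).
assert (D1 : (delta < Cmod q)%R).
{ generalize (Rmin_l (Cmod q) (Cmod b * Cmod q ^ n)); unfold delta in *; lra. }
assert (D2 : (delta < Cmod b * Cmod q ^ n)%R).
{ generalize (Rmin_r (Cmod q) (Cmod b * Cmod q ^ n)); unfold delta in *; lra. }
assert (Cd : Cmod (RtoC delta) = delta) by (rewrite Cmod_R, Rabs_pos_eq; lra).
assert (Zm : forall m, (Cmod (RtoC delta * q ^ m) <= delta)%R).
{ intros m; rewrite <- Cd at 2; now apply Cmod_mult_qpow_le. }
apply (circle_int_identity rho
  (fun x => qpoch_inf (mu (snd x)) q * (aw_sum q n b a c d (cis (fst x)) * nr_weight q a c d (snd x) b t (cis (fst x))))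
  (fun r => aw_poly_const * Cseries (aw_poly_term r)) (fun m => RtoC delta * q ^ m)); auto.
- apply panalytic_mult; [now apply panalytic_qpoch_inf, panalytic_mu|].
  apply panalytic_mult; [apply panalytic_aw_sum|].
  unfold nr_weight; apply panalytic_mult; [|apply panalytic_mult].
  + do 5 (apply panalytic_mult; [|now apply panalytic_ihh_fixed]).
    now apply panalytic_ibase.
  + apply panalytic_qpoch_inf; auto; apply panalytic_mult; auto using panalytic_snd, panalytic_cis.
  + apply panalytic_qpoch_inf; auto; apply panalytic_mult; auto using panalytic_snd, panalytic_inv_cis.
- apply panalytic_mult; [apply panalytic_const|].
  destruct (aw_poly_term_bound rho) as [B [kappa [Hk HB]]].
  apply (panalytic_series rho (fun k x => aw_poly_term (snd x) k) B kappa); auto.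
  intros k; apply panalytic_aw_poly_term.
- apply (Ccv_le _ _ delta (Cmod q)); [lra|intros m].
  replace (RtoC delta * q ^ m - 0) with (RtoC delta * q ^ m) by ring.
  rewrite Cmod_mult, Cmod_pow, Cd; lra.
- intros m; apply Cmult_neq_0; [apply RtoC_neq0; lra|apply Cpow_nz, q_neq0, Hq].
- intros m _; cbn [fst snd]; specialize (Zm m).
  apply aw_poly_integral_small; try lra.
  apply Cmult_neq_0; [apply RtoC_neq0; lra|apply Cpow_nz, q_neq0, Hq].
- unfold rho; lra.
Qed.

End PolynomialIntegral.

(** * Powers of q *)

(** [acos] loses the sign of the sine; the case distinction on the imaginary part in [carg] restores
    it. *)
Lemma Cmod_polar (z : C) : z <> 0 -> RtoC (Cmod z) * cis (carg z) = z.
Proof.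
intros Hz; assert (P : (0 < Cmod z)%R) by now apply Cmod_gt_0.
destruct z as [x y]; set (m := Cmod (x, y)) in *.
assert (E : (m * m = x * x + y * y)%R).
{ unfold m; assert (S := Cmod2_alt (x, y)); simpl in S; lra. }
assert (U : (-1 <= x / m <= 1)%R).
{ assert (m * m >= x * x)%R by nra.
  split; apply Rmult_le_reg_r with m; auto; unfold Rdiv; rewrite Rmult_assoc, Rinv_l; nra. }
assert (S2 : (sqrt (1 - Rsqr (x / m)) = Rabs y / m)%R).
{ replace (1 - Rsqr (x / m))%R with (Rsqr (y / m)).
  - rewrite sqrt_Rsqr_abs; unfold Rdiv; rewrite Rabs_mult, (Rabs_pos_eq (/ m)); auto.
    left; now apply Rinv_0_lt_compat.
  - unfold Rsqr; field_simplify; [|lra|lra].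
    apply Rmult_eq_reg_r with (m ^ 2)%R; [|apply pow_nonzero; lra].
    field_simplify; [nra|lra..]. }
unfold carg; simpl Re; simpl Im; fold m.
unfold cis; destruct (Rle_dec 0 y) as [Hy|Hy].
- rewrite cos_acos, sin_acos, S2, Rabs_pos_eq by auto.
  unfold Cmult; simpl; f_equal; field; lra.
- rewrite cos_neg, sin_neg, cos_acos, sin_acos, S2, Rabs_left by lra.
  unfold Cmult; simpl; f_equal; field; lra.
Qed.

Section Powers.
Variable q : C.
Hypothesis Hq : q <> 0.

Lemma Cmod_q_pos : (0 < Cmod q)%R.
Proof. now apply Cmod_gt_0. Qed.

Lemma cpow_plus s s' : cpow q (s + s') = cpow q s * cpow q s'.
Proof.
unfold cpow; rewrite Rpower_plus, Rmult_plus_distr_r, cis_plus, RtoC_mult; ring.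
Qed.

Lemma cpow_0 : cpow q 0 = 1.
Proof.
unfold cpow; rewrite Rpower_O, Rmult_0_l, cis_0 by apply Cmod_q_pos; ring.
Qed.

Lemma cpow_1 : cpow q 1 = q.
Proof.
unfold cpow; rewrite Rpower_1, Rmult_1_l by apply Cmod_q_pos; now apply Cmod_polar.
Qed.

Lemma cpow_INR n : cpow q (INR n) = q ^ n.
Proof.
induction n as [|n IH]; [apply cpow_0|].
rewrite S_INR, cpow_plus, IH, cpow_1; simpl; ring.
Qed.

Lemma Cmod_cpow s : Cmod (cpow q s) = Rpower (Cmod q) s.
Proof.
unfold cpow; rewrite Cmod_mult, Cmod_cis, Cmod_R, Rabs_pos_eq, Rmult_1_r; auto.
left; apply exp_pos.
Qed.

Lemma cpow_neq0 s : cpow q s <> 0.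
Proof. apply Cmod_gt_0; rewrite Cmod_cpow; apply exp_pos. Qed.

Lemma cpow_opp s : cpow q (- s) = / cpow q s.
Proof.
apply (Cmult_eq_reg_l (cpow q s)); [apply cpow_neq0|].
rewrite <- cpow_plus, Cinv_r by apply cpow_neq0.
rewrite Rplus_opp_r; apply cpow_0.
Qed.

Lemma Cmod_cpow_lt1 s : (Cmod q < 1)%R -> (0 < s)%R -> (Cmod (cpow q s) < 1)%R.
Proof.
intros H1 Hs; rewrite Cmod_cpow; unfold Rpower; rewrite <- exp_0; apply exp_increasing.
assert (L : (ln (Cmod q) < 0)%R) by (rewrite <- ln_1; apply ln_increasing; [apply Cmod_q_pos|auto]).
nra.
Qed.

End Powers.

Lemma csqrt_sq z : csqrt z * csqrt z = z.
Proof.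
destruct (classic (z = 0)) as [->|Hz].
- unfold csqrt; rewrite Cmod_0, sqrt_0; ring.
- transitivity (RtoC (sqrt (Cmod z)) * RtoC (sqrt (Cmod z)) * (cis (carg z / 2) * cis (carg z / 2))).
  { unfold csqrt; ring. }
  rewrite <- cis_plus, <- RtoC_mult, sqrt_sqrt by apply Cmod_ge_0.
  replace (carg z / 2 + carg z / 2)%R with (carg z) by field; now apply Cmod_polar.
Qed.

(** * The substitution x = cos theta *)

Lemma pspan_continuous rho p z : span (R * C) (fun x => cdisc rho (snd x)) is_pmono p -> cdisc rho z ->
  forall th : R, Ccontinuous (fun th => p (th, z)) th.
Proof.
intros H Hz; induction H as [f [c [k [Hc [_ E]]]]|f g _ H1 _ H2|f g _ H E]; intros th.
- apply continuous_ext with (fun t => c t * z ^ k); [intros t; now rewrite E|].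
  apply continuous_Cmult; auto; apply (continuous_const (V := C_R_NormedModule)).
- apply (continuous_plus (V := C_R_NormedModule) (fun th => f (th, z)) (fun th => g (th, z))); auto.
- apply continuous_ext with (fun t => f (t, z)); auto.
Qed.

Lemma continuous_C_eps (f : R -> C) x :
  (forall eps, (0 < eps)%R -> exists delta, (0 < delta)%R /\
     forall y, (Rabs (y - x) < delta)%R -> (Cmod (f y - f x) < eps)%R) ->
  Ccontinuous f x.
Proof.
intros H P [eps HP]; destruct (H eps (cond_pos eps)) as [delta [Hd H']].
exists (mkposreal _ Hd); intros y Hy; apply HP.
specialize (H' y Hy); split.
- exact (Rle_lt_trans _ _ _ (re_le_Cmod (f y - f x)) H').
- exact (Rle_lt_trans _ _ _ (im_le_Cmod (f y - f x)) H').
Qed.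

Lemma continuous_C_eps_inv (f : R -> C) x :
  Ccontinuous f x ->
  forall eps, (0 < eps)%R -> exists delta, (0 < delta)%R /\
     forall y, (Rabs (y - x) < delta)%R -> (Cmod (f y - f x) < eps)%R.
Proof.
intros H eps He; assert (He2 : (0 < eps / 2)%R) by lra.
assert (L := H (ball (M := C_R_NormedModule) (f x) (mkposreal _ He2)) (locally_ball _ _)).
destruct L as [delta Hd]; exists delta; split; [apply cond_pos|].
intros y Hy; destruct (Hd y Hy) as [B1 B2].
change (Rabs (Re (f y - f x)) < eps / 2)%R in B1.
change (Rabs (Im (f y - f x)) < eps / 2)%R in B2.
set (w := f y - f x) in *.
replace w with (RtoC (Re w) + Ci * RtoC (Im w)) by (destruct w; unfold Cplus, Cmult; simpl; f_equal; ring).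
apply Rle_lt_trans with (1 := Cmod_triangle _ _).
rewrite Cmod_mult, !Cmod_R, Cmod_Ci; lra.
Qed.

Lemma panalytic_continuous rho f z : panalytic rho f -> cdisc rho z ->
  forall th : R, Ccontinuous (fun th => f (th, z)) th.
Proof.
intros Hf Hz th; apply continuous_C_eps; intros eps He.
destruct (Hf (eps / 4)%R ltac:(lra)) as [p [Hp Ep]].
destruct (continuous_C_eps_inv _ _ (pspan_continuous rho p z Hp Hz th) (eps / 4)%R ltac:(lra))
  as [delta [Hd H]]; exists delta; split; auto; intros y Hy; specialize (H y Hy).
set (u := f (y, z)); set (v := p (y, z)); set (w := p (th, z)); set (r := f (th, z)).
assert (E1 : (Cmod (u - v) <= eps / 4)%R) by exact (Ep (y, z) Hz).
assert (E2 : (Cmod (r - w) <= eps / 4)%R) by exact (Ep (th, z) Hz).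
assert (E3 : (Cmod (v - w) < eps / 4)%R) by exact H.
change (Cmod (u - r) < eps)%R.
rewrite (Cmod_minus_comm r) in E2.
generalize (Cmod_minus_le u v r) (Cmod_minus_le v w r); lra.
Qed.

(** Where x^2 = 1, the square root vanishes and the bounded G cannot spoil continuity, also from
    outside the interval since [sqrt] is 0 on negative arguments. Elsewhere [acos] is
    differentiable. *)
Lemma cos_subst_continuous (G : R -> C) B :
  (forall th : R, Ccontinuous G th) ->
  (forall th, (Cmod (G th) <= B)%R) ->
  forall x, (-1 <= x <= 1)%R -> Ccontinuous
     (fun x => RtoC (4 * sqrt (1 - x * x)) * G (acos x)) x.
Proof.
intros HG HB x Hx.
assert (HB0 : (0 <= B)%R) by (apply Rle_trans with (2 := HB 0%R), Cmod_ge_0).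
assert (CS : continuous (fun x => (4 * sqrt (1 - x * x))%R) x).
{ apply (continuous_scal_r (V := R_NormedModule) 4%R (fun x => sqrt (1 - x * x))).
  apply continuous_comp; [|apply continuous_sqrt].
  apply (ex_derive_continuous (V := R_NormedModule)); auto_derive; auto. }
destruct (Req_dec (x * x) 1) as [E|E].
- apply continuous_C_eps; intros eps He.
  assert (He2 : (0 < eps / (B + 1))%R) by (apply Rdiv_lt_0_compat; lra).
  destruct (CS (ball (4 * sqrt (1 - x * x))%R (mkposreal _ He2)) (locally_ball _ _)) as [delta Hd].
  exists delta; split; [apply cond_pos|]; intros y Hy; specialize (Hd y Hy).
  replace (1 - x * x)%R with 0%R in * by lra; rewrite sqrt_0, Rmult_0_r in *.
  replace (_ - _) with (RtoC (4 * sqrt (1 - y * y)) * G (acos y)) by ring.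
  change (Rabs (4 * sqrt (1 - y * y) - 0) < eps / (B + 1))%R in Hd.
  rewrite Rminus_0_r in Hd.
  rewrite Cmod_mult, Cmod_R.
  apply Rle_lt_trans with (Rabs (4 * sqrt (1 - y * y)) * B)%R.
  { apply Rmult_le_compat_l; [apply Rabs_pos|auto]. }
  apply Rle_lt_trans with (eps / (B + 1) * B)%R.
  { apply Rmult_le_compat_r; lra. }
  apply Rlt_le_trans with (eps / (B + 1) * (B + 1))%R; [apply Rmult_lt_compat_l; lra|].
  right; field; lra.
- apply continuous_Cmult.
  + apply continuous_C_pair; auto.
    apply continuous_const.
  + apply (continuous_comp (V := R_UniformSpace) (W := C_R_NormedModule) acos G); [|apply HG].
    apply continuity_pt_filterlim, derivable_continuous_pt, derivable_pt_acos; nra.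
Qed.

(** One factor sin theta is absorbed by dx = - sin theta d theta, the other becomes sqrt(1-x^2); the
    sign reverses the orientation from 1, -1 to -1, 1. *)
Lemma is_CInt_cos_subst (G : R -> C) B L :
  (forall th : R, Ccontinuous G th) ->
  (forall th, (Cmod (G th) <= B)%R) ->
  is_CInt (fun th => RtoC (4 * (sin th * sin th)) * G th) 0 PI L ->
  is_CInt (fun x => RtoC (4 * sqrt (1 - x * x)) * G (acos x)) (-1) 1 L.
Proof.
intros HG HB HL.
set (f := fun x => RtoC (4 * sqrt (1 - x * x)) * G (acos x)).
assert (HPI := PI_RGT_0).
assert (Cf := cos_subst_continuous G B HG HB); fold f in Cf.
assert (Ex : ex_RInt (V := C_R_CompleteNormedModule) f (-1) 1).
{ apply (ex_RInt_continuous (V := C_R_CompleteNormedModule)); intros x.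
  rewrite Rmin_left, Rmax_right by lra; apply Cf. }
assert (Sub := is_RInt_comp (V := C_R_CompleteNormedModule) f cos (fun y => (- sin y)%R) 0 PI).
rewrite Rmin_left, Rmax_right in Sub by lra.
specialize (Sub ltac:(intros y _; apply Cf, COS_bound)).
assert (Sub' := Sub ltac:(intros y _; split;
  [auto_derive; auto; ring|apply (ex_derive_continuous (V := R_NormedModule)); auto_derive; auto])).
clear Sub; rewrite cos_0, cos_PI in Sub'.
rewrite <- (opp_RInt_swap (V := C_R_CompleteNormedModule) f (-1) 1 Ex) in Sub'.
assert (E : is_CInt (fun th => RtoC (4 * (sin th * sin th)) * G th) 0 PI (RInt (V := C_R_CompleteNormedModule) f (-1) 1)).
{ assert (O := is_RInt_opp (V := C_R_NormedModule) _ _ _ _ Sub'); rewrite opp_opp in O.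
  apply (is_RInt_ext (V := C_R_NormedModule)) with (2 := O).
  rewrite Rmin_left, Rmax_right by lra; intros y Hy; unfold f.
  rewrite acos_cos by lra.
  assert (Sy : sqrt (1 - cos y * cos y) = sin y).
  { replace (1 - cos y * cos y)%R with (Rsqr (sin y)).
    - apply sqrt_Rsqr, sin_ge_0; lra.
    - generalize (sin2_cos2 y); unfold Rsqr; lra. }
  rewrite Sy; destruct (G y) as [g1 g2].
  unfold opp, scal; simpl; unfold prod_opp, prod_scal, opp, scal; simpl.
  unfold Cmult, mult; simpl; f_equal; ring. }
rewrite (is_CInt_unique _ _ _ _ _ HL E).
apply (RInt_correct (V := C_R_CompleteNormedModule)), Ex.
Qed.

(** The substitution theta -> 2 pi - theta gives both half circles the same integral. *)
Lemma is_CInt_half (g : R -> C) I : (forall th, g (2 * PI - th)%R = g th) ->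
  is_CInt g 0 (2 * PI) I -> is_CInt g 0 PI (I / 2).
Proof.
intros Hg HI; assert (HPI := PI_RGT_0).
assert (Ex : ex_RInt (V := C_R_CompleteNormedModule) g 0 PI).
{ apply (ex_RInt_Chasles_1 (V := C_R_CompleteNormedModule) g 0 PI (2 * PI)); [lra|now exists I]. }
destruct Ex as [L HL].
assert (H2 : is_CInt g PI (2 * PI) L).
{ assert (S1 := is_RInt_swap (V := C_R_NormedModule) _ _ _ _ HL).
  assert (S2 := is_RInt_comp_lin (V := C_R_NormedModule) g (-1) (2 * PI) PI (2 * PI) (opp L)).
  replace (-1 * PI + 2 * PI)%R with PI in S2 by ring.
  replace (-1 * (2 * PI) + 2 * PI)%R with 0%R in S2 by ring.
  assert (S3 := is_RInt_opp (V := C_R_NormedModule) _ _ _ _ (S2 S1)); rewrite opp_opp in S3.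
  apply (is_RInt_ext (V := C_R_NormedModule)) with (2 := S3); intros y _.
  replace (-1 * y + 2 * PI)%R with (2 * PI - y)%R by ring; rewrite Hg.
  destruct (g y) as [g1 g2].
  unfold opp, scal; simpl; unfold prod_opp, prod_scal, opp, scal; simpl.
  unfold mult; simpl; f_equal; ring. }
assert (E := is_RInt_Chasles (V := C_R_NormedModule) _ _ _ _ _ _ HL H2).
rewrite (is_CInt_unique _ _ _ _ _ HI E).
assert (F : forall x : C, (x + x) / 2 = x) by (intros; field; apply RtoC_neq0; lra).
change (plus L L) with (Cplus L L); now rewrite F.
Qed.

(** * Continuous q-Jacobi polynomials *)

Lemma csum_Re f n : sum_n (fun k => Re (f k)) n = Re (csum f (S n)).
Proof.
induction n as [|n IH]; [rewrite sum_O; cbn [csum]; now rewrite Cplus_0_l|].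
rewrite sum_Sn, IH; reflexivity.
Qed.

Lemma csum_Im f n : sum_n (fun k => Im (f k)) n = Im (csum f (S n)).
Proof.
induction n as [|n IH]; [rewrite sum_O; cbn [csum]; now rewrite Cplus_0_l|].
rewrite sum_Sn, IH; reflexivity.
Qed.

Lemma Series_Ccv f l : Ccv (csum f) l ->
  (Series (fun k => Re (f k)), Series (fun k => Im (f k))) = l.
Proof.
intros H.
assert (H' : Ccv (fun n => csum f (S n)) l) by (apply (Ccv_subseq (csum f)); auto).
unfold Series.
rewrite (Lim_seq_ext _ (fun n => Re (csum f (S n)))) by apply csum_Re.
rewrite (Lim_seq_ext (sum_n (fun k => Im (f k))) (fun n => Im (csum f (S n)))) by apply csum_Im.
exact (Ccv_Clim _ _ H').
Qed.

Lemma Series_finite (f : nat -> C) n : (forall k, (n < k)%nat -> f k = 0) ->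
  (Series (fun k => Re (f k)), Series (fun k => Im (f k))) = csum f (S n).
Proof.
intros H; apply Series_Ccv; intros eps He; exists (S n); intros m Hm.
replace m with (S n + (m - S n))%nat by lia.
rewrite csum_add, (csum_zero (fun k => f (S n + k)%nat)) by (intros; apply H; lia).
replace (_ - _) with (RtoC 0) by ring; now rewrite Cmod_0.
Qed.

(** The pair qs, -qs over s, -s yields (1 - s^2 q^(2i))/(1 - s^2), in which only the square of s is
    left. *)
Lemma qpoch_very_well_poised s q i :
  qpoch (q * s) q i * qpoch (- (q * s)) q i * (1 - s * s)
  = qpoch s q i * qpoch (- s) q i * (1 - s * s * q ^ (2 * i)).
Proof.
assert (E : forall x, qpoch (q * x) q i * (1 - x) = qpoch x q i * (1 - x * q ^ i)).
{ intros x; rewrite (Cmult_comm q x), Cmult_comm, <- qpoch_Sl; reflexivity. }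
replace (- (q * s)) with (q * - s) by ring.
replace (q ^ (2 * i)) with (q ^ i * q ^ i) by (rewrite <- Cpow_add_r; f_equal; lia).
transitivity ((qpoch (q * s) q i * (1 - s)) * (qpoch (q * - s) q i * (1 - - s))); [ring|].
rewrite !E; ring.
Qed.

(** The formula (q^-n; q)_k = (-1)^k q^(k(k-1)/2 - nk) (q; q)_n/(q; q)_(n-k), cleared of
    denominators. *)
Lemma qpoch_inv_pow (q : C) n k : q <> 0 -> (k <= n)%nat ->
  qpoch (/ q ^ n) q k * qpoch q q (n - k) * q ^ (n * k) = (- (1)) ^ k * qtri q k * qpoch q q n.
Proof.
intros Hq Hk; induction k as [|k IH].
- rewrite Nat.mul_0_r, Nat.sub_0_r; simpl; ring.
- specialize (IH ltac:(lia)).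
  replace (n - k)%nat with (S (n - S k)) in IH by lia.
  cbn [qpoch] in IH |- *; cbn [qtri].
  rewrite Nat.mul_succ_r, Cpow_add_r.
  assert (Nn : q ^ n <> 0) by now apply Cpow_nz.
  assert (E : q ^ n = q * q ^ (n - S k) * q ^ k).
  { rewrite <- Cpow_S, <- Cpow_add_r; f_equal; lia. }
  transitivity (- (qpoch (/ q ^ n) q k * (qpoch q q (n - S k) * (1 - q * q ^ (n - S k))) * q ^ (n * k)) * q ^ k);
    [|rewrite IH; simpl; ring].
  replace ((1 - / q ^ n * q ^ k)) with ((q ^ n - q ^ k) / q ^ n) by (field; auto).
  replace (q ^ n - q ^ k) with (- ((1 - q * q ^ (n - S k)) * q ^ k)) by (rewrite E; ring).
  field; auto.
Qed.

(** * The theorem in Askey-Wilson parameters, with u = alpha^(1/2) and g = gamma^(1/2) *)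

Section Jacobi.
Variables (q h u g t beta : C) (n : nat).
Hypothesis Hq : (0 < Cmod q < 1)%R.
Hypothesis Hh : q = h * h.
Hypothesis Hu : (Cmod u < 1)%R.
Hypothesis Hg : (Cmod g < 1)%R.
Hypothesis Ht : (Cmod t < 1)%R.
Hypothesis Hu0 : u <> 0.
Hypothesis Hg0 : g <> 0.

Let Hq1 : (Cmod q < 1)%R := proj2 Hq.
Let Hq0 : q <> 0 := q_neq0 q Hq.
Let b := h * u.
Let c := - g.
Let d := - (h * g).
Let r := t * beta.
Let D := b * u * c * d.
Let m := mu q u c d n r.

Lemma h_lt1 : (0 < Cmod h < 1)%R.
Proof. exact (Cmod_h q Hq h Hh). Qed.

Lemma h_neq0 : h <> 0.
Proof. apply Cmod_gt_0, h_lt1. Qed.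

Lemma b_lt1 : (Cmod b < 1)%R.
Proof. apply Cmod_mult_lt1; auto; apply h_lt1. Qed.

Lemma c_lt1 : (Cmod c < 1)%R.
Proof. unfold c; now rewrite Cmod_opp. Qed.

Lemma d_lt1 : (Cmod d < 1)%R.
Proof. unfold d; rewrite Cmod_opp; apply Cmod_mult_lt1; auto; apply h_lt1. Qed.

Lemma b_neq0 : b <> 0.
Proof. apply Cmult_neq_0; auto using h_neq0. Qed.

Lemma d_neq0 : d <> 0.
Proof.
unfold d; replace (- (h * g)) with (- (1) * (h * g)) by ring.
repeat apply Cmult_neq_0; auto using h_neq0; intros E; injection E; lra.
Qed.

(** [s] stands for any square root of [m]: as s and -s occur together, the terms depend only on
    s^2. *)
Definition phi_upper (s : C) : list C :=
  [ m; q * s; - (q * s); u * c * q ^ n; u * d * q ^ n; c * d * q ^ n; r / b; q ^ n * beta ].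

Definition phi_lower (s : C) : list C :=
  [ s; - s; u * r * q ^ n; c * r * q ^ n; d * r * q ^ n; D * q ^ (2 * n); u * c * d * t * q ^ n ].

(** The term of index 0 of [aw_poly_term], by which the series is normalized to start with 1. *)
Definition phi_const : C :=
  (1 - m) * (qpoch (u * c) q n * qpoch (u * d) q n * qpoch (c * d) q n)
  * (qpoch_inf (u * r * q ^ n) q * qpoch_inf (c * r * q ^ n) q * qpoch_inf (d * r * q ^ n) q)
  * (t ^ n * qpoch beta q n * qpoch_inf (u * c * d * t * q ^ n) q) / qpoch D q (2 * n).

Lemma aw_poly_term_phi s i : s * s = m -> nonvanishing (phi_lower s) q ->
  aw_poly_term q u b c d t n r i = phi_const * qhyp_term (phi_upper s) (phi_lower s) q (b * t) i.
Proof.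
intros Hs Hn.
assert (NV : forall x, In x (phi_lower s) -> qpoch x q i <> 0).
{ intros x Hx; apply qpoch_neq0; intros k _; now apply Hn. }
assert (Nm : 1 - m <> 0).
{ rewrite <- Hs; replace (1 - s * s) with ((1 - s) * (1 - - s)) by ring.
  apply Cmult_neq_0; apply Cminus_neq0, not_eq_sym.
  - intros E; apply (Hn s (or_introl eq_refl) O); rewrite E; simpl; ring.
  - intros E; apply (Hn (- s) (or_intror (or_introl eq_refl)) O); rewrite E; simpl; ring. }
assert (V := qpoch_very_well_poised s q i); rewrite Hs in V.
assert (N1 := NV s ltac:(simpl; tauto)); assert (N2 := NV (- s) ltac:(simpl; tauto)).
assert (N3 := NV (u * r * q ^ n) ltac:(simpl; tauto)).
assert (N4 := NV (c * r * q ^ n) ltac:(simpl; tauto)).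
assert (N5 := NV (d * r * q ^ n) ltac:(simpl; tauto)).
assert (N6 := NV (D * q ^ (2 * n)) ltac:(simpl; tauto)).
assert (N7 := NV (u * c * d * t * q ^ n) ltac:(simpl; tauto)).
assert (N8 := qfact_neq0 q Hq i).
assert (ND : qpoch D q (2 * n) <> 0).
{ apply qpoch_neq0_small; auto; exact (Cmod_D u b c d Hu b_lt1 c_lt1 d_lt1). }
assert (Sinf : forall x, qpoch x q i <> 0 -> qpoch_inf (x * q ^ i) q = qpoch_inf x q / qpoch x q i).
{ intros x Nx; rewrite (qpoch_inf_split q Hq1 x i); field; auto. }
unfold aw_poly_term, vnum, qhyp_term, phi_const, phi_upper, phi_lower, qpochs; cbn [fold_right length].
fold m; fold D.
replace (1 + 7 - 8)%nat with O by reflexivity.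
assert (Ex : forall x, x * q ^ (n + i) = x * q ^ n * q ^ i) by (intros; rewrite Cpow_add_r; ring).
rewrite !Ex, !Sinf by auto.
rewrite !(qpoch_add _ q n i), (qpoch_add D q (2 * n) i).
assert (Nb := b_neq0).
assert (Bt : bpoch t r q (n + i) = t ^ n * t ^ i * (qpoch beta q n * qpoch (beta * q ^ n) q i)).
{ unfold r; rewrite bpoch_qpoch, Cpow_add_r, qpoch_add; reflexivity. }
assert (Bb : bpoch b r q i = b ^ i * qpoch (r / b) q i).
{ replace r with (b * (r / b)) at 1 by (field; auto); apply bpoch_qpoch. }
rewrite Bt, Bb, (Cmult_comm (q ^ n) beta), (Cpow_mult_l b t).
replace (qpoch (q * s) q i * (qpoch (- (q * s)) q i * _)) with
  (qpoch (q * s) q i * qpoch (- (q * s)) q i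
    * (qpoch (u * c * q ^ n) q i * (qpoch (u * d * q ^ n) q i * (qpoch (c * d * q ^ n) q i
       * (qpoch (r / b) q i * (qpoch (beta * q ^ n) q i * 1)))))) by ring.
replace (qpoch (q * s) q i * qpoch (- (q * s)) q i)
  with (qpoch s q i * qpoch (- s) q i * (1 - m * q ^ (2 * i)) / (1 - m))
  by (rewrite <- V; field; auto).
cbn [Cpow].
field; repeat split; auto.
Qed.

Lemma Cseries_aw_poly_term s : s * s = m -> nonvanishing (phi_lower s) q ->
  Cseries (aw_poly_term q u b c d t n r) = phi_const * qhyp (phi_upper s) (phi_lower s) q (b * t).
Proof.
intros Hs Hn.
destruct (aw_poly_term_bound q u b c d t n Hq Hu b_lt1 c_lt1 d_lt1 Ht (Cmod r)) as [B [kappa [Hk HB]]].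
assert (CV : Ccv (csum (aw_poly_term q u b c d t n r)) (Cseries (aw_poly_term q u b c d t n r))).
{ apply (Cseries_cv _ B kappa); auto; intros i; apply HB; lra. }
(* If the first term is 0, all terms are, and both sides vanish; otherwise the convergence of the
   8-phi-7 follows by dividing by it. *)
destruct (classic (phi_const = 0)) as [Z|Z].
- rewrite Z, Cmult_0_l; apply (Ccv_unique _ _ _ CV).
  apply Ccv_ext with (fun _ => RtoC 0); [|apply Ccv_const].
  intros k; symmetry; apply csum_zero; intros i _; rewrite (aw_poly_term_phi s) by auto; rewrite Z; ring.
- unfold qhyp; rewrite (Series_Ccv _ (/ phi_const * Cseries (aw_poly_term q u b c d t n r))).
  + field; auto.
  + apply Ccv_ext with (fun k => / phi_const * csum (aw_poly_term q u b c d t n r) k).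
    * intros k; rewrite <- csum_scal; apply csum_ext; intros i _; rewrite (aw_poly_term_phi s) by auto; field; auto.
    * now apply Ccv_scal.
Qed.

(** g_n in terms of pair products: ub = q^(1/2) alpha, cd = q^(1/2) gamma, uc = -(alpha
    gamma)^(1/2), ud = -(q alpha gamma)^(1/2), bd = -q (alpha gamma)^(1/2). *)
Definition jacobi_norm : C :=
  (u * u) ^ n * (1 - u * u * (g * g))
  * (qpoch (u * b) q n * qpoch (c * d) q n * qpoch (b * d) q n)
  * (qpoch_inf (h * (u * g)) q * qpoch_inf (q * (u * g)) q)
  / ((1 - q ^ (2 * n) * (u * u * (g * g)))
     * (qpoch q q n * qpoch (u * u * (g * g)) q n * qpoch (u * c) q n)
     * (qpoch_inf q q * qpoch_inf (u * b) q * qpoch_inf (c * d) q * qpoch_inf (u * c) q * qpoch_inf (u * d) q)).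

Definition jacobi_coef (F : C) : C :=
  (t * / u) ^ n * (qpoch beta q n * qpoch (u * c) q n * qpoch (u * d) q n)
  / qpoch (q ^ n * (u * u * (g * g))) q n
  * (qpoch_inf (u * r * q ^ n) q * qpoch_inf (c * r * q ^ n) q * qpoch_inf (d * r * q ^ n) q
     * qpoch_inf (u * c * d * t * q ^ n) q
     / (qpoch_inf (u * t) q * qpoch_inf (c * t) q * qpoch_inf (d * t) q * qpoch_inf (m * q) q)) * F.

(** With x = u g the right side is (D; q)_inf. Two of the four factors are (bc, bd; q)_inf and
    cancel; the other two are the infinite products in the numerator of g_n. *)
Lemma qpoch_inf_quadruple x : (Cmod x < 1)%R ->
  qpoch_inf (h * x) q * qpoch_inf (q * x) q * (qpoch_inf (- (h * x)) q * qpoch_inf (- (q * x)) q)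
  = qpoch_inf (q * (x * x)) q.
Proof.
intros Hx.
assert (Hqq : (Cmod (q * q) < 1)%R) by now apply Cmod_sq_lt1.
transitivity ((qpoch_inf (h * x) q * qpoch_inf (- (h * x)) q) * (qpoch_inf (q * x) q * qpoch_inf (- (q * x)) q));
  [ring|].
rewrite !qpoch_inf_sq by auto.
replace (h * x * (h * x)) with (q * (x * x)) by (rewrite Hh; ring).
replace (q * x * (q * x)) with (q * (x * x) * q) by ring.
now apply qpoch_inf_dup.
Qed.

(** Return to base u: Sears' factor and the clearing factor (m; q)_inf are divided out. *)
Lemma aw_sum_nr_int : qpoch_inf m q <> 0 ->
  is_CInt (fun th => qpoch (u * b) q n / qpoch q q n
     * (aw_sum q n u b c d (cis th) * nr_weight q u c d r b t (cis th))) 0 (2 * PI)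
   (qpoch (u * b) q n / qpoch q q n
     / ((b / u) ^ n * (qpoch (u * c) q n * qpoch (u * d) q n)
         / (qpoch (b * c) q n * qpoch (b * d) q n) * qpoch_inf m q)
    * (aw_poly_const q u b c d t n * Cseries (aw_poly_term q u b c d t n r))).
Proof.
intros Nm.
assert (NP := qpoch_mult_neq0 q Hq1).
assert (Hc := c_lt1); assert (Hd := d_lt1); assert (Hb := b_lt1).
assert (R := aw_poly_integral h q u b c d t n Hq Hh Hu Hb Hc Hd Ht b_neq0 r); fold m in R.
assert (S0 := fun K => is_CInt_scal K _ _ _ _ R).
apply is_CInt_ext with (2 := S0 _); intros th; cbv beta.
rewrite (aw_sum_sears q Hq n u b c d (cis th)) by auto using b_neq0, d_neq0, cis_neq0.
assert (Nb : (b / u) ^ n <> 0).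
{ apply Cpow_nz; replace (b / u) with h by (unfold b; field; auto); apply h_neq0. }
assert (N1 := qfact_neq0 q Hq n).
field; repeat split; auto.
Qed.

(** The division by 2 is that of the half circle; it turns the 4 pi of the Askey-Wilson integral
    into 2 pi. *)
Lemma jacobi_value F : 1 - m <> 0 -> qpoch_inf (m * q) q <> 0 ->
  qpoch (u * b) q n / qpoch q q n
     / ((b / u) ^ n * (qpoch (u * c) q n * qpoch (u * d) q n)
         / (qpoch (b * c) q n * qpoch (b * d) q n) * qpoch_inf m q)
    * (aw_poly_const q u b c d t n * (phi_const * F)) / 2
  = 2 * RtoC PI * jacobi_norm * jacobi_coef F.
Proof.
intros Nm Nmq.
assert (Hc := c_lt1); assert (Hd := d_lt1); assert (Hb := b_lt1); assert (Hh0 := h_neq0).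
assert (NP := qpoch_mult_neq0 q Hq1).
assert (NI := qpoch_inf_mult_neq0 q Hq1).
set (E := u * u * (g * g)).
assert (HE : (Cmod E < 1)%R) by (unfold E; repeat apply Cmod_mult_lt1; auto).
assert (ED : D = E * q) by (unfold D, E, b, c, d; rewrite Hh; ring).
assert (Ead : u * d = b * c) by (unfold b, c, d; ring).
assert (Hug : (Cmod (u * g) < 1)%R) by now apply Cmod_mult_lt1.
assert (Q4 := qpoch_inf_quadruple (u * g) Hug).
replace (- (h * (u * g))) with (b * c) in Q4 by (unfold b, c; ring).
replace (- (q * (u * g))) with (b * d) in Q4 by (unfold b, d; rewrite Hh; ring).
replace (q * (u * g * (u * g))) with D in Q4 by (unfold D, b, c, d; rewrite Hh; ring).
(* As D = Eq, both sides are (E; q)_(2n+1): on the left with its first factor split off, on the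
   right as n + n + 1 factors. *)
assert (D2 : qpoch D q (2 * n) * (1 - E) = qpoch E q n * qpoch (q ^ n * E) q n * (1 - q ^ (2 * n) * E)).
{ rewrite ED, Cmult_comm, <- qpoch_Sl.
  replace (qpoch E q (S (2 * n))) with (qpoch E q (2 * n) * (1 - E * q ^ (2 * n))) by reflexivity.
  replace (2 * n)%nat with (n + n)%nat by lia; rewrite qpoch_add, (Cmult_comm (q ^ n) E); ring. }
assert (NE1 : 1 - E <> 0) by now apply one_minus_neq0.
assert (NE2 : 1 - q ^ (2 * n) * E <> 0).
{ rewrite Cmult_comm; now apply one_minus_neq0, Cmod_mult_qpow_lt1. }
assert (NE3 : qpoch E q n <> 0) by now apply qpoch_neq0_small.
assert (NE4 : qpoch (q ^ n * E) q n <> 0).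
{ rewrite Cmult_comm; now apply qpoch_neq0_small, Cmod_mult_qpow_lt1. }
unfold aw_poly_const, nr_const, phi_const, jacobi_norm, jacobi_coef; fold D; fold E.
replace (qpoch D q (2 * n)) with (qpoch E q n * qpoch (q ^ n * E) q n * (1 - q ^ (2 * n) * E) / (1 - E))
  by (rewrite <- D2; field; auto).
rewrite <- Q4, (qpoch_inf_S q Hq1 m).
rewrite (Cmult_comm c b), (Cmult_comm d b), Ead.
replace (b / u) with h by (unfold b; field; auto).
replace (b ^ n) with (h ^ n * u ^ n) by (symmetry; apply Cpow_mult_l).
rewrite !(Cpow_mult_l _ _ n), (Cpow_inv u) by auto.
rewrite RtoC_mult.
assert (N2 := NI b c Hb Hc); assert (N3 := NI b d Hb Hd).
assert (N0 := qpoch_inf_neq0_small q Hq1 q Hq1).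
assert (Nh : h ^ n <> 0) by now apply Cpow_nz.
assert (Nu : u ^ n <> 0) by now apply Cpow_nz.
assert (N1 := qfact_neq0 q Hq n).
field; repeat split; auto; apply RtoC_neq0; lra.
Qed.

End Jacobi.

(** * Weight, polynomial and kernel in Askey-Wilson parameters *)

Section Translation.
Variables (q : C) (alpha gamma : R).
Hypothesis Hq : (0 < Cmod q < 1)%R.
Hypothesis Halpha : (- (1 / 2) < alpha)%R.
Hypothesis Hgamma : (- (1 / 2) < gamma)%R.

Let Hq1 : (Cmod q < 1)%R := proj2 Hq.
Let Hq0 : q <> 0 := q_neq0 q Hq.
Let h := cpow q (1 / 2).
Let u := rpow q alpha (1 / 2).
Let g := rpow q gamma (1 / 2).

Lemma cpow_half_sq : q = h * h.
Proof.
unfold h; rewrite <- cpow_plus; replace (1 / 2 + 1 / 2)%R with 1%R by field.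
symmetry; now apply cpow_1.
Qed.

Lemma rpow_plus a s s' : rpow q a (s + s') = rpow q a s * rpow q a s'.
Proof. unfold rpow; rewrite <- cpow_plus; f_equal; ring. Qed.

Lemma rpow_1 a : rpow q a 1 = rpow q a (1 / 2) * rpow q a (1 / 2).
Proof. rewrite <- rpow_plus; f_equal; field. Qed.

Lemma rpow_lt1 a : (- (1 / 2) < a)%R -> (Cmod (rpow q a (1 / 2)) < 1)%R.
Proof. intros Ha; apply Cmod_cpow_lt1; auto; lra. Qed.

Lemma rpow_neq0 a s : rpow q a s <> 0.
Proof. now apply cpow_neq0. Qed.

Lemma rpow_opp a s : rpow q a (- s) = / rpow q a s.
Proof. unfold rpow; rewrite <- cpow_opp by auto; f_equal; ring. Qed.

Lemma h_half_lt1 : (Cmod h < 1)%R.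
Proof. apply Cmod_cpow_lt1; auto; lra. Qed.

Lemma qpoch_inf_half x : qpoch_inf x h = qpoch_inf x q * qpoch_inf (x * h) q.
Proof. rewrite cpow_half_sq; symmetry; apply qpoch_inf_dup, h_half_lt1. Qed.

(** Each product of base q^(1/2) splits into two of base q; this is where the four parameters u, hu,
    -g, -hg come from. *)
Lemma weight_aw x :
  weight alpha gamma q x = aw_weight q u (h * u) (- g) (- (h * g)) (cis (acos x)).
Proof.
assert (Hu := rpow_lt1 alpha Halpha); assert (Hg := rpow_lt1 gamma Hgamma); assert (Hh := h_half_lt1).
fold u in Hu; fold g in Hg.
unfold weight, weight_amp, qpochs_inf; cbn [fold_right]; fold h; fold u; fold g.
rewrite !qpoch_inf_half.
set (th := acos x).
replace (2 * - th)%R with (- (2 * th))%R by ring; rewrite <- !cis_inv.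
replace (2 * th)%R with (th + th)%R by ring; rewrite cis_plus.
set (z := cis th); assert (Hz : z <> 0) by apply cis_neq0.
replace (/ (z * z)) with (/ z * / z) by (field; auto).
unfold aw_weight, ibase, ihh.
assert (N : forall v y, (Cmod v < 1)%R -> Cmod y = 1%R -> qpoch_inf (v * y) q <> 0).
{ intros v y Hv Hy; apply qpoch_inf_neq0_small; auto; rewrite Cmod_mult, Hy; lra. }
assert (Hz1 : Cmod z = 1%R) by apply Cmod_cis.
assert (Hz2 : Cmod (/ z) = 1%R) by (unfold z; rewrite cis_inv; apply Cmod_cis).
assert (Hhu : (Cmod (h * u) < 1)%R) by now apply Cmod_mult_lt1.
assert (Hg' : (Cmod (- g) < 1)%R) by now rewrite Cmod_opp.
assert (Hhg : (Cmod (- (h * g)) < 1)%R) by (rewrite Cmod_opp; now apply Cmod_mult_lt1).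
replace (u * z * h) with (h * u * z) by ring; replace (u * / z * h) with (h * u * / z) by ring.
replace (- (g * z) * h) with (- (h * g) * z) by ring; replace (- (g * / z) * h) with (- (h * g) * / z) by ring.
replace (- (g * z)) with (- g * z) by ring; replace (- (g * / z)) with (- g * / z) by ring.
field; repeat split; auto.
Qed.

(** The factor (q^-n; q)_k is 0 for k > n, so the formally infinite 4-phi-3 is a finite sum; for k
    <= n it becomes the coefficient in [pcoef]. *)
Lemma cqJacobi_aw_sum n x :
  cqJacobi n alpha gamma q x
  = qpoch (u * (h * u)) q n / qpoch q q n
    * aw_sum q n u (h * u) (- g) (- (h * g)) (cis (acos x)).
Proof.
unfold cqJacobi; rewrite !rpow_1; fold u; fold g; fold h.
rewrite <- cis_inv; set (z := cis (acos x)).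
replace (u * (h * u)) with (h * (u * u)) by ring; f_equal.
unfold qhyp; rewrite (Series_finite _ n).
- unfold aw_sum; apply csum_ext; intros k Hk.
  unfold qhyp_term, qpochs; cbn [fold_right length].
  replace (1 + 3 - 4)%nat with O by reflexivity.
  unfold pcoef, gbin; cbn [qtri].
  assert (P := qpoch_inv_pow q n k Hq0 ltac:(lia)).
  assert (N1 := qfact_neq0 q Hq).
  assert (N2 : q ^ (n * k) <> 0) by now apply Cpow_nz.
  replace (qpoch (/ q ^ n) q k)
    with ((- (1)) ^ k * qtri q k * qpoch q q n / (qpoch q q (n - k) * q ^ (n * k)))
    by (rewrite <- P; field; auto).
  replace (u * (h * u) * - g * - (h * g) * q ^ n / q) with (q ^ n * (u * u) * (g * g)).
  2:{ replace (u * (h * u) * - g * - (h * g)) with (h * h * ((u * u) * (g * g))) by ring.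
      rewrite <- cpow_half_sq; field; auto. }
  assert (Hu := rpow_lt1 alpha Halpha); assert (Hg := rpow_lt1 gamma Hgamma); assert (Hh := h_half_lt1).
  fold u in Hu; fold g in Hg.
  assert (N3 : qpoch (h * (u * u)) q k <> 0) by (apply qpoch_neq0_small, Cmod_mult_lt1, Cmod_mult_lt1; auto).
  assert (N4 : qpoch (- (u * g)) q k <> 0).
  { apply qpoch_neq0_small; auto; rewrite Cmod_opp; now apply Cmod_mult_lt1. }
  assert (N5 : qpoch (- (h * u * g)) q k <> 0).
  { apply qpoch_neq0_small; auto; rewrite Cmod_opp; apply Cmod_mult_lt1; auto; now apply Cmod_mult_lt1. }
  replace (u * (h * u)) with (h * (u * u)) by ring.
  replace (u * - g) with (- (u * g)) by ring.
  replace (u * - (h * g)) with (- (h * u * g)) by ring.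
  cbn [Cpow]; field; repeat split; auto.
- intros k Hk; unfold qhyp_term, qpochs; cbn [fold_right].
  replace (qpoch (/ q ^ n) q k) with (RtoC 0); [unfold Cdiv; ring|].
  replace k with (n + S (k - S n))%nat by lia; rewrite qpoch_add, qpoch_Sl, Cinv_l by now apply Cpow_nz.
  ring.
Qed.

Lemma gen_kernel_ihh beta t x : (Cmod t < 1)%R ->
  gen_kernel beta t q x
  = qpoch_inf (t * beta * cis (acos x)) q * qpoch_inf (t * beta * / cis (acos x)) q
    * ihh q t (cis (acos x)).
Proof.
intros Ht; unfold gen_kernel, qpochs_inf; cbn [fold_right]; rewrite <- cis_inv.
set (z := cis (acos x)).
assert (Hz1 : Cmod z = 1%R) by apply Cmod_cis.
assert (Hz2 : Cmod (/ z) = 1%R) by (unfold z; rewrite cis_inv; apply Cmod_cis).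
assert (N : forall y, Cmod y = 1%R -> qpoch_inf (t * y) q <> 0).
{ intros y Hy; apply qpoch_inf_neq0_small; auto; rewrite Cmod_mult, Hy; lra. }
unfold ihh; field; auto.
Qed.

End Translation.

Lemma sin_sq_cis th : RtoC (4 * (sin th * sin th))
  = (1 - cis th * cis th) * (1 - / cis th * / cis th).
Proof.
rewrite cis_inv; unfold cis; rewrite cos_neg, sin_neg.
assert (E := sin2_cos2 th); unfold Rsqr in E.
set (s := sin th) in *; set (c := cos th) in *.
unfold Cminus, Cmult, Cplus, Copp, RtoC; simpl; f_equal; [|ring].
assert (C2 : (c * c = 1 - s * s)%R) by lra.
transitivity ((1 - (c * c - s * s)) * (1 - (c * c - s * s)) + 4 * (s * s) * (c * c))%R; [|ring].
rewrite C2; ring.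
Qed.

(** * From the circle to the interval (-1, 1) *)

Section Final.
Variables (q h a b c d t r K : C) (n : nat).
Hypothesis Hq : (0 < Cmod q < 1)%R.
Hypothesis Ha : (Cmod a < 1)%R.
Hypothesis Hb : (Cmod b < 1)%R.
Hypothesis Hc : (Cmod c < 1)%R.
Hypothesis Hd : (Cmod d < 1)%R.
Hypothesis Ht : (Cmod t < 1)%R.

Let Hq1 : (Cmod q < 1)%R := proj2 Hq.

Definition integrand (z : C) : C := K * (aw_sum q n a b c d z * nr_weight q a c d r b t z).

(* [integrand] without the factor (1 - z^2)(1 - z^-2) of the weight, which absorbs the
   singularity of 1/sqrt(1-x^2). *)
Definition reduced_integrand (z : C) : C :=
  K * (aw_sum q n a b c d z
    * (qpoch_inf (z * z * q) q * qpoch_inf (/ z * / z * q) q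
       * ihh q a z * ihh q c z * ihh q d z * ihh q b z * ihh q t z
       * (qpoch_inf (r * z) q * qpoch_inf (r * / z) q))).

Lemma integrand_reduced th :
  integrand (cis th) = RtoC (4 * (sin th * sin th)) * reduced_integrand (cis th).
Proof.
rewrite sin_sq_cis; unfold integrand, reduced_integrand, nr_weight, ibase.
rewrite (qpoch_inf_S q Hq1 (cis th * cis th)), (qpoch_inf_S q Hq1 (/ cis th * / cis th)); ring.
Qed.

Lemma panalytic_reduced rho : panalytic rho (fun x => reduced_integrand (cis (fst x))).
Proof.
assert (P1 := panalytic_cis rho); assert (P2 := panalytic_inv_cis rho).
unfold reduced_integrand; apply panalytic_mult; [apply panalytic_const|].
apply panalytic_mult.
- unfold aw_sum.
  apply (panalytic_csum rho (fun k x => pcoef q n (a * b * c * d) k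
   * (qpoch (a * cis (fst x)) q k * qpoch (a * / cis (fst x)) q k)
   / (qpoch (a * b) q k * qpoch (a * c) q k * qpoch (a * d) q k))).
  intros k; apply panalytic_mult; [|apply panalytic_const].
  apply panalytic_mult; [apply panalytic_const|].
  apply panalytic_mult; apply panalytic_qpoch; apply panalytic_mult; auto using panalytic_const.
- apply panalytic_mult; [|apply panalytic_mult].
  + do 5 (apply panalytic_mult; [|now apply panalytic_ihh_fixed]).
    apply panalytic_mult; apply panalytic_qpoch_inf; auto;
      apply panalytic_mult; auto using panalytic_const; apply panalytic_mult; auto.
  + apply panalytic_qpoch_inf; auto; apply panalytic_mult; auto using panalytic_const.
  + apply panalytic_qpoch_inf; auto; apply panalytic_mult; auto using panalytic_const.
Qed.

Lemma integrand_inv (z : C) : z <> 0 -> integrand (/ z) = integrand z.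
Proof.
intros Hz; assert (Ez : / / z = z) by (field; auto).
assert (E : aw_sum q n a b c d (/ z) = aw_sum q n a b c d z).
{ unfold aw_sum; apply csum_ext; intros k _; rewrite Ez; unfold Cdiv; ring. }
unfold integrand; rewrite E; unfold nr_weight, ibase, ihh; rewrite Ez; ring.
Qed.

(** The integrand divides by 0 at the end points, so the substitution is performed on
    [reduced_integrand]; the two versions agree on the open interval, which determines the
    integral. *)
Lemma integrand_cos I : is_CInt (fun th => integrand (cis th)) 0 (2 * PI) I ->
  is_CInt (fun x => integrand (cis (acos x)) / RtoC (sqrt (1 - x ^ 2))) (-1) 1 (I / 2).
Proof.
intros HI.
assert (D0 : cdisc 1 0) by (unfold cdisc; rewrite Cmod_0; lra).
assert (PA := panalytic_reduced 1).
assert (HC := panalytic_continuous 1 _ 0 PA D0).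
destruct (uclos_bounded _ _ _ (pmono_bounded 1) _ PA) as [B [_ HB]].
assert (HS : forall th, integrand (cis (2 * PI - th)) = integrand (cis th)).
{ intros th; replace (2 * PI - th)%R with (INR 1 * (2 * PI) + - th)%R by (simpl; ring).
  rewrite cis_plus, cis_2PI_nat, Cmult_1_l, <- cis_inv; apply integrand_inv, cis_neq0. }
assert (H2 := is_CInt_half _ _ HS HI).
assert (H3 : is_CInt (fun th => RtoC (4 * (sin th * sin th)) * reduced_integrand (cis th)) 0 PI (I / 2)).
{ apply is_CInt_ext with (2 := H2); intros th; apply integrand_reduced. }
assert (H4 := is_CInt_cos_subst (fun th => reduced_integrand (cis th)) B (I / 2) HC
  (fun th => HB (th, RtoC 0) D0) H3).
apply (is_RInt_ext (V := C_R_NormedModule)) with (2 := H4).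
rewrite Rmin_left, Rmax_right by lra; intros x Hx.
rewrite integrand_reduced, sin_acos by lra; unfold Rsqr.
replace (x ^ 2)%R with (x * x)%R by ring.
assert (P : (0 < sqrt (1 - x * x))%R) by (apply sqrt_lt_R0; nra).
rewrite !RtoC_mult; match goal with |- @eq _ ?y ?z => change (@eq C y z) end; field; apply RtoC_neq0; lra.
Qed.

End Final.

(** * The parameters of the 8-phi-7 as fractional powers of q *)

Section FractionalPowers.
Variables (q t beta : C) (alpha gamma : R) (n : nat).
Hypothesis Hq : (0 < Cmod q < 1)%R.

Let Hq0 : q <> 0 := q_neq0 q Hq.
Let h := cpow q (1 / 2).
Let u := rpow q alpha (1 / 2).
Let g := rpow q gamma (1 / 2).
Let m := mu q u (- g) (- (h * g)) n (t * beta).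
Let s := cpow q (INR n - 1 / 4) * rpow q alpha (1 / 4) * csqrt (rpow q gamma 1 * beta * t).

Lemma cpow_2n x : cpow q (2 * INR n + x) = q ^ (2 * n) * cpow q x.
Proof.
rewrite cpow_plus; f_equal.
replace (2 * INR n)%R with (INR (2 * n)) by (rewrite mult_INR; reflexivity).
now apply cpow_INR.
Qed.

Lemma cpow_n x : cpow q (INR n + x) = q ^ n * cpow q x.
Proof. now rewrite cpow_plus, cpow_INR. Qed.

Lemma mu_cpow : cpow q (2 * INR n - 1 / 2) * u * rpow q gamma 1 * beta * t = m.
Proof.
unfold Rminus; rewrite cpow_2n, rpow_1; fold g.
unfold m, mu.
replace (cpow q (- (1 / 2))) with (h / q); [unfold Cdiv; ring|].
rewrite cpow_opp by auto; fold h.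
assert (Nh : h <> 0) by now apply cpow_neq0.
assert (E : q = h * h) by now apply cpow_half_sq.
rewrite E; field; auto.
Qed.

Lemma mu_mult_q : cpow q (2 * INR n + 1 / 2) * u * rpow q gamma 1 * beta * t = m * q.
Proof.
rewrite <- mu_cpow.
replace (2 * INR n + 1 / 2)%R with ((2 * INR n - 1 / 2) + 1)%R by field.
rewrite cpow_plus, cpow_1 by auto; ring.
Qed.

(** Exponents of q add up, and the principal root of gamma beta t enters only through its square, so
    no compatibility of branches is involved. *)
Lemma sqrt_mu : s * s = m.
Proof.
rewrite <- mu_cpow; unfold s.
transitivity ((cpow q (INR n - 1 / 4) * cpow q (INR n - 1 / 4)) * (rpow q alpha (1 / 4) * rpow q alpha (1 / 4))
  * (csqrt (rpow q gamma 1 * beta * t) * csqrt (rpow q gamma 1 * beta * t))); [ring|].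
rewrite csqrt_sq, <- cpow_plus, <- rpow_plus.
replace (INR n - 1 / 4 + (INR n - 1 / 4))%R with (2 * INR n - 1 / 2)%R by field.
replace (1 / 4 + 1 / 4)%R with (1 / 2)%R by field.
fold u; ring.
Qed.

Lemma Phi_upper_eq : Phi_upper n beta t alpha gamma q = phi_upper q h u g t beta n s.
Proof.
assert (Nu : u <> 0) by now apply rpow_neq0.
assert (Nh : h <> 0) by now apply cpow_neq0.
assert (E : q = h * h) by now apply cpow_half_sq.
assert (S34 : cpow q (INR n + 3 / 4) = q * cpow q (INR n - 1 / 4)).
{ replace (INR n + 3 / 4)%R with ((INR n - 1 / 4) + 1)%R by field.
  rewrite cpow_plus, cpow_1 by auto; ring. }
unfold Phi_upper, phi_upper; fold m; fold u; fold g.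
rewrite mu_cpow, S34.
replace (q * cpow q (INR n - 1 / 4) * rpow q alpha (1 / 4) * csqrt (rpow q gamma 1 * beta * t))
  with (q * s) by (unfold s; ring).
rewrite cpow_INR, cpow_n, rpow_opp, cpow_opp, rpow_1 by auto; fold h; fold u; fold g.
repeat apply (f_equal2 cons); try (unfold Cdiv; ring); auto; field; auto.
Qed.

Lemma Phi_lower_eq : Phi_lower n beta t alpha gamma q = phi_lower q h u g t beta n s.
Proof.
assert (E : q = h * h) by now apply cpow_half_sq.
unfold Phi_lower, phi_lower; fold s; fold u; fold g.
rewrite cpow_INR, cpow_n, cpow_2n, !rpow_1, cpow_1 by auto; fold h; fold u; fold g.
repeat apply (f_equal2 cons); try ring; auto.
rewrite E at 2; ring.
Qed.

Lemma d_lower_eq :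
  d_lower n beta t alpha gamma q = [ u * t; - (g * t); - (h * g * t); m * q ].
Proof. unfold d_lower; fold u; fold g; fold h; now rewrite mu_mult_q. Qed.

End FractionalPowers.

Theorem corollary18 :
  forall (n : nat) (alpha gamma : R) (t beta q : C),
    (- (1 / 2) < alpha)%R -> (- (1 / 2) < gamma)%R ->
    (Cmod t < 1)%R -> (0 < Cmod q < 1)%R ->
    (* no zero denominator on the right-hand side *)
    nonvanishing (Phi_lower n beta t alpha gamma q) q ->
    nonvanishing (d_lower n beta t alpha gamma q) q ->
    is_RInt (V := C_R_NormedModule)
      (fun x : R =>
         gen_kernel beta t q x * cqJacobi n alpha gamma q x
         * (weight alpha gamma q x / RtoC (sqrt (1 - x ^ 2))))
      (-1) 1
      (2 * RtoC PI * gnorm n alpha gamma q * dcoef n beta t alpha gamma q).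
Proof.
intros n alpha gamma t beta q Halpha Hgamma Ht Hq HP Hd.
assert (Hq0 := q_neq0 q Hq); assert (Hq1 := proj2 Hq).
set (h := cpow q (1 / 2)); set (u := rpow q alpha (1 / 2)); set (g := rpow q gamma (1 / 2)).
set (m := mu q u (- g) (- (h * g)) n (t * beta)).
set (s := cpow q (INR n - 1 / 4) * rpow q alpha (1 / 4) * csqrt (rpow q gamma 1 * beta * t)).
assert (Hh : q = h * h) by now apply cpow_half_sq.
assert (Hh1 : (Cmod h < 1)%R) by now apply h_half_lt1.
assert (Hu : (Cmod u < 1)%R) by now apply rpow_lt1.
assert (Hg : (Cmod g < 1)%R) by now apply rpow_lt1.
assert (Hu0 : u <> 0) by now apply rpow_neq0.
assert (Hg0 : g <> 0) by now apply rpow_neq0.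
assert (Hs : s * s = m) by now apply sqrt_mu.
assert (EL := Phi_lower_eq q t beta alpha gamma n Hq); fold h u g s in EL.
assert (EU := Phi_upper_eq q t beta alpha gamma n Hq); fold h u g s in EU.
assert (ED := d_lower_eq q t beta alpha gamma n Hq); fold h u g m in ED.
rewrite EL in HP; rewrite ED in Hd.
(* The last entry of [d_lower] is m q, and the entries s, -s of [Phi_lower] at k = 0 give 1 - m <>
   0. Together they yield (m; q)_inf <> 0, so that the clearing factor can be divided out. *)
assert (Nmq : qpoch_inf (m * q) q <> 0).
{ apply qpoch_inf_neq0; auto; apply Hd; simpl; tauto. }
assert (Nm : 1 - m <> 0).
{ rewrite <- Hs; replace (1 - s * s) with ((1 - s) * (1 - - s)) by ring.
  apply Cmult_neq_0; apply Cminus_neq0, not_eq_sym; intros E.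
  - apply (HP s (or_introl eq_refl) O); rewrite E; simpl; ring.
  - apply (HP (- s) (or_intror (or_introl eq_refl)) O); rewrite E; simpl; ring. }
assert (Nmi : qpoch_inf m q <> 0) by (rewrite qpoch_inf_S by auto; now apply Cmult_neq_0).
assert (Hb1 : (Cmod (h * u) < 1)%R) by now apply Cmod_mult_lt1.
assert (Hc1 : (Cmod (- g) < 1)%R) by now rewrite Cmod_opp.
assert (Hd1 : (Cmod (- (h * g)) < 1)%R) by (rewrite Cmod_opp; now apply Cmod_mult_lt1).
assert (I := aw_sum_nr_int q h u g t beta n Hq Hh Hu Hg Ht Hu0 Hg0 Nmi).
rewrite (Cseries_aw_poly_term q h u g t beta n Hq Hh Hu Hg Ht Hu0 s Hs HP) in I.
apply (integrand_cos q u (h * u) (- g) (- (h * g)) t (t * beta) (qpoch (u * (h * u)) q n / qpoch q q n) n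
  Hq Hu Hb1 Hc1 Hd1 Ht) in I.
fold m in I; rewrite (jacobi_value q h u g t beta n Hq Hh Hu Hg Ht Hu0 _ Nm Nmq) in I.
set (F := qhyp _ _ _ _) in I.
assert (EF : Phi n beta t alpha gamma q = F) by (unfold Phi; rewrite EU, EL; reflexivity).
replace (2 * RtoC PI * gnorm n alpha gamma q * dcoef n beta t alpha gamma q)
  with (2 * RtoC PI * jacobi_norm q h u g n * jacobi_coef q h u g t beta n F).
- apply is_CInt_ext with (2 := I); intros x; unfold integrand, nr_weight.
  rewrite gen_kernel_ihh, cqJacobi_aw_sum, weight_aw by auto.
  fold h u g; unfold aw_weight, Cdiv; ring.
- f_equal; [f_equal|].
  + unfold gnorm, jacobi_norm, qpochs, qpochs_inf; cbn [fold_right].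
    rewrite !rpow_1; fold h u g.
    replace (u * (h * u)) with (h * (u * u)) by ring.
    replace (- g * - (h * g)) with (h * (g * g)) by ring.
    replace (h * u * - (h * g)) with (- (q * (u * g))) by (rewrite Hh; ring).
    replace (u * - g) with (- (u * g)) by ring.
    replace (u * - (h * g)) with (- (h * (u * g))) by ring.
    rewrite !Cmult_1_r, !Cmult_assoc; reflexivity.
  + unfold dcoef, jacobi_coef; rewrite ED, EF; unfold qpochs, qpochs_inf; cbn [fold_right].
    rewrite rpow_opp, !cpow_INR, !cpow_n, !rpow_1 by auto; fold h u g; fold m.
    replace (u * - g) with (- (u * g)) by ring.
    replace (u * - (h * g)) with (- (h * u * g)) by ring.
    replace (u * (t * beta) * q ^ n) with (q ^ n * u * beta * t) by ring.
    replace (- g * (t * beta) * q ^ n) with (- (q ^ n * g * beta * t)) by ring.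
    replace (- (h * g) * (t * beta) * q ^ n) with (- (q ^ n * h * g * beta * t)) by ring.
    replace (- (u * g) * - (h * g) * t * q ^ n) with (q ^ n * h * u * (g * g) * t) by ring.
    replace (- g * t) with (- (g * t)) by ring.
    replace (- (h * g) * t) with (- (h * g * t)) by ring.
    replace (q ^ n * (u * u) * (g * g)) with (q ^ n * (u * u * (g * g))) by ring.
    unfold Cdiv; rewrite !Cmult_1_r, !Cmult_assoc; reflexivity.
Qed.
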